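(* Let $\mu\in\mathcal P(S)$ be a solution to the recursive distributional equation $T(\mu)=\mu$. Then the following statements are equivalent. (i) The recursive tree process corresponding to $\gamma$ and $\mu$ is endogenous. (ii) The measure $\overline\mu^{(2)}$ is the unique fixed point of $T^{(2)}$ in the space $\mathcal P_{\rm sym}(S^2)_\mu$. (iii) $(T^{(n)})^t(\nu)\Rightarrow\overline\mu^{(n)}$ as $t\to\infty$, for all $n\in\overline{\mathbb N}_+$ and all $\nu\in\mathcal P(S^n)_\mu$.
   Context: Notation: $\mathbb N=\{0,1,2,\ldots\}$, $\overline{\mathbb N}=\mathbb N\cup\{\infty\}$, $\mathbb N_+=\{1,2,\ldots\}$, $\overline{\mathbb N}_+=\mathbb N_+\cup\{\infty\}$. For a Polish space $E$, $\mathcal P(E)$ is the space of Borel probability measures on $E$ with the topology of weak convergence (which is again Polish) and its Borel $\sigma$-field; $\Rightarrow$ denotes weak convergence. $E^0$ is a one-point space (containing the empty sequence) and $E^\infty$ is the space of infinite sequences in $E$ with the product topology. Setting: $S$ and $\Omega$ are Polish spaces, $r$ is a Borel probability measure on $\Omega$, $\kappa:\Omega\to\overline{\mathbb N}$ is measurable, $\Omega_k:=\{\omega:\kappa(\omega)=k\}$, and $\gamma$ assigns to each $\omega\in\Omega$ a map $\gamma[\omega]:S^{\kappa(\omega)}\to S$ such that for each $k\in\overline{\mathbb N}$ the map $\Omega_k\times S^k\ni(\omega,x)\mapsto\gamma[\omega](x)\in S$ is jointly measurable. For measurable $g:E^k\to E$ and $\mu\in\mathcal P(E)$, $T_g(\mu)$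 is the law of $g(X_1,\ldots,X_k)$ where $X_1,\ldots,X_k$ are i.i.d. with law $\mu$ (infinitely many $X_i$ if $k=\infty$). The map $T:\mathcal P(S)\to\mathcal P(S)$ is $T(\mu):=\int_\Omega r(d\omega)\,T_{\gamma[\omega]}(\mu)$. $n$-variate maps: for $n\in\overline{\mathbb N}_+$ and measurable $g:S^k\to S$, define $g^{(n)}:(S^n)^k\to S^n$ by $g^{(n)}(x):=(g(x^1),\ldots,g(x^n))$, where $x=(x_i^j)_{i=1,\ldots,k}^{j=1,\ldots,n}$ and $x^j:=(x^j_1,\ldots,x^j_k)$ (with the obvious modification if $n$ or $k$ is $\infty$). Then $T^{(n)}(\nu):=\int_\Omega r(d\omega)\,T_{\gamma[\omega]^{(n)}}(\nu)$ for $\nu\in\mathcal P(S^n)$, and $(T^{(n)})^t$ is its $t$-th iterate. $\mathcal P(S^n)_\mu$ is the set of $\nu\in\mathcal P(S^n)$ all of whose one-dimensional marginals equal $\mu$; $\mathcal P_{\rm sym}(S^n)_\mu$ is the set of those $\nu\in\mathcal P(S^n)_\mu$ that are invariant under permutations of the $n$ coordinates. $\overline\mu^{(n)}\in\mathcal P(S^n)$ is the law of $(X,\ldots,X)$ ($n$ copies), where $X$ has law $\mu$. Recursive tree processes: fix $d\in\overline{\mathbb N}_+$ with $\kappa(\omega)\le d$ for all $\omega$. Let $\mathbb T$ be the set of all finite words $\mathbf i=i_1\cdots i_t$ ($t\in\mathbb N$) over the alphabet $\{1,\ldots,d\}$ (over $\mathbb N_+$ if $d=\infty$), with $\varnothing$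 the empty word (root), $\mathbf i j$ denoting concatenation, and $|\mathbf i|$ the length. For $t\ge1$ put $\mathbb T_{(t)}:=\{\mathbf i:|\mathbf i|<t\}$, $\partial\mathbb T_{(t)}:=\{\mathbf i:|\mathbf i|=t\}$. If $T(\mu)=\mu$, a recursive tree process (RTP) corresponding to $\gamma$ and $\mu$ is a collection $(\omega_{\mathbf i},X_{\mathbf i})_{\mathbf i\in\mathbb T}$ of $\Omega\times S$-valued random variables such that: (a) the $(\omega_{\mathbf i})_{\mathbf i\in\mathbb T}$ are i.i.d. with law $r$; (b) for each $t\ge1$, the $(X_{\mathbf i})_{\mathbf i\in\partial\mathbb T_{(t)}}$ are i.i.d. with law $\mu$ and independent of $(\omega_{\mathbf i})_{\mathbf i\in\mathbb T_{(t)}}$; (c) almost surely $X_{\mathbf i}=\gamma[\omega_{\mathbf i}](X_{\mathbf i1},\ldots,X_{\mathbf i\kappa(\omega_{\mathbf i})})$ for all $\mathbf i\in\mathbb T$. Such a collection exists and its joint law is unique. The RTP is endogenous if $X_\varnothing$ is measurable with respect to the $\sigma$-field generated by $(\omega_{\mathbf i})_{\mathbf i\in\mathbb T}$, up to null sets (i.e. $X_\varnothing$ is a.s. equal to a measurable function of $(\omega_{\mathbf i})_{\mathbf i\in\mathbb T}$). *)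

(* Defs.v *)
From HB Require Import structures.
From mathcomp Require Import all_boot all_order all_algebra.
From mathcomp Require Import all_classical all_reals all_analysis.

Set Implicit Arguments.
Unset Strict Implicit.
Unset Printing Implicit Defensive.

Import Order.TTheory GRing.Theory Num.Theory.
Import numFieldNormedType.Exports.

Local Open Scope classical_set_scope.
Local Open Scope ring_scope.

(* Polish spaces: separable and completely metrizable.  The structure records
   the existence of a metric, not a choice of one.  Measurable types are
   pointed in the library, so the spaces here are nonempty; this excludes
   nothing, since each of them carries a probability measure. *)
Definition completely_metrizable (R : realType) (T : topologicalType) :=
  exists d : T -> T -> R,
    [/\ forall x y, d x y = 0 <-> x = y,
        forall x y, d x y = d y x,
        forall x y z, d x z <= d x y + d y z,
        forall x (A : set T),
          nbhs x A <-> exists2 e, 0 < e & [set y | d x y < e] `<=` A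
      & forall u : nat -> T,
          (forall e, 0 < e ->
            exists N, forall m n, (N <= m)%N -> (N <= n)%N -> d (u m) (u n) < e) ->
          exists l : T, u @ \oo --> l].

HB.mixin Record isPolish (R : realType) T & PointedTopological T := {
  polish_separable : exists2 D : set T, countable D & dense D ;
  polish_metrizable : completely_metrizable R T
}.

#[short(type="polishType")]
HB.structure Definition Polish (R : realType) :=
  {T of PointedTopological T & isPolish R T}.

Notation borel E := (g_sigma_algebraType (@open E)).

(* Measures are functions on all sets whose values matter only on measurable
   ones, so Leibniz equality would be too strong. *)
Definition eq_law d (T : measurableType d) (R : realType)
    (m1 m2 : set T -> \bar R) :=
  forall A, measurable A -> m1 A = m2 A.
Notation "m1 =m m2" := (eq_law m1 m2) (at level 70).

Definition weak_cvg (E : ptopologicalType) (R : realType)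
    (nu : nat -> probability (borel E) R) (nu' : probability (borel E) R) :=
  forall f : E -> R, continuous f -> (exists M, forall x, `|f x| <= M) ->
    (fun t => \int[nu t]_x (f x)%:E)%E @ \oo --> (\int[nu']_x (f x)%:E)%E.

(* N with infinity adjoined; None is infinity. *)
Definition natbar := option nat.

Definition below (k : natbar) (i : nat) : bool :=
  if k is Some n then (i < n)%N else true.

Definition le_natbar (k d : natbar) : bool :=
  match d, k with
  | None, _ => true
  | Some n, Some m => (m <= n)%N
  | Some _, None => false
  end.

Lemma below_le k d i : le_natbar k d -> below k i -> below d i.
Proof. by case: d k => [d|] [k|] //= kd ik; exact: leq_trans kd. Qed.

(* Coordinates are numbered from 0, so {1,...,k} is rendered {i | i < k}. *)
Definition idx (k : natbar) := {i : nat | below k i}.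

Definition widen_idx k d (kd : le_natbar k d) (i : idx k) : idx d :=
  exist _ (val i) (below_le kd (valP i)).

Definition pow (k : natbar) (E : Type) := prod_topology (fun _ : idx k => E).
HB.instance Definition _ k (E : ptopologicalType) :=
  Topological.copy (pow k E) (prod_topology (fun _ : idx k => E)).
HB.instance Definition _ k (E : ptopologicalType) :=
  isPointed.Build (pow k E) (fun=> point).

Definition restrict E (k : natbar) (x : pow None E) : pow k E :=
  fun i => x (exist _ (val i) isT).
Arguments restrict {E} k x.

Section independence.
Context d (W : measurableType d) (R : realType) (P : probability W R).
Context d' (T : measurableType d').

Definition independent (I : eqType) (D : set I) (X : I -> W -> T) :=
  forall (s : seq I) (A : I -> set T), uniq s ->
    (forall i, i \in s -> D i) -> (forall i, measurable (A i)) ->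
    P (\bigcap_(i in [set` s]) (X i @^-1` A i)) =
    (\prod_(i <- s) P (X i @^-1` A i))%E.

Definition iid (I : eqType) (D : set I) (X : I -> W -> T)
    (m : probability T R) :=
  (forall i, D i -> forall A, measurable A -> P (X i @^-1` A) = m A) /\
  independent D X.

(* The sigma-field on the sample space generated by (X_i)_{i in D}. *)
Definition sigma_gen (I : Type) (D : set I) (X : I -> W -> T) : set (set W) :=
  <<s [set X i @^-1` A | i in D & A in measurable] >>.

End independence.

Lemma open_borel (E : ptopologicalType) (A : set E) :
  open A -> measurable (A : set (borel E)).
Proof. by move=> oA; exact: sub_sigma_algebra. Qed.

Lemma continuous_borel (E F : ptopologicalType) (f : E -> F) : continuous f ->
  measurable_fun setT (f : borel E -> borel F).
Proof.
move=> /continuousP cf; apply: (@measurability _ _ (borel E) (borel F) setT f open) => //.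
by move=> _ [B oB <-]; rewrite setTI; apply: open_borel; exact: cf.
Qed.

Section pow_topology.
Context (E : ptopologicalType).

Lemma pow_cvg k (F : set_system (pow k E)) (x : pow k E) : Filter F ->
  (forall i (A : set E), nbhs (x i) A -> F [set y | A (y i)]) -> F --> x.
Proof.
move=> FF H; apply/cvg_sup => i B.
move=> [_ [[A oA <-] Ax] AB]; apply: filterS AB _; apply: H.
exact: open_nbhs_nbhs.
Qed.

Lemma pow_proj_continuous k (i : idx k) : continuous (fun x : pow k E => x i).
Proof. exact: (@proj_continuous _ (fun=> E) i). Qed.

Lemma continuous_pow (F : topologicalType) k (f : F -> pow k E) :
  (forall i, continuous (fun y => f y i)) -> continuous f.
Proof. by move=> cf y; apply: pow_cvg => i A /cf. Qed.

Lemma measurable_restrict k :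
  measurable_fun setT (@restrict E k : borel (pow None E) -> borel (pow k E)).
Proof.
apply: (@continuous_borel (pow None E) (pow k E)).
by apply: continuous_pow => i; exact: pow_proj_continuous.
Qed.

End pow_topology.

(* For Polish E the Borel sigma-field of a countable power is generated by the
   coordinates. *)
Section borel_pow.
Context (R : realType) (E : polishType R).

Lemma polish_basis : exists b : nat -> set E,
  (forall n, open (b n)) /\
  forall x A, nbhs x A -> exists n, b n x /\ b n `<=` A.
Proof.
have [D cD dD] := @polish_separable R E.
have [d [d0 dC dT dn _]] := @polish_metrizable R E.
have dxx x : d x x = 0 by apply/d0.
have oB x e : open [set y | d x y < e].
  rewrite openE => y /= xye; apply/dn; exists (e - d x y); first by rewrite subr_gt0.
  by move=> z /= yz; apply: (le_lt_trans (dT _ y _)); rewrite -ltrBrDl.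
have D0 : D !=set0.
  by have [x [_ Dx]] := dD setT (ex_intro _ point I) openT; exists x.
have /pfcard_geP[Df|[s]] := cD; first by have [x] := D0; rewrite Df.
pose b n := if unpickle n is Some (p, m) then
  [set y | d (s p) y < m.+1%:R^-1] else set0.
exists b; split.
  by move=> n; rewrite /b; case: (unpickle n) => [[p m]|]; [exact: oB|exact: open0].
move=> x A /dn[e e0 eA].
have [m me] : exists m : nat, m.+1%:R^-1 < e / 2.
  have e2 : 0 < e / 2 by rewrite divr_gt0.
  have [N _ /(_ N (leqnn N)) ?] := near_infty_natSinv_lt (PosNum e2).
  by exists N.
have m0 : 0 < m.+1%:R^-1 :> R by rewrite invr_gt0.
have [q [/= xq Dq]] : [set y | d x y < m.+1%:R^-1] `&` D !=set0.
  by apply: dD (oB _ _); exists x; rewrite /= dxx.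
have [p _ pq] : (s @` setT) q by apply: (@surj _ _ _ _ s).
exists (pickle (p, m)); rewrite /b pickleK pq; split; first by rewrite /= dC.
move=> y /= qy; apply: eA => /=; apply: (le_lt_trans (dT _ q _)).
by rewrite [ltRHS](splitr e); apply: ltrD; apply: lt_trans me.
Qed.

Lemma measurable_pow d (T : measurableType d) k (f : T -> pow k E) :
  (forall i, measurable_fun setT (fun t => f t i : borel E)) ->
  measurable_fun setT (f : T -> borel (pow k E)).
Proof.
move=> mf.
have [b [ob bb]] := polish_basis.
pose cyl (l : seq (idx k * nat)) : set (pow k E) :=
  [set x | forall p, p \in l -> b p.2 (x p.1)].
apply: (@measurability _ _ T (borel (pow k E)) setT f open) => //.
move=> _ [U oU <-]; rewrite setTI.
have -> : U = \bigcup_(l in [set l | cyl l `<=` U]) cyl l.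
  apply/seteqP; split=> [x Ux|x [l /= lU]]; last exact: lU.
  pose F : set_system (pow k E) := filter_from [set l | cyl l x] cyl.
  have FF : Filter F.
    apply: filter_from_filter; first by exists [::].
    move=> l1 l2 /= h1 h2; exists (l1 ++ l2).
      by move=> p; rewrite mem_cat => /orP[/h1|/h2].
    by move=> y h; split=> p pl; apply: h; rewrite mem_cat pl ?orbT.
  have : F --> x.
    apply: pow_cvg => i A /bb[n [bx bA]]; exists [:: (i, n)] => /=.
      by move=> p; rewrite inE => /eqP ->.
    by move=> y /(_ (i, n)) /=; rewrite mem_head => /(_ isT) /bA.
  move=> /(_ U) []; first by apply: open_nbhs_nbhs; split.
  by move=> l lx lU; exists l.
rewrite bigcup_mkcond preimage_bigcup.
apply: countable_bigcupT_measurable => [|l]; first exact: countableP.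
case: ifP => _; last by rewrite preimage_set0.
rewrite (_ : _ @^-1` _ = \bigcap_(p in [set` l]) ((fun t => f t p.1) @^-1` b p.2)) //.
apply: fin_bigcap_measurable => [|p _]; first exact: finite_seq.
by rewrite -[X in measurable X]setTI; apply: mf => //; exact: open_borel.
Qed.

End borel_pow.

(* The random maps w |-> gam[w] : E^(arity w) -> E.  The last field says that
   (w, x) |-> gam[w](x) is measurable on {arity = k} x E^k; since
   x : E^k has to be transported to E^(arity w), this is phrased through
   preimages. *)
Record random_map d (Omega : measurableType d) (E : ptopologicalType) :=
  RandomMap {
    arity : Omega -> natbar ;
    gam : forall w, pow (arity w) E -> E ;
    measurable_arity : forall k, measurable (arity @^-1` [set k]) ;
    measurable_gam : forall k (B : set (borel E)), measurable B ->
      measurable [set wx : Omega * borel (pow k E) |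
        exists e : k = arity wx.1,
          B (gam (eq_rect k (fun k' => pow k' E) wx.2 _ e))]
  }.
Arguments gam {d Omega E} r w.

Section rde_map.
Context d (Omega : measurableType d) (R : realType).
Variable r : probability Omega R.
Context (E : ptopologicalType).
Variables (g : random_map Omega E).
Local Notation law := (probability (borel E) R).

(* The law of a sequence of i.i.d. variables with law mu, characterized as the
   Borel law on E^oo under which the coordinates are i.i.d. with law mu.  For
   Polish E it exists and is unique; iid_law is used for such E only. *)
Definition iid_law (mu : law) : probability (borel (pow None E)) R :=
  get [set Q : probability (borel (pow None E)) R |
    iid Q setT (fun i x => x i : borel E) mu].

(* T_f(mu), the law of f(X_1,...,X_k): for every k, finite or not, X_1,...,X_k
   are the first k terms of one i.i.d. sequence. *)
Definition image_law k (f : pow k E -> E) (mu : law) : set (borel E) -> \bar R :=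
  fun A => iid_law mu [set x | A (f (restrict k x))].

Definition rde_map (mu : law) : set (borel E) -> \bar R :=
  fun A => (\int[r]_w image_law (gam g w) mu A)%E.

Let G (wx : Omega * borel (pow None E)) : borel E :=
  gam g wx.1 (restrict (arity g wx.1) wx.2).

Let mG : measurable_fun setT G.
Proof.
move=> _ B mB; rewrite setTI.
have -> : G @^-1` B = \bigcup_(k : natbar)
    ((fun wx => (wx.1, restrict k wx.2) : Omega * borel (pow k E)) @^-1`
     [set wx : Omega * borel (pow k E) | exists e : k = arity g wx.1,
        B (gam g wx.1 (eq_rect k (fun k' => pow k' E) wx.2 _ e))]).
  apply/seteqP; split=> [wx /= BG|[w x] [k _ [/= e]]].
    by exists (arity g wx.1) => //=; exists erefl.
  by subst k.
apply: countable_bigcupT_measurable => [|k]; first exact: countableP.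
have mh : measurable_fun setT (fun wx : Omega * borel (pow None E) =>
    (wx.1, restrict k wx.2) : Omega * borel (pow k E)).
  apply/measurable_fun_pairP; split; first exact: measurable_fst.
  by apply: (measurableT_comp (@measurable_restrict E k)); exact: measurable_snd.
by have := mh measurableT _ (measurable_gam g (k := k) mB); rewrite setTI.
Qed.

Let rde_mapE mu : rde_map mu = pushforward (r \x iid_law mu)%E G.
Proof.
apply/funext => A; apply: eq_integral => w _ /=.
by rewrite xsectionE.
Qed.

Let rde_map0 mu : rde_map mu set0 = 0%E.
Proof. by rewrite rde_mapE measure0. Qed.

Let rde_map_ge0 mu A : (0 <= rde_map mu A)%E.
Proof. by apply: integral_ge0 => w _; exact: measure_ge0. Qed.

Let rde_map_sigma_additive mu : semi_sigma_additive (rde_map mu).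
Proof. by rewrite rde_mapE; exact: measure_semi_sigma_additive. Qed.

HB.instance Definition _ mu := isMeasure.Build _ _ _ (rde_map mu)
  (rde_map0 mu) (rde_map_ge0 mu) (@rde_map_sigma_additive mu).

Let rde_mapT mu : rde_map mu setT = 1%E.
Proof. by rewrite rde_mapE /pushforward preimage_setT probability_setT. Qed.

HB.instance Definition _ mu :=
  Measure_isProbability.Build _ _ _ (rde_map mu) (rde_mapT mu).

Definition Tmap (mu : law) : law := rde_map mu.

End rde_map.

(* The n-variate map: x : (S^n)^k is a family x i j with i < k, j < n, and the
   j-th coordinate of gam^(n)[w](x) is gam[w] applied to (x i j)_i. *)
Section nvariate.
Context d (Omega : measurableType d) (R : realType) (S : polishType R).
Variables (n : natbar) (g : random_map Omega S).

Definition nvariate_gam w (x : pow (arity g w) (pow n S)) : pow n S :=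
  fun j => gam g w (fun i => x i j).

Lemma measurable_nvariate_gam k (B : set (borel (pow n S))) : measurable B ->
  measurable [set wx : Omega * borel (pow k (pow n S)) |
    exists e : k = arity g wx.1,
      B (nvariate_gam (eq_rect k (fun k' => pow k' (pow n S)) wx.2 _ e))].
Proof.
move=> mB.
pose D : set (Omega * borel (pow k (pow n S))) := [set wx | k = arity g wx.1].
have mD : measurable D.
  rewrite (_ : D = setT `&` fst @^-1` (arity g @^-1` [set k])).
    by apply: measurable_fst => //; exact: measurable_arity.
  by rewrite setTI; apply/seteqP; split=> wx /= /esym.
pose slice (j : idx n) (x : pow k (pow n S)) : pow k S := fun i => x i j.
have mslice j : measurable_fun setT
    (fun wx : Omega * borel (pow k (pow n S)) =>
      (wx.1, slice j wx.2) : Omega * borel (pow k S)).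
  apply/measurable_fun_pairP; split; first exact: measurable_fst.
  apply: (@measurableT_comp _ _ _ _ _ _ (slice j : borel _ -> borel (pow k S)));
    last exact: measurable_snd.
  apply: continuous_borel; apply: continuous_pow => i x.
  exact: (continuous_comp (@pow_proj_continuous _ k i x)
    (@pow_proj_continuous _ n j _)).
pose h wx : pow n S := if pselect (k = arity g wx.1) is left e then
  nvariate_gam (eq_rect k (fun k' => pow k' (pow n S)) wx.2 _ e) else point.
have mh : measurable_fun setT (h : Omega * borel (pow k (pow n S)) -> borel _).
  apply: measurable_pow => j _ C mC; rewrite setTI.
  pose Cj := [set wx : Omega * borel (pow k S) | exists e : k = arity g wx.1,
    C (gam g wx.1 (eq_rect k (fun k' => pow k' S) wx.2 _ e))].
  have mCj := mslice j measurableT _ (measurable_gam g (k := k) mC).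
  rewrite setTI -/Cj in mCj.
  rewrite (_ : _ @^-1` C = (fun wx => (wx.1, slice j wx.2)) @^-1` Cj `|`
      (~` D `&` [set _ | C point])).
    apply: measurableU => //; apply: measurableI; first exact: measurableC.
    have [?|?] := pselect (C point).
      by rewrite (_ : [set _ | _] = setT)//; apply/seteqP; split.
    by rewrite (_ : [set _ | _] = set0)//; apply/seteqP; split.
  apply/seteqP; split=> [[w x]|[w x]] /=; rewrite /h /=; case: pselect => /= e.
  - by move=> Ch; left; exists e; subst k.
  - by move=> Ch; right.
  - case=> [[e']|[] //]; rewrite (Prop_irrelevance e' e); by subst k.
  - by case=> [[]|[]].
rewrite (_ : [set _ | _] = D `&` (h @^-1` B)).
  by apply: measurableI => //; rewrite -[X in measurable X]setTI; exact: mh.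
apply/seteqP; split=> [wx|wx] /=; rewrite /h; case: pselect => /= e.
- by move=> [e']; rewrite (Prop_irrelevance e' e).
- by case.
- by move=> [_ ?]; exists e.
- by case.
Qed.

Definition nvariate : random_map Omega (pow n S) :=
  RandomMap (measurable_arity g) measurable_nvariate_gam.

End nvariate.

Section diagonal.
Context (R : realType) (S : polishType R) (n : natbar).

Definition diag (x : borel S) : borel (pow n S) := fun _ : idx n => x.

Lemma measurable_diag : measurable_fun setT diag.
Proof. by apply: measurable_pow => i; exact: measurable_id. Qed.

HB.instance Definition _ := isMeasurableFun.Build _ _ _ _
  diag measurable_diag.

Definition diag_law (mu : probability (borel S) R) :
    probability (borel (pow n S)) R :=
  distribution mu diag.

End diagonal.

Section marginals.
Context (R : realType) (S : ptopologicalType) (n : natbar).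

Definition has_marginals (mu : probability (borel S) R)
    (nu : probability (borel (pow n S)) R) :=
  forall (i : idx n) (A : set (borel S)), measurable A ->
    nu [set x | A (x i)] = mu A.

(* For infinite n all bijections of the index set are allowed; this amounts to
   invariance under finite permutations. *)
Definition symmetric_law (nu : probability (borel (pow n S)) R) :=
  forall s : idx n -> idx n, bijective s ->
    forall A : set (borel (pow n S)), measurable A ->
      nu [set x : pow n S | A (fun i => x (s i))] = nu A.

End marginals.

Section recursive_tree_process.
Context (R : realType) (S Omega : polishType R).
Variables (r : probability (borel Omega) R) (g : random_map (borel Omega) S).
Variables (d : natbar) (gd : forall w, le_natbar (arity g w) d).
Variable mu : probability (borel S) R.

(* Words over {i | i < d}; rcons i j is the word i followed by the letter j. *)
Local Notation word := (seq (idx d)).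

Section sample_space.
Context dW (W : measurableType dW) (P : probability W R).
Variables (om : word -> {RV P >-> borel Omega}) (X : word -> {RV P >-> borel S}).

Definition is_rtp :=
  [/\ iid P setT (fun i => om i : W -> borel Omega) r,
      forall t : nat, (1 <= t)%N ->
        iid P [set i | size i = t] (fun i => X i : W -> borel S) mu /\
        (forall A B,
          sigma_gen [set i | size i = t] (fun i => X i : W -> borel S) A ->
          sigma_gen [set i | (size i < t)%N] (fun i => om i : W -> borel Omega) B ->
          P (A `&` B) = P A * P B)%E
    & {ae P, forall w, forall i : word,
        X i w = gam g (om i w) (fun j => X (rcons i (widen_idx (gd _) j)) w)}].

(* X at the root is almost surely equal to a variable Y measurable with respect
   to the sigma-field generated by all the om i. *)
Definition rtp_endogenous :=
  exists Y : W -> S,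
    (forall B : set (borel S), measurable B ->
      sigma_gen setT (fun i => om i : W -> borel Omega) (Y @^-1` B)) /\
    {ae P, forall w, X [::] w = Y w}.

End sample_space.

(* The joint law of the process is unique and endogeny depends on that law
   only, so any realization may be considered. *)
Definition endogenous :=
  forall dW (W : measurableType dW) (P : probability W R)
    (om : word -> {RV P >-> borel Omega}) (X : word -> {RV P >-> borel S}),
  is_rtp om X -> rtp_endogenous om X.

End recursive_tree_process.

(* Main.v *)
From HB Require Import structures.
From mathcomp Require Import all_boot all_order all_algebra.
From mathcomp Require Import all_classical all_reals all_analysis.
From mathcomp Require Import ring lra measurable_realfun.
Require Import Defs.

Set Implicit Arguments.
Unset Strict Implicit.
Unset Printing Implicit Defensive.

Import Order.TTheory GRing.Theory Num.Theory.
Import numFieldNormedType.Exports.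

Local Open Scope classical_set_scope.
Local Open Scope ring_scope.

(* Let joint t A B be the probability that the two coordinates of the t-th iterate
   of T^(2), started from mu x mu, lie in A and B: in a tree cut at depth t they
   are two values at the root, computed with the same maps from independent
   leaves.  Each of the three statements is equivalent to coalescence:
   joint t A (~` A) tends to 0 for every measurable A.

   If the root value X is a function of the maps, the event X in A is close to an
   event that depends on finitely many levels of maps only, and joint t A (~` A)
   is at most twice the error.  Conversely, by Fubini there are deterministic
   leaves for which the root value in A and X in A differ with probability at
   most joint t A (~` A) + joint t (~` A) A; letting t grow fast and taking upper
   limits makes X in A an event of the maps.  It is enough to do this for
   countably many balls A, whose events determine X.

   The numbers joint t A A are nondecreasing in t, since their increments are
   limits of second moments of differences of empirical averages.  Hence
   joint t A B converges to a symmetric coupling of mu with itself that is fixed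
   by T^(2), and uniqueness of that fixed point is coalescence.  Coalescence
   controls every coupling of mu with itself by comparing both coordinates with
   an independent third one, and so gives the convergence of T^(n).

   Infinite product measures, couplings and the recursive tree process are all
   realized on the unit interval, from the consistent probabilities of finite
   patterns of ball events. *)

(** * Probabilities and independence *)

(** Coalescence is stated setwise, for all measurable sets, so that limits in t can be taken without
    topology: each [joint t] is finitely additive in each argument and has marginals [mu], and
    domination by [mu] replaces the missing continuity. It spreads convergence from a generating
    pi-system to the sigma-field, and it turns the setwise limit into the law of a pair of S-valued
    variables. Topology enters through the countable family [base] of balls: it generates the Borel
    sets and separates points, completeness makes abstract events that behave like balls come from a
    variable, and ramps inside the balls are the test functions for weak convergence. [endogenous]
    speaks of every realization of the tree process and would be vacuous without one, so the step
    from (i) to (ii) needs the process to be constructed; consistency of its finite stages is where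
    [T(mu) = mu] enters that construction. The step from (iii) back to (i) applies the convergence
    to n = 2 and [prod2 mu], for all realizations at once. *)

Section pr.
Context d (T : measurableType d) (R : realType).
Implicit Types P : probability T R.

(** Real values make [ring], [lra] and limits of real sequences available; [prE] is the way back to
    measures. *)
Definition pr P (A : set T) : R := fine (P A).

Lemma prE P A : measurable A -> P A = (pr P A)%:E.
Proof. by move=> mA; rewrite /pr fineK// fin_num_measure. Qed.

Lemma pr_ge0 P A : 0 <= pr P A.
Proof. by rewrite /pr fine_ge0. Qed.

Lemma pr_setT P : pr P setT = 1.
Proof. by rewrite /pr probability_setT. Qed.

Lemma pr_set0 P : pr P set0 = 0.
Proof. by rewrite /pr measure0. Qed.

Lemma pr_le P A B : measurable A -> measurable B -> A `<=` B ->
  pr P A <= pr P B.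
Proof.
move=> mA mB AB; rewrite -lee_fin -!prE//.
by apply: le_measure => //; rewrite inE.
Qed.

Lemma pr_le1 P A : measurable A -> pr P A <= 1.
Proof. by move=> mA; rewrite -(pr_setT P); apply: pr_le. Qed.

Lemma pr_split P A B : measurable A -> measurable B ->
  pr P A = pr P (A `&` B) + pr P (A `\` B).
Proof.
move=> mA mB; apply: EFin_inj; rewrite EFinD -!prE//.
- by rewrite addeC -measureDI.
- exact: measurableD.
- exact: measurableI.
Qed.

Lemma pr_setC P A : measurable A -> pr P (~` A) = 1 - pr P A.
Proof.
move=> mA; have := pr_split P measurableT mA.
rewrite setTI setTD pr_setT => ->; ring.
Qed.

Lemma pr_setU_le P A B : measurable A -> measurable B ->
  pr P (A `|` B) <= pr P A + pr P B.
Proof.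
move=> mA mB; rewrite (pr_split P (measurableU _ _ mA mB) mA).
rewrite setUK setDUl setDv set0U lerD2l.
apply: pr_le => //; exact: measurableD.
Qed.

Lemma pr_sub0 P A B : measurable A -> measurable B -> A `<=` B ->
  pr P B = 0 -> pr P A = 0.
Proof.
by move=> mA mB AB B0; apply/eqP; rewrite eq_le pr_ge0 andbT -B0 pr_le.
Qed.

Lemma pr_eq0 P A : measurable A -> pr P A = 0 -> P A = 0%E.
Proof. by move=> mA A0; rewrite prE// A0. Qed.

Lemma pr_cvg_up P (F : (set T)^nat) : (forall i, measurable (F i)) ->
  nondecreasing_seq F -> pr P (F n) @[n --> \oo] --> pr P (\bigcup_n F n).
Proof.
move=> mF ndF.
have mU : measurable (\bigcup_n F n) by exact: bigcup_measurable.
apply: (@fine_cvg _ _ _ _ (fun n => P (F n))).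
by rewrite -prE//; exact: nondecreasing_cvg_mu.
Qed.

Lemma pr_cvg_down P (F : (set T)^nat) : (forall i, measurable (F i)) ->
  nonincreasing_seq F -> pr P (F n) @[n --> \oo] --> pr P (\bigcap_n F n).
Proof.
move=> mF ndF.
have mU : measurable (\bigcap_n F n) by exact: bigcapT_measurable.
have F0 : (P (F 0%N) < +oo)%E by rewrite prE// ltry.
apply: (@fine_cvg _ _ _ _ (fun n => P (F n))).
by rewrite -prE//; exact: nonincreasing_cvg_mu.
Qed.

Lemma prU_null P (F : (set T)^nat) : (forall i, measurable (F i)) ->
  (forall i, pr P (F i) = 0) -> pr P (\bigcup_n F n) = 0.
Proof.
move=> mF F0; apply/eqP; rewrite /pr fine_eq0 ?fin_num_measure//; last first.
  exact: bigcup_measurable.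
apply/eqP; apply/negligibleP; first exact: bigcup_measurable.
by apply: negligible_bigcup => k; apply/negligibleP => //; apply: pr_eq0.
Qed.

Lemma pr_null_countable P (I : countType) (F : I -> set T) :
  (forall i, measurable (F i)) ->
  (forall i, pr P (F i) = 0) -> pr P (\bigcup_i F i) = 0.
Proof.
move=> mF F0.
rewrite (_ : \bigcup_i F i =
    \bigcup_n if unpickle n is Some i then F i else set0).
  by apply: prU_null => n; case: unpickle => //; rewrite pr_set0.
apply/seteqP; split=> [x [i _ Fx]|x [n _]].
  by exists (pickle i) => //; rewrite pickleK.
by case: unpickle => // i; exists i.
Qed.

Lemma prE_bigcup P (F : (set T)^nat) : (forall i, measurable (F i)) ->
  trivIset setT F ->
  (pr P (\bigcup_n F n))%:E = (\sum_(0 <= n <oo) (pr P (F n))%:E)%E.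
Proof.
move=> mF tF; rewrite -prE; last exact: bigcup_measurable.
rewrite measure_semi_bigcup//; last exact: bigcup_measurable.
by apply: eq_eseriesr => n _; exact: prE.
Qed.

(** With [C] fixed, complements and countable disjoint unions preserve the product formula;
    [sub_pi_lambda] then carries it from a pi-system to the generated sigma-field. *)
Lemma dynkin_indep P (C : set T) : measurable C ->
  dynkin [set A | measurable A /\ pr P (A `&` C) = pr P A * pr P C].
Proof.
move=> mC; split.
- by split => //; rewrite setTI pr_setT mul1r.
- move=> A [mA eA]; split; first exact: measurableC.
  rewrite pr_setC// mulrBl mul1r -eA.
  rewrite (pr_split P mC mA) setDE [C `&` A]setIC [C `&` ~` A]setIC; ring.
- move=> F tF FG.
  have mF n : measurable (F n) by have [] := FG n.
  have mFC n : measurable (F n `&` C) by apply: measurableI.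
  split; first exact: bigcup_measurable.
  apply: EFin_inj; rewrite setI_bigcupl EFinM !prE_bigcup//; last first.
    by under eq_fun do rewrite setIC; exact: trivIset_setIl.
  rewrite muleC -nneseriesZl//; last by move=> n _; rewrite lee_fin pr_ge0.
  apply: eq_eseriesr => n _.
  by rewrite -EFinM mulrC; have [_ ->] := FG n.
Qed.

Lemma dynkin_eq (P Q : probability T R) :
  dynkin [set A | measurable A /\ pr P A = pr Q A].
Proof.
split.
- by split => //; rewrite !pr_setT.
- by move=> A [mA eA]; split; [exact: measurableC|rewrite !pr_setC// eA].
- move=> F tF FG.
  have mF n : measurable (F n) by have [] := FG n.
  split; first exact: bigcup_measurable.
  apply: EFin_inj; rewrite !prE_bigcup//.
  by apply: eq_eseriesr => n _; have [_ ->] := FG n.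
Qed.

Lemma sub_pi_lambda (G H : set (set T)) : setI_closed G -> dynkin H ->
  G `<=` H -> <<s G >> `<=` H.
Proof.
by move=> GI DH GH; apply: (lambda_system_subset GI _ GH) => //;
  exact/dynkin_lambda_system.
Qed.

Lemma prob_unique (G : set (set T)) (P Q : probability T R) :
  measurable `<=` <<s G >> -> G `<=` measurable -> setI_closed G ->
  (forall A, G A -> pr P A = pr Q A) -> P =m Q.
Proof.
move=> mG Gm GI PQ A mA; rewrite !prE//; congr EFin.
have GH : G `<=` [set A | measurable A /\ pr P A = pr Q A].
  by move=> B GB; split; [exact: Gm|exact: PQ].
by have [] := sub_pi_lambda GI (dynkin_eq P Q) GH (mG A mA).
Qed.

End pr.

Lemma eq_lawP d (T : measurableType d) (R : realType) (P Q : probability T R) :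
  P =m Q <-> forall A, measurable A -> pr P A = pr Q A.
Proof.
split=> PQ A mA; first by rewrite /pr PQ.
by rewrite !prE// PQ.
Qed.

Section law.
Context d (T : measurableType d) (R : realType) (P : probability T R).
Context d' (T' : measurableType d').

Definition law (f : T -> T') (mf : measurable_fun setT f) : probability T' R :=
  distribution P (mfun_Sub (mem_set mf)).

Lemma lawE f (mf : measurable_fun setT f) A : law mf A = P (f @^-1` A).
Proof. by []. Qed.

Lemma pr_law f (mf : measurable_fun setT f) A : pr (law mf) A = pr P (f @^-1` A).
Proof. by []. Qed.

Lemma measurable_pre (f : T -> T') : measurable_fun setT f ->
  forall A, measurable A -> measurable (f @^-1` A).
Proof. by move=> mf A mA; rewrite -[X in measurable X]setTI; exact: mf. Qed.

End law.

Section indep.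
Context d (T : measurableType d) (R : realType) (P : probability T R).

Definition indep_fields (I : choiceType) (F : I -> set (set T)) :=
  forall (s : seq I) (A : I -> set T), uniq s ->
    (forall i, i \in s -> F i (A i)) ->
    pr P (\bigcap_(i in [set` s]) A i) = \prod_(i <- s) pr P (A i).

Lemma indep_fieldsW (I : choiceType) (F G : I -> set (set T)) :
  (forall i, F i `<=` G i) -> indep_fields G -> indep_fields F.
Proof. by move=> FG iG s A us FA; apply: iG => // i /FA /FG. Qed.

Lemma bigcap_seq_cons (I : choiceType) (U : Type) (i : I) s (A : I -> set U) :
  \bigcap_(j in [set` i :: s]) A j = A i `&` \bigcap_(j in [set` s]) A j.
Proof. by rewrite !bigcap_seq big_cons. Qed.

(** The pi-systems are exchanged for their sigma-fields one index at a time, each time by a Dynkin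
    argument against the intersection of all other events. *)
Lemma indep_sigma (I : choiceType) (F : I -> set (set T)) :
  (forall i, F i `<=` measurable) -> (forall i, setI_closed (F i)) ->
  indep_fields F -> indep_fields (fun i => <<s F i >>).
Proof.
move=> Fm FI iF.
have sFm i : <<s F i >> `<=` measurable.
  by apply: smallest_sub => //; exact: sigma_algebra_measurable.
(* Indices in [s1] already carry events of the sigma-field, those in [s2] still carry generators. *)
suff H s1 s2 (A : I -> set T) : uniq (s1 ++ s2) ->
    (forall i, i \in s1 -> <<s F i >> (A i)) ->
    (forall i, i \in s2 -> F i (A i)) ->
    pr P (\bigcap_(i in [set` s1 ++ s2]) A i) = \prod_(i <- s1 ++ s2) pr P (A i).
  by move=> s A us FA; have := H s [::] A; rewrite cats0; apply.
elim: s1 s2 A => [|i s1 IH] s2 A us sA FA; first exact: iF.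
have mA j : j \in s1 ++ s2 -> measurable (A j).
  rewrite mem_cat => /orP[js|/FA/Fm //].
  by apply: (sFm j); apply: sA; rewrite inE js orbT.
rewrite cat_cons bigcap_seq_cons big_cons.
set C := \bigcap_(_ in _) _.
have mC : measurable C by apply: fin_bigcap_measurable => [|j /mA].
have us12 : uniq (s1 ++ s2) by move: us => /= /andP[].
have inotin j : j \in s1 ++ s2 -> (j == i) = false.
  by move=> js; apply/eqP => ji; move: us; rewrite /= -ji js.
have CE : pr P C = \prod_(j <- s1 ++ s2) pr P (A j).
  by apply: IH => // j js; apply: sA; rewrite inE js orbT.
rewrite -CE.
have Ai : <<s F i >> (A i) by apply: sA; rewrite mem_head.
suff FH : F i `<=` [set A | measurable A /\ pr P (A `&` C) = pr P A * pr P C].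
  by have [] := sub_pi_lambda (FI i) (dynkin_indep P mC) FH Ai.
move=> B FB; split; first exact: Fm FB.
pose A' j := if j == i then B else A j.
have A'E j : j \in s1 ++ s2 -> A' j = A j by rewrite /A' => /inotin ->.
have := IH (i :: s2) A'.
have pe : perm_eq (s1 ++ i :: s2) (i :: s1 ++ s2).
  by rewrite -cat1s perm_catCA.
rewrite (perm_uniq pe) => /(_ us).
have -> : \bigcap_(j in [set` s1 ++ i :: s2]) A' j = B `&` C.
  rewrite (_ : [set` _] = [set` i :: s1 ++ s2]); last first.
    by apply/seteqP; split=> x /=; rewrite (perm_mem pe).
  rewrite bigcap_seq_cons {1}/A' eqxx; congr (_ `&` _).
  by apply: eq_bigcapr => j; exact: A'E.
have A'i : A' i = B by rewrite /A' eqxx.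
rewrite (perm_big _ pe)/= big_cons A'i CE => -> //.
- by congr (_ * _); apply: eq_big_seq => j /A'E ->.
- by move=> j js; rewrite A'E ?mem_cat ?js//; apply: sA; rewrite inE js orbT.
- move=> j; rewrite inE => /orP[/eqP ->|js]; first by rewrite /A' eqxx.
  by rewrite A'E ?mem_cat ?js ?orbT//; exact: FA.
Qed.

(** Within one group, finite intersections form a pi-system that generates the field of the group.
    Independence of such intersections is independence of the [F i] along the concatenated index
    lists, and [indep_sigma] does the rest. *)
Lemma indep_group (I K : choiceType) (F : I -> set (set T)) (h : I -> K) :
  (forall i, F i `<=` measurable) -> (forall i, setI_closed (F i)) ->
  (forall i, F i setT) -> indep_fields F ->
  indep_fields (fun k => <<s \bigcup_(i in [set i | h i = k]) F i >>).
Proof.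
move=> Fm FI FT iF.
pose G k : set (set T) := [set C | exists s (A : I -> set T),
  [/\ uniq s, forall i, i \in s -> h i = k, forall i, i \in s -> F i (A i)
    & C = \bigcap_(i in [set` s]) A i]].
have FG k : \bigcup_(i in [set i | h i = k]) F i `<=` G k.
  move=> C [i /= hi FC]; exists [:: i], (fun=> C); split=> //.
  - by move=> j; rewrite inE => /eqP ->.
  - by move=> j; rewrite inE => /eqP ->.
  - by rewrite bigcap_seq big_seq1.
apply: (@indep_fieldsW _ _ (fun k => <<s G k >>)).
  by move=> k; apply: sub_sigma_algebra2; exact: FG.
apply: indep_sigma.
- move=> k _ [s [A [us hs FA ->]]].
  by apply: fin_bigcap_measurable => // i /FA; exact: Fm.
- move=> k _ _ [s [A [us hs FA ->]]] [s' [A' [us' hs' FA' ->]]].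
  exists (undup (s ++ s')), (fun i => (if i \in s then A i else setT) `&`
    (if i \in s' then A' i else setT)); split.
  + exact: undup_uniq.
  + by move=> i; rewrite mem_undup mem_cat => /orP[/hs|/hs'].
  + move=> i _; apply: FI; case: ifP => //; [exact: FA|exact: FA'].
  + apply/seteqP; split=> [x [/= h1 h2] i /= _|x /= H].
      by split; case: ifP => //; [exact: h1|exact: h2].
    split=> i /= i_s; have := H i; rewrite /= mem_undup mem_cat i_s ?orbT;
      by move=> /(_ isT)[].
- move=> s C us GC.
  have /choice[f Hf] k : exists sA : seq I * (I -> set T), k \in s ->
     [/\ uniq sA.1, forall i, i \in sA.1 -> h i = k,
       forall i, i \in sA.1 -> F i (sA.2 i) &
       C k = \bigcap_(i in [set` sA.1]) sA.2 i].
    have [/GC[t [A H]]|] := boolP (k \in s); first by exists (t, A).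
    by exists ([::], fun=> setT).
  pose L := flatten [seq (f k).1 | k <- s].
  pose B i := (f (h i)).2 i.
  have -> : \bigcap_(k in [set` s]) C k = \bigcap_(i in [set` L]) B i.
    apply/seteqP; split=> [x H i /= /flattenP[_ /mapP[k ks ->] ik]|x H k /= ks].
      have [_ hk _ CE] := Hf k ks; have := H k ks; rewrite CE.
      by rewrite /B (hk _ ik); apply.
    have [_ hk _ ->] := Hf k ks => i /= ik.
    have := H i; rewrite /B (hk _ ik); apply => /=.
    by apply/flattenP; exists (f k).1 => //; apply/mapP; exists k.
  rewrite iF.
  + rewrite big_flatten big_map/=; apply: eq_big_seq => k ks.
    have [uk hk Fk CE] := Hf k ks; rewrite CE iF//.
    by apply: eq_big_seq => i ik; rewrite /B (hk _ ik).
  (* A tautology, kept as a hypothesis so that the induction on the list of groups remembers that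
     its members lie in [s]. *)
  + have : forall k, k \in s -> k \in s by [].
    rewrite /L; elim: {1 2 4}s us => //= k t IH /andP[kt ut] st.
    rewrite cat_uniq; have [-> hk _ _] := Hf k (st _ (mem_head _ _)).
    rewrite IH ?andbT//=; last by move=> j jt; apply: st; rewrite inE jt orbT.
    apply/hasPn => i /flattenP[_ /mapP[j jt ->] ij].
    apply/negP => /hk hik; have js : j \in s by apply: st; rewrite inE jt orbT.
    by have [_ hj _ _] := Hf j js; move: kt; rewrite -hik (hj _ ij) jt.
  + move=> i /flattenP[_ /mapP[k ks ->] ik].
    by have [_ hk FA _] := Hf k ks; rewrite /B (hk _ ik); exact: FA.
Qed.

End indep.

(** * Patterns of events on the unit interval *)

Section content.
Context (R : realType).

Definition pat (K : eqType) U (D : K -> set U) (l : seq (K * bool)) : set U :=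
  [set u | forall kb, kb \in l -> (D kb.1 u <-> kb.2)].

(* p l is a candidate for the probability that D k holds for (k, true) in l and
   fails for (k, false) in l. *)
Record lit_content (K : eqType) (p : seq (K * bool) -> R) : Prop := LitContent {
  lit_content0 : p [::] = 1 ;
  lit_content_ge0 : forall l, 0 <= p l ;
  lit_content_split : forall k l, p l = p ((k, true) :: l) + p ((k, false) :: l) ;
  lit_content_ext : forall l l', l =i l' -> p l = p l' }.

Lemma pat_nil (K : eqType) U (D : K -> set U) : pat D [::] = setT.
Proof. by apply/seteqP; split. Qed.

Lemma pat_cons (K : eqType) U (D : K -> set U) k b l :
  pat D ((k, b) :: l) = (if b then D k else ~` D k) `&` pat D l.
Proof.
apply/seteqP; split=> [u H|u [kb H] kb']; last first.
  by rewrite inE => /orP[/eqP -> /=|/H //]; case: (b) kb => /=; split.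
split; last by move=> kb kbl; apply: H; rewrite inE kbl orbT.
by have := H (k, b) (mem_head _ _); case: (b) => /= -[h1 h2]; [exact: h2|move=> /h1].
Qed.

Lemma eq_pat (K : eqType) U (D : K -> set U) l l' : l =i l' -> pat D l = pat D l'.
Proof.
by move=> ll; apply/seteqP; split=> u H kb; [rewrite -ll|rewrite ll] => /H.
Qed.

Lemma pat_cat (K : eqType) U (D : K -> set U) l l' :
  pat D (l ++ l') = pat D l `&` pat D l'.
Proof.
apply/seteqP; split=> [u H|u [H H'] kb]; last by rewrite mem_cat => /orP[/H|/H'].
by split=> kb kbl; apply: H; rewrite mem_cat kbl ?orbT.
Qed.

Lemma pat_map (K K' : eqType) U (D : K -> set U) (h : K' -> K) l :
  pat D [seq (h x.1, x.2) | x <- l] = pat (D \o h) l.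
Proof.
apply/seteqP; split=> u H; last by move=> _ /mapP[x xl ->]; exact: H.
by move=> x xl; apply: (H (h x.1, x.2)); apply/mapP; exists x.
Qed.

Lemma lit_content_map (K K' : eqType) (p : seq (K * bool) -> R) (h : K' -> K) :
  lit_content p -> lit_content (fun l => p [seq (h x.1, x.2) | x <- l]).
Proof.
move=> cp; split=> [|l|k l|l l' ll] /=; first exact: lit_content0 cp.
- exact: lit_content_ge0.
- exact: lit_content_split.
- by apply: lit_content_ext => //; exact: eq_mem_map.
Qed.

Lemma measurable_pat_in d (T : measurableType d) (K : eqType) (D : K -> set T)
    (l : seq (K * bool)) :
  (forall kb, kb \in l -> measurable (D kb.1)) -> measurable (pat D l).
Proof.
elim: l => [|[k b] l IH] mD; first by rewrite pat_nil.
rewrite pat_cons; apply: measurableI; last first.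
  by apply: IH => kb kl; apply: mD; rewrite inE kl orbT.
have mk := mD (k, b) (mem_head _ _).
by case: (b); [exact: mk|exact: measurableC].
Qed.

Lemma measurable_pat d (T : measurableType d) (K : eqType) (D : K -> set T) l :
  (forall k, measurable (D k)) -> measurable (pat D l).
Proof. by move=> mD; apply: measurable_pat_in. Qed.

Lemma pat_lit_content d (T : measurableType d) (P : probability T R)
  (K : eqType) (D : K -> set T) : (forall k, measurable (D k)) ->
  lit_content (fun l => pr P (pat D l)).
Proof.
move=> mD; split.
- by rewrite pat_nil pr_setT.
- by move=> l; exact: pr_ge0.
- move=> k l; rewrite !pat_cons (@pr_split _ _ _ _ _ (D k))//.
    by rewrite setDE ![_ `&` pat _ _]setIC.
  exact: measurable_pat.
- by move=> l l' /eq_pat ->.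
Qed.

(** Adding either literal leaves the set of literals unchanged, so splitting at [k] reads p l = p l
    + p l. *)
Lemma lit_content_clash (K : eqType) (p : seq (K * bool) -> R) k l :
  lit_content p -> (k, true) \in l -> (k, false) \in l -> p l = 0.
Proof.
move=> cp kt kf; have := lit_content_split cp k l.
rewrite -!(@lit_content_ext _ _ cp l) => [H||].
- by apply: (addrI (p l)); rewrite addr0.
- by move=> x; rewrite inE; case: eqP => // ->.
- by move=> x; rewrite inE; case: eqP => // ->.
Qed.

Definition unif01 : probability (measurableTypeR R) R := uniform_prob (@ltr01 R).

Lemma pr_unif01 (a b : R) : 0 <= a -> a <= b -> b <= 1 ->
  pr unif01 `[a, b[%classic = b - a.
Proof.
move=> a0 ab b1; rewrite /pr (_ : unif01 _ =
  (\int[lebesgue_measure]_(x in `[a, b[) (uniform_pdf 0 1 x)%:E)%E)//.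
rewrite integral_uniform_pdf.
have -> : `[a, b[ `&` `[0, 1] = `[a, b[%classic :> set R.
  apply/setIidl => x /=; rewrite !in_itv/= => /andP[ax xb].
  by rewrite (le_trans a0 ax) (le_trans (ltW xb) b1).
rewrite (eq_integral (fun=> 1%:E)); last first.
  move=> x; rewrite inE/= in_itv/= => /andP[ax xb].
  by rewrite /uniform_pdf (le_trans a0 ax) (le_trans (ltW xb) b1)/= subr0 invr1.
rewrite integral_cst//= mul1e lebesgue_measure_itv/= lte_fin.
case: ltP => //= ba.
by have -> : a = b by [apply/eqP; rewrite eq_le ab]; rewrite subrr.
Qed.

Section nested_intervals.
Variables (p : seq (nat * bool) -> R) (cp : lit_content p).

Let p0 := lit_content0 cp.
Let p_ge0 := lit_content_ge0 cp.
Let pD := lit_content_split cp.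

(** The most recent digit is the head of the list. The digit [true] selects the left part of an
    interval, so only [false] moves the left end. *)
Fixpoint left_end (l : seq (nat * bool)) : R :=
  match l with
  | [::] => 0
  | (k, b) :: l' => left_end l' + (if b then 0 else p ((k, true) :: l'))
  end.

Fixpoint digits (n : nat) (u : R) : seq (nat * bool) :=
  if n is n'.+1 then
    let l := digits n' u in (n', u < left_end l + p ((n', true) :: l)) :: l
  else [::].

Fixpoint full (n : nat) (l : seq (nat * bool)) : bool :=
  match n, l with
  | 0, [::] => true
  | n'.+1, (k, _) :: l' => (k == n') && full n' l'
  | _, _ => false
  end.

Definition subitv l : set R := `[left_end l, left_end l + p l[%classic.

Lemma full_digits n u : full n (digits n u).
Proof. by elim: n => //= n ->; rewrite eqxx. Qed.

Lemma full_mem n l k : full n l -> (k < n)%N -> exists b, (k, b) \in l.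
Proof.
elim: n l => // n IH [|[j b] l] //= /andP[/eqP -> fl].
rewrite ltnS leq_eqVlt => /orP[/eqP ->|/(IH _ fl)[c kc]].
  by exists b; rewrite mem_head.
by exists c; rewrite inE kc orbT.
Qed.

Lemma digits_itv n u : 0 <= u -> u < 1 -> subitv (digits n u) u.
Proof.
move=> u0 u1; rewrite /subitv /=; elim: n => [|n IH] /=.
  by rewrite in_itv /= add0r p0 u0.
move: IH; rewrite !in_itv/= => /andP[h1 h2].
case: ltP => h3; first by rewrite addr0 h1.
by rewrite h3 -addrA -pD.
Qed.

Lemma subitv_sub n l : full n l -> 0 <= left_end l /\ left_end l + p l <= 1.
Proof.
elim: n l => [[|//] _|n IH [//|[k b] l] /= /andP[_ /IH[h1 h2]]] /=.
  by rewrite add0r p0.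
have := pD k l; have := p_ge0 ((k, true) :: l); have := p_ge0 ((k, false) :: l).
by case: b; split; lra.
Qed.

Lemma itv_digits n l u : full n l -> subitv l u -> digits n u = l.
Proof.
rewrite /subitv; elim: n l => [[]//|n IH [//|[k b] l]] /= /andP[/eqP -> fl].
rewrite in_itv/= => /andP[h1 h2].
have h := pD n l; have h3 := p_ge0 ((n, true) :: l).
have h4 := p_ge0 ((n, false) :: l).
rewrite (IH l fl) /=; last by rewrite in_itv/=; case: (b) h1 h2 => *; lra.
by congr ((_, _) :: _); case: (b) h1 h2 => *; [apply/idP|apply/negbTE]; lra.
Qed.

(* Splitting the interval of every pattern l of length n in the ratio
   p ((n, true) :: l) : p ((n, false) :: l) makes its length p l; digit_set n
   collects the left parts. *)
Definition digit_set (n : nat) : set (measurableTypeR R) :=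
  \bigcup_(l in [set l | full n l]) subitv ((n, true) :: l).

Lemma measurable_digit_set n : measurable (digit_set n).
Proof.
rewrite /digit_set bigcup_mkcond.
apply: countable_bigcupT_measurable => [|l]; first exact: countableP.
by case: ifP => // _; exact: measurable_itv.
Qed.

Lemma digit_setE n u : 0 <= u -> u < 1 ->
  digit_set n u <-> u < left_end (digits n u) + p ((n, true) :: digits n u).
Proof.
move=> u0 u1; have H := @digits_itv n.+1 u u0 u1; split.
  move=> [l /= fl ul]; have : digits n.+1 u = (n, true) :: l.
    by apply: itv_digits => //=; rewrite eqxx.
  by move=> /= [->].
move=> h; exists (digits n u); first exact: full_digits.
by move: H; rewrite /= h.
Qed.

Lemma pat_digit_set n l u : 0 <= u -> u < 1 -> full n l ->
  pat digit_set l u <-> digits n u = l.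
Proof.
move=> u0 u1; elim: n l => [[|//] _|n IH [//|[k b] l] /= /andP[/eqP -> fl]].
  by rewrite pat_nil.
rewrite pat_cons; split.
  move=> [h /(IH _ fl) dl]; rewrite /= dl; congr ((_, _) :: _).
  have := digit_setE n u0 u1; rewrite dl => e.
  by case: b h => /= h; [apply/idP/e|apply/negP => /e].
rewrite /= => -[bE dl]; split; last exact/(IH _ fl).
have := digit_setE n u0 u1; rewrite bE.
by case: (b) => -[h1 h2]; [exact: h2|move=> /h1].
Qed.

Lemma pr_full n l : full n l -> pr unif01 (pat digit_set l) = p l.
Proof.
move=> fl; have mD := measurable_pat l measurable_digit_set.
have [h1 h2] := subitv_sub fl; have pl := p_ge0 l.
have E : pr unif01 (subitv l) = p l.
  rewrite pr_unif01//; lra.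
(* The digits describe points of [0, 1[ only; everything else is a null set. *)
pose J : set (measurableTypeR R) := `[0, 1[%classic.
have mJ : measurable J by exact: measurable_itv.
have U : pr unif01 J = 1 by rewrite pr_unif01//; lra.
rewrite (pr_split _ mD mJ) -[RHS]addr0; congr (_ + _).
  rewrite -[RHS]E; congr pr; apply/seteqP; split=> u /=.
    move=> [pu]; rewrite /J/= in_itv/= => /andP[u0 u1].
    by move/(pat_digit_set u0 u1 fl): pu => <-; exact: digits_itv.
  move=> lu; have /andP[u1 u2] : (left_end l <= u) && (u < left_end l + p l).
    by move: lu; rewrite /subitv /= in_itv.
  have u0 : 0 <= u by lra.
  have u3 : u < 1 by lra.
  split; last by rewrite /J/= in_itv/= u0.
  by apply/(pat_digit_set u0 u3 fl); exact: itv_digits.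
apply: (@pr_sub0 _ _ _ _ _ (~` J)) => //.
- exact: measurableD.
- exact: measurableC.
- by rewrite pr_setC// U subrr.
Qed.

(** Splitting at one more index at a time reduces the claim to patterns [l ++ l0], where [l0]
    decides every index below a bound [N] for [l]. Such a pattern either says no more than [l0],
    which is the case of [pr_full], or contradicts it, and then both sides vanish. *)
Lemma pr_digit_set l : pr unif01 (pat digit_set l) = p l.
Proof.
have cP := pat_lit_content unif01 measurable_digit_set.
have [N lN] : exists N, forall kb, kb \in l -> (kb.1 < N)%N.
  exists (\max_(kb <- l) kb.1).+1 => kb kl; rewrite ltnS.
  exact: (@leq_bigmax_seq _ l xpredT (fun kb : nat * bool => kb.1) _ kl isT).
suff H m n l0 : (n + m = N)%N -> full n l0 ->
    pr unif01 (pat digit_set (l ++ l0)) = p (l ++ l0).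
  by have := H N 0 [::] erefl isT; rewrite cats0.
elim: m n l0 => [|m IH] n l0 nm fl; last first.
  rewrite (lit_content_split cp n) (lit_content_split cP n).
  have E b : (n, b) :: l ++ l0 =i l ++ (n, b) :: l0.
    by move=> x; rewrite !(inE, mem_cat) orbCA.
  rewrite !(lit_content_ext cp (E _)) !(eq_pat _ (E _)).
  by congr (_ + _); apply: (IH n.+1); rewrite ?addSnnS//= eqxx.
have [/allP ll|/allPn[[k b] kl kl0]] := boolP (all [in l0] l).
  have E : l ++ l0 =i l0.
    by move=> x; rewrite mem_cat; case: (boolP (x \in l)) => //= /ll.
  by rewrite (eq_pat _ E) (lit_content_ext cp E); exact: pr_full fl.
have [c kc] : exists b, (k, b) \in l0.
  by apply: full_mem fl _; rewrite -[n]addn0 nm; exact: (lN (k, b)).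
have := (@lit_content_clash _ _ k _ cp, @lit_content_clash _ _ k _ cP).
move=> cl; rewrite !cl// mem_cat; case: (b) (c) kl kl0 kc => -[] /= h1 h2 h3.
all: by rewrite ?h1 ?h3 ?orbT//; rewrite h3 in h2.
Qed.

End nested_intervals.

(** Keys are coded by numbers. A number that codes no key gets an event of probability 1: [ok]
    rejects the patterns that deny it, and [dec] drops the literals that assert it. *)
Lemma realize_content (K : countType) (p : seq (K * bool) -> R) :
  lit_content p -> exists2 D : K -> set (measurableTypeR R),
    forall k, measurable (D k) & forall l, pr unif01 (pat D l) = p l.
Proof.
move=> cp.
pose dec (l : seq (nat * bool)) : seq (K * bool) :=
  pmap (fun nb => omap (fun k => (k, nb.2)) (pickle_inv nb.1)) l.
pose ok (l : seq (nat * bool)) : bool :=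
  all (fun nb => (pickle_inv nb.1 : option K) || nb.2) l.
pose q l : R := if ok l then p (dec l) else 0.
have cq : lit_content q.
  split.
  - by rewrite /q /= lit_content0.
  - by move=> l; rewrite /q; case: ifP => // _; exact: lit_content_ge0.
  - move=> n l; rewrite /q /=; case: (pickle_inv n : option K) => [k|] /=.
      by case: ifP => _; [exact: lit_content_split|rewrite addr0].
    by rewrite addr0.
  - move=> l l' ll; rewrite /q /ok (eq_all_r ll); case: ifP => // _.
    by apply: lit_content_ext => // x; rewrite !mem_pmap (eq_mem_map _ ll).
exists (fun k => digit_set q (pickle k)).
  by move=> k; exact: measurable_digit_set.
move=> l; pose l' := [seq (pickle kb.1, kb.2) | kb <- l].
have -> : pat (fun k => digit_set q (pickle k)) l = pat (digit_set q) l'.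
  by apply/seteqP; split=> u H [k b]; [move=> /mapP[kb kl ->]; exact: H|
    move=> kl; apply: (H (pickle k, b)); apply/mapP; exists (k, b)].
rewrite pr_digit_set// /q.
have -> : ok l' by rewrite /ok all_map; apply/allP => kb _ /=; rewrite pickleK_inv.
by congr p; rewrite /dec /l' {l'}; elim: l => //= -[k b] l IH /=; rewrite pickleK_inv/= IH.
Qed.

End content.

(** * Polish-valued variables from ball events *)

Section symmetric_difference.
Context d (T : measurableType d) (R : realType) (P : probability T R).

Lemma measurableY (A B : set T) :
  measurable A -> measurable B -> measurable (A `+` B).
Proof. by move=> mA mB; apply: measurableU; exact: measurableD. Qed.

Lemma pr_setY_eq (A B : set T) : measurable A -> measurable B ->
  pr P (A `+` B) = 0 -> pr P A = pr P B.
Proof.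
move=> mA mB AB; rewrite (pr_split P mA mB) (pr_split P mB mA) setIC.
have mY := measurableY mA mB.
have /(pr_sub0 (measurableD mA mB) mY) -> // : A `\` B `<=` A `+` B by left.
have /(pr_sub0 (measurableD mB mA) mY) -> // : B `\` A `<=` A `+` B by right.
Qed.

(** The two patterns can differ only on the union of countably many null sets. *)
Lemma pr_pat_setY (K : countType) (D D' : K -> set T) l :
  (forall k, measurable (D k)) -> (forall k, measurable (D' k)) ->
  (forall k, pr P (D k `+` D' k) = 0) -> pr P (pat D l) = pr P (pat D' l).
Proof.
move=> mD mD' DD'.
have mY k := measurableY (mD k) (mD' k).
apply: pr_setY_eq; [exact: measurable_pat..|].
apply: (@pr_sub0 _ _ _ _ _ (\bigcup_k (D k `+` D' k))).
- by apply: measurableY; exact: measurable_pat.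
- by apply: countable_bigcupT_measurable => //; exact: countableP.
- have E (D1 D2 : K -> set T) u :
      pat D1 l u -> ~ (exists k, (D1 k `+` D2 k) u) -> pat D2 l u.
    move=> H nE kb /H; have [h|h] := pselect ((D1 kb.1 `+` D2 kb.1) u).
      by case: nE; exists kb.1.
    have [h1|h1] := pselect (D1 kb.1 u); have [h2|h2] := pselect (D2 kb.1 u).
    + by move=> -[h3 h4]; split => _; [exact: h3|exact: h2].
    + by case: h; left.
    + by case: h; right.
    + by move=> -[h3 h4]; split => [/h2|/h4/h1].
  move=> u uY; apply: contrapT => nU; case: uY => -[h]; apply.
    by apply: (E _ _ _ h) => -[k uk]; apply: nU; exists k.
  apply: (E _ _ _ h) => -[k uk]; apply: nU; exists k => //.
  by case: uk; [right|left].
- exact: pr_null_countable.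
Qed.

End symmetric_difference.

(** Denying all keys of [M] is the decreasing limit of denying those with code below [N], so the
    probabilities of finite patterns determine this one too. In this way coverings of balls by
    infinitely many balls pass to abstract events. *)
Lemma pr_pat_infinite d (T : measurableType d) d' (T' : measurableType d')
  (R : realType) (P : probability T R) (Q : probability T' R) (K : countType)
  (D : K -> set T) (D' : K -> set T') (l : seq (K * bool)) (M : set K) :
  (forall k, measurable (D k)) -> (forall k, measurable (D' k)) ->
  (forall l, pr P (pat D l) = pr Q (pat D' l)) ->
  pr P (pat D l `\` \bigcup_(k in M) D k) =
  pr Q (pat D' l `\` \bigcup_(k in M) D' k).
Proof.
move=> mD mD' DD'.
pose s N : seq (K * bool) :=
  [seq (k, false) | k <- pmap unpickle (iota 0 N) & k \in M].
have sP N k b : (k, b) \in s N -> M k /\ b = false.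
  by move=> /mapP[j]; rewrite mem_filter => /andP[/set_mem Mj _] [-> ->].
have Ps N k : M k -> (pickle k < N)%N -> (k, false) \in s N.
  move=> Mk kN; apply/mapP; exists k => //.
  rewrite mem_filter mem_set//= mem_pmap; apply/mapP; exists (pickle k).
    by rewrite mem_iota.
  by rewrite pickleK.
have H d1 (T1 : measurableType d1) (P1 : probability T1 R) (D1 : K -> set T1) :
    (forall k, measurable (D1 k)) ->
    pr P1 (pat D1 (l ++ s N)) @[N --> \oo] -->
    pr P1 (pat D1 l `\` \bigcup_(k in M) D1 k).
  move=> mD1; rewrite (_ : _ `\` _ = \bigcap_N pat D1 (l ++ s N)); last first.
    apply/seteqP; split=> [u [ul uM] N _|u H].
      rewrite pat_cat; split => // -[k b] /sP[Mk ->] /=; split => // Dk.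
      by case: uM; exists k.
    split; first by have := H 0%N I; rewrite pat_cat => -[].
    move=> [k Mk Dk]; have := H (pickle k).+1 I.
    by rewrite pat_cat => -[_ /(_ (k, false))]; rewrite Ps// => /(_ isT) [/(_ Dk)].
  apply: pr_cvg_down; first by move=> N; exact: measurable_pat.
  move=> m n mn; apply/subsetPset; rewrite !pat_cat; apply: setIS => u H [k b].
  move=> /mapP[j]; rewrite mem_filter => /andP[/set_mem Mj jm] [-> ->].
  apply: (H (j, false)); apply/mapP; exists j => //.
  rewrite mem_filter mem_set//=; move: jm; rewrite !mem_pmap => /mapP[i im e].
  by apply/mapP; exists i => //; move: im; rewrite !mem_iota => /leq_trans; apply.
have := H _ _ P D mD; under eq_fun do rewrite DD'.
by move=> h; apply: cvg_unique h (H _ _ Q D' mD').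
Qed.

Section ball_base.
Context (R : realType) (E : polishType R).

Let radius (m : nat) : R := m.+1%:R^-1.

(** A Polish space records that a metric exists without choosing one. The metric and the dense
    sequence therefore stay under the existential; [base] is chosen once, and proofs that need the
    metric reopen this statement. *)
Definition ball_base (b : nat * nat -> set E) :=
  exists (d : E -> E -> R) (c : nat -> E),
  [/\ [/\ forall x y, d x y = 0 <-> x = y, forall x y, d x y = d y x &
        forall x y z, d x z <= d x y + d y z],
      forall x (A : set E),
        nbhs x A <-> exists2 e, 0 < e & [set y | d x y < e] `<=` A,
      forall u : nat -> E,
        (forall e, 0 < e ->
          exists N, forall m n, (N <= m)%N -> (N <= n)%N -> d (u m) (u n) < e) ->
        exists l : E, u @ \oo --> l,
      forall x e, 0 < e -> exists n, d (c n) x < e &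
      b = fun k => [set y | d (c k.1) y < radius k.2]].

Lemma ball_base_exists : exists b, ball_base b.
Proof.
have [D cD dD] := @polish_separable R E.
have [d [d0 dC dT dn dcomp]] := @polish_metrizable R E.
have dxx x : d x x = 0 by apply/d0.
have oB x e : open [set y | d x y < e].
  rewrite openE => y /= xye; apply/dn; exists (e - d x y); first by rewrite subr_gt0.
  by move=> z /= yz; apply: (le_lt_trans (dT _ y _)); rewrite -ltrBrDl.
have D0 : D !=set0.
  by have [x [_ Dx]] := dD setT (ex_intro _ point I) openT; exists x.
have /pfcard_geP[Df|[s]] := cD; first by have [x] := D0; rewrite Df.
eexists; exists d, s; split; [by split|exact: dn|exact: dcomp| |reflexivity].
move=> x e e0; have [q [/= xq Dq]] : [set y | d x y < e] `&` D !=set0.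
  by apply: dD (oB _ _); exists x; rewrite /= dxx.
have [p _ pq] : (s @` setT) q by apply: (@surj _ _ _ _ s).
by exists p; rewrite pq dC.
Qed.

Definition base : nat * nat -> set E := projT1 (cid ball_base_exists).

Let baseP : ball_base base := projT2 (cid ball_base_exists).

Let radius_gt0 m : 0 < radius m. Proof. by rewrite invr_gt0. Qed.

Let radius_small (e : R) : 0 < e -> exists m, radius m < e.
Proof.
move=> e0; have [N _ /(_ N (leqnn N)) ?] := near_infty_natSinv_lt (PosNum e0).
by exists N.
Qed.

Lemma base_open k : open (base k).
Proof.
have [d [c [[d0 dC dT] dn _ _ ->]]] := baseP.
rewrite openE => y /= xye; apply/dn; exists (radius k.2 - d (c k.1) y).
  by rewrite subr_gt0.
by move=> z /= yz; apply: (le_lt_trans (dT _ y _)); rewrite -ltrBrDl.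
Qed.

Lemma measurable_base k : measurable (base k : set (borel E)).
Proof. by apply: open_borel; exact: base_open. Qed.

Lemma base_nbhs (x : E) A : nbhs x A -> exists k, base k x /\ base k `<=` A.
Proof.
have [d [c [[d0 dC dT] dn _ dd ->]]] := baseP.
move=> /dn[e e0 eA]; have e2 : 0 < e / 2 by rewrite divr_gt0.
have [m me] := radius_small e2; have [p px] := dd x _ (radius_gt0 m).
exists (p, m); split=> // y /= yp; apply: eA => /=.
apply: (le_lt_trans (dT _ (c p) _)); rewrite dC [ltRHS](splitr e).
by apply: ltrD; exact: lt_trans me.
Qed.

Lemma base_separates (x y : E) : (forall k, base k x <-> base k y) -> x = y.
Proof.
have [d [c [[d0 dC dT] dn _ dd bE]]] := baseP.
move=> H; apply/d0/eqP; rewrite eq_le; apply/andP; split; last first.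
  have := dT x y x; rewrite (dC y x) (_ : d x x = 0) ?(d0 x x).2//.
  by rewrite -mulr2n pmulrn_lge0.
apply/ler_addgt0Pl => e e0; rewrite addr0.
have e2 : 0 < e / 2 by rewrite divr_gt0.
have [m me] := radius_small e2; have [p px] := dd x _ (radius_gt0 m).
have := (H (p, m)).1; rewrite bE /= => /(_ px) py.
apply: ltW; apply: (le_lt_trans (dT _ (c p) _)); rewrite dC [ltRHS](splitr e).
by apply: ltrD; exact: lt_trans me.
Qed.

Lemma base_neq T (f f' : T -> E) w : f w <> f' w ->
  exists k, ((f @^-1` base k) `+` (f' @^-1` base k)) w.
Proof.
apply: contra_notP => h; apply: base_separates => k; apply: contrapT => nk.
apply: h; exists k; have [h1|h1] := pselect (base k (f w)).
  by left; split => // h2; apply: nk.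
by right; split => //; apply: contrapT => h2; apply: nk.
Qed.

Lemma open_bigcup_base (U : set E) : open U ->
  U = \bigcup_(k in [set k | base k `<=` U]) base k.
Proof.
move=> oU; apply/seteqP; split=> [x Ux|x [k /=]]; last exact.
have [k [kx kU]] : exists k, base k x /\ base k `<=` U.
  by apply: base_nbhs; apply: open_nbhs_nbhs; split.
by exists k.
Qed.

Lemma borel_base (G : set (set E)) : (forall k, <<s G >> (base k)) ->
  @measurable _ (borel E) `<=` <<s G >>.
Proof.
move=> Gb; apply: smallest_sub; first exact: smallest_sigma_algebra.
move=> U /open_bigcup_base ->; rewrite bigcup_mkcond.
have := @countable_bigcupT_measurable _ (g_sigma_algebraType G)
  (nat * nat)%type (fun k => if k \in [set k | base k `<=` U] then base k else set0).
apply; first exact: countableP.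
by move=> k; case: ifP => // _; exact: Gb.
Qed.

Lemma borel_law_unique (P Q : probability (borel E) R) :
  (forall l, pr P (pat base l) = pr Q (pat base l)) -> P =m Q.
Proof.
move=> PQ; apply: (@prob_unique _ (borel E) R (range (pat base))) => //.
- apply: borel_base => k; apply: sub_sigma_algebra.
  by exists [:: (k, true)] => //; rewrite pat_cons pat_nil setIT.
- by move=> _ [l _ <-]; apply: measurable_pat; exact: measurable_base.
- by move=> _ _ [l _ <-] [l' _ <-]; exists (l ++ l') => //; rewrite pat_cat.
- by move=> _ [l _ <-].
Qed.

Lemma measurable_fun_base d (T : measurableType d) (f : T -> E) :
  (forall k, measurable (f @^-1` base k)) ->
  measurable_fun setT (f : T -> borel E).
Proof.
move=> mf _ B mB; rewrite setTI.
have : [set B | measurable (f @^-1` B)] B; last by [].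
have H : @measurable _ (borel E) `<=` <<s range base >>.
  by apply: borel_base => k; apply: sub_sigma_algebra; exists k.
move: (H B mB); apply: smallest_sub => [|_ [k _ <-]]; last exact: mf.
split => /=; first by rewrite preimage_set0.
- by move=> A mA; rewrite setTD preimage_setC; exact: measurableC.
- by move=> F mF; rewrite preimage_bigcup; exact: bigcup_measurable.
Qed.

(** The functions are m times the depth [h y] of the point inside the ball, clipped to [0, 1]; a
    point of the ball gets the value 1 as soon as m is at least the inverse of its depth. *)
Lemma base_approx k : exists f : nat -> E -> R,
  [/\ forall m, continuous (f m), forall m y, 0 <= f m y <= 1,
    forall m y, ~ base k y -> f m y = 0 &
    forall y, base k y -> \forall m \near \oo, f m y = 1].
Proof.
have [d [c [[d0 dC dT] dn _ dd bE]]] := baseP.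
pose h (y : E) : R := radius k.2 - d (c k.1) y.
have ch : continuous h.
  move=> y; apply/cvgrPdist_lt => e e0.
  apply/dn; exists e => // z /= yz; apply: le_lt_trans yz; rewrite /h.
  have := dT (c k.1) y z; have := dT (c k.1) z y; rewrite (dC z y) => h1 h2.
  by rewrite ler_norml; apply/andP; split; lra.
exists (fun m y => Num.min 1 (m%:R * Num.max 0 (h y))); split.
- move=> m y; apply: (@continuous_min R E (cst 1) (fun y => m%:R * Num.max 0 (h y))).
    exact: cst_continuous.
  apply: continuousM; first exact: cst_continuous.
  by apply: (@continuous_max R E (cst 0) h); [exact: cst_continuous|exact: ch].
- move=> m y; rewrite ge_min lexx le_min ler01/= andbT.
  by rewrite mulr_ge0// le_max lexx.
- move=> m y; rewrite bE /= => /negP; rewrite -leNgt => hy.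
  have -> : Num.max 0 (h y) = 0.
    by apply/max_idPl; rewrite /h subr_le0.
  by rewrite mulr0; apply/min_idPr; exact: ler01.
- move=> y; rewrite bE /= => yk.
  have hy : 0 < h y by rewrite /h subr_gt0.
  exists (Num.bound (h y)^-1) => // m /= hm.
  have -> : Num.max 0 (h y) = h y by apply/max_idPr; exact: ltW.
  apply/min_idPl; rewrite -ler_pdivrMr// mul1r.
  apply: (@le_trans _ _ (Num.bound (h y)^-1)%:R); last by rewrite ler_nat.
  by apply: ltW; apply: archi_boundP; rewrite invr_ge0 ltW.
Qed.

(* Off a null set, the balls base k with D k holding at w meet pairwise and have
   arbitrarily small radii; by completeness they shrink to a point Y w. *)
Lemma realize_base d (W : measurableType d) (P : probability W R)
  (G : set (set W)) (D : nat * nat -> set W) (mu : probability (borel E) R) :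
  G `<=` measurable -> (forall k, <<s G >> (D k)) ->
  (forall l, pr P (pat D l) = pr mu (pat base l)) ->
  exists Y : W -> E,
    measurable_fun setT (Y : g_sigma_algebraType G -> borel E) /\
    forall k, pr P ((Y @^-1` base k) `+` D k) = 0.
Proof.
move=> Gm GD PD.
have sGm : <<s G >> `<=` measurable.
  by apply: smallest_sub => //; exact: sigma_algebra_measurable.
have mD k : measurable (D k) by exact: sGm.
have mb := measurable_base.
(* Every covering of a pattern of balls by balls also holds for the events [D], up to a null set. *)
have null l M : pat base l `<=` \bigcup_(k in M) base k ->
    pr P (pat D l `\` \bigcup_(k in M) D k) = 0.
  move=> H; rewrite (pr_pat_infinite _ _ mD mb PD).
  by rewrite (_ : _ `\` _ = set0) ?pr_set0// setD_eq0.
have nullD k k' : base k `<=` base k' -> pr P (D k `\` D k') = 0.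
  move=> kk'; have := null [:: (k, true)] [set k'].
  by rewrite !pat_cons !pat_nil !setIT !bigcup_set1; apply.
have [d' [c [[d0 dC dT] dn dcomp dd bE]]] := baseP.
have bd k x : base k x = (d' (c k.1) x < radius k.2) :> Prop by rewrite bE.
have dxx x : d' x x = 0 by apply/d0.
have close (U : set E) x : open U -> U x -> exists m, forall p,
    d' (c p) x <= radius m ->
    [set y | d' (c p) y <= radius m] `<=` U.
  move=> oU Ux; have /dn[e e0 eU] : nbhs x U by apply: open_nbhs_nbhs; split.
  have e2 : 0 < e / 2 by rewrite divr_gt0.
  have [m me] := radius_small e2; exists m => p px y /= py; apply: eU => /=.
  apply: (le_lt_trans (dT _ (c p) _)); rewrite dC [ltRHS](splitr e).
  by apply: ltrD; exact: le_lt_trans me.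
(* Closed balls inside [U]: a limit of centers is only known to satisfy the non-strict inequality
   for the distance. *)
pose inner (U : set E) : set (nat * nat) :=
  [set k | [set y | d' (c k.1) y <= radius k.2] `<=` U].
have inner_cover U : open U -> U `<=` \bigcup_(k in inner U) base k.
  move=> oU x Ux; have [m Hm] := close U x oU Ux.
  have [p px] := dd x _ (radius_gt0 m).
  by exists (p, m); [apply: Hm; exact: ltW|rewrite bd].
pose FT := g_sigma_algebraType G.
have mDF k : measurable (D k : set FT) by exact: GD.
(* On [N1 m] no ball of the m-th radius holds; on [N2] two disjoint balls both hold. Both are null,
   since balls of one radius cover the space and disjoint balls have an empty intersection. *)
pose N1 m := ~` \bigcup_p D (p, m).
pose N2 (kk : (nat * nat) * (nat * nat)) : set W :=
  if `[< base kk.1 `&` base kk.2 = set0 >] then D kk.1 `&` D kk.2 else set0.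
pose good : set W := ~` ((\bigcup_m N1 m) `|` \bigcup_kk N2 kk).
have mN1 m : measurable (N1 m : set FT).
  by apply: measurableC; apply: bigcup_measurable => p _.
have mN2 kk : measurable (N2 kk : set FT).
  by rewrite /N2; case: asboolP => // _; exact: measurableI.
have mbad : measurable ((\bigcup_m N1 m) `|` (\bigcup_kk N2 kk) : set FT).
  apply: measurableU; first by apply: bigcup_measurable => m _.
  by apply: countable_bigcupT_measurable => //; exact: countableP.
have mgood : measurable (good : set FT) by exact: measurableC.
have bad0 : pr P (~` good) = 0.
  have mU1 : measurable (\bigcup_m N1 m : set W).
    by apply: bigcup_measurable => m _; exact: sGm (mN1 m).
  have mU2 : measurable (\bigcup_kk N2 kk : set W).
    apply: countable_bigcupT_measurable => [|kk]; first exact: countableP.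
    exact: sGm (mN2 kk).
  apply/eqP; rewrite setCK eq_le pr_ge0 andbT.
  apply: (le_trans (pr_setU_le P mU1 mU2)).
  rewrite prU_null => [|m|m]; last 2 first.
  - exact: sGm (mN1 m).
  - have := null [::] [set k | k.2 = m]; rewrite !pat_nil setTD.
    rewrite (_ : ~` _ = N1 m) => [|]; last first.
      rewrite /N1; congr (~` _); apply/seteqP; split=> [w [[p m'] /= -> ?]|w [p _ ?]].
        by exists p.
      by exists (p, m).
    apply=> x _; have [p px] := dd x _ (radius_gt0 m).
    by exists (p, m); rewrite ?bd.
  rewrite pr_null_countable ?addr0// => kk; first exact: sGm (mN2 kk).
  rewrite /N2; case: asboolP => [k0|_]; last by rewrite pr_set0.
  have := null [:: (kk.1, true); (kk.2, true)] set0.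
  by rewrite !pat_cons !pat_nil !setIT !bigcup_set0 !setD0 k0; apply.
have /choice[Y0 HY0] w : exists l : E, good w ->
    forall k, D k w -> d' (c k.1) l <= radius k.2.
  have [gw|] := pselect (good w); last by exists point.
  have /choice[p Hp] m : exists p, D (p, m) w.
    by apply: contrapT => nD; apply: gw; left; exists m => //= -[p _ ?]; apply: nD; exists p.
  have meet k k' : D k w -> D k' w -> d' (c k.1) (c k'.1) < radius k.2 + radius k'.2.
    move=> kw k'w.
    have [z [zk zk']] : base k `&` base k' !=set0.
      apply/set0P/eqP => k0; apply: gw; right; exists (k, k') => //.
      by rewrite /N2/=; case: asboolP.
    rewrite !bd in zk zk'; apply: (le_lt_trans (dT _ z _)).
    by rewrite (dC z); exact: ltrD.
  have radius_le m n : (m <= n)%N -> radius n <= radius m.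
    by move=> mn; rewrite /radius lef_pV2 ?posrE// ler_nat ltnS.
  have [|l Hl] := dcomp (fun m => c (p m)).
    move=> e e0; have e2 : 0 < e / 2 by rewrite divr_gt0.
    have [m me] := radius_small e2; exists m => i j mi mj.
    have := meet _ _ (Hp i) (Hp j); have := radius_le _ _ mi.
    by have := radius_le _ _ mj => /=; lra.
  exists l => _ k kw; apply/ler_addgt0Pr => e e0.
  have e2 : 0 < e / 2 by rewrite divr_gt0.
  have [m me] := radius_small e2.
  have [M _ HM] : \forall n \near \oo, d' l (c (p n)) < e / 2.
    by apply: (Hl [set y | d' l y < e / 2]); apply/dn; exists (e / 2).
  pose n := maxn m M.
  have h1 := HM n (leq_maxr _ _); have h2 := meet _ _ kw (Hp n).
  have h3 := radius_le m n (leq_maxl _ _).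
  apply: (le_trans (dT _ (c (p n)) _)); rewrite (dC (c (p n))) /= in h2 *.
  by move: h1 h2 h3 me => /=; lra.
(* Since [good] itself belongs to [<<s G >>], a constant value off [good] makes [Y] measurable for
   [<<s G >>] everywhere, not merely up to null sets. *)
pose Y w := if `[< good w >] then Y0 w else point.
have Yopen U : open U ->
    Y @^-1` U = (good `&` \bigcup_(k in inner U) D k) `|`
      (~` good `&` [set _ | U point]).
  move=> oU; apply/seteqP; split=> w; rewrite /Y /=; case: asboolP => gw //=.
  - move=> UY; left; split=> //; have [m Hm] := close U _ oU UY.
    have [p pw] : exists p, D (p, m) w.
      apply: contrapT => nD; apply: gw; left; exists m => //= -[p _ ?].
      by apply: nD; exists p.
    by exists (p, m) => //; apply: Hm; exact: (HY0 _ gw _ pw).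
  - by move=> ?; right.
  - by case=> [[_ [k kU kw]]|[]//]; apply: kU; exact: HY0.
  - by case=> [[]|[]].
have mY : measurable_fun setT (Y : FT -> borel E).
  apply: measurable_fun_base => k; rewrite (Yopen _ (base_open k)).
  apply: measurableU; apply: measurableI => //.
  - rewrite bigcup_mkcond.
    apply: countable_bigcupT_measurable => [|k']; first exact: countableP.
    by case: ifP.
  - exact: measurableC.
  - have [bp|bp] := pselect (base k point).
      by rewrite (_ : [set _ | _] = setT)//; apply/seteqP; split.
    by rewrite (_ : [set _ | _] = set0)//; apply/seteqP; split.
exists Y; split => // k.
have mYk : measurable (Y @^-1` base k : set W).
  by apply: sGm; exact: (measurable_pre mY (measurable_base k)).
(* On [good], [Y] lies in the ball exactly when some inner ball holds; [N3] and [N4] are the two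
   ways in which this can differ from [D k]. *)
pose N3 := D k `\` \bigcup_(k' in inner (base k)) D k'.
pose N4 k' : set W := if `[< inner (base k) k' >] then D k' `\` D k else set0.
have mN4 k' : measurable (N4 k').
  by rewrite /N4; case: asboolP => // _; exact: measurableD.
have mI : measurable (\bigcup_(k' in inner (base k)) D k').
  rewrite bigcup_mkcond.
  apply: countable_bigcupT_measurable => [|k']; first exact: countableP.
  by case: ifP.
have mN3 : measurable N3 by exact: measurableD.
have mN4' : measurable (\bigcup_k' N4 k').
  by apply: countable_bigcupT_measurable => [|k' //]; exact: countableP.
have mbadW : measurable (~` good : set W) by apply: measurableC; exact: sGm mgood.
apply: (@pr_sub0 _ _ _ _ _ (~` good `|` (N3 `|` \bigcup_k' N4 k'))).
- exact: measurableY.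
- by apply: measurableU => //; exact: measurableU.
- move=> w; have [gw|gw] := pselect (good w); last by left.
  move=> H; right; move: H; rewrite (Yopen _ (base_open k)) => -[[[[_ [k' k'i k'w]]|[//]]]|].
    move=> nD; right; exists k' => //; rewrite /N4.
    by case: asboolP.
  move=> [kw nY]; left; split=> // -[k' k'i k'w].
  by apply: nY; left; split=> //; exists k'.
- apply/eqP; rewrite eq_le pr_ge0 andbT.
  apply: (le_trans (pr_setU_le _ mbadW (measurableU _ _ mN3 mN4'))).
  rewrite bad0 add0r; apply: (le_trans (pr_setU_le _ mN3 mN4')).
  rewrite pr_null_countable//; last first.
    move=> k'; rewrite /N4; case: asboolP => [k'i|_]; last by rewrite pr_set0.
    apply: nullD => x; rewrite bd => /ltW; exact: k'i.
  rewrite addr0; have := null [:: (k, true)] (inner (base k)).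
  rewrite !pat_cons !pat_nil !setIT => ->//.
  by apply: inner_cover; exact: base_open.
Qed.

End ball_base.

(** * Independent sequences *)

Section prod_content.
Context (R : realType) (I K : eqType).
Variable (c : I -> seq (K * bool) -> R).
Hypothesis cP : forall i, lit_content (c i).

Definition lits_at i (l : seq ((I * K) * bool)) : seq (K * bool) :=
  [seq (x.1.2, x.2) | x <- l & x.1.1 == i].

Lemma mem_lits_at i l k b : ((k, b) \in lits_at i l) = (((i, k), b) \in l).
Proof.
apply/mapP/idP => [[[[i' k'] b']]|h].
  by rewrite mem_filter /= => /andP[/eqP -> h] [-> ->].
by exists ((i, k), b) => //; rewrite mem_filter /= eqxx.
Qed.

Definition prod_content (l : seq ((I * K) * bool)) : R :=
  \prod_(i <- undup [seq x.1.1 | x <- l]) c i (lits_at i l).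

(** An index without literals in [l] contributes [c i [::] = 1], so any duplicate-free list that
    covers the indices of [l] gives the same product. *)
Lemma prod_contentE (J : seq I) l : uniq J ->
  (forall x, x \in l -> x.1.1 \in J) ->
  prod_content l = \prod_(i <- J) c i (lits_at i l).
Proof.
move=> uJ lJ; set s := undup [seq x.1.1 | x <- l].
rewrite [RHS](bigID [in s])/= [X in _ * X]big1_seq ?mulr1; last first.
  move=> i /andP[i_s _]; rewrite /lits_at (@eq_in_filter _ _ pred0).
    by rewrite filter_pred0 /= (lit_content0 (cP i)).
  move=> x xl; apply: contraNF i_s => /eqP <-.
  by rewrite mem_undup; apply/mapP; exists x.
rewrite -big_filter; apply: perm_big; apply: uniq_perm.
- exact: undup_uniq.
- exact: filter_uniq.
- move=> i; rewrite mem_filter; case: (boolP (i \in s)) => //=.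
  by rewrite mem_undup => /mapP[x xl ->]; rewrite lJ.
Qed.

Lemma prod_content_lit_content : lit_content prod_content.
Proof.
split.
- by rewrite /prod_content big_nil.
- by move=> l; apply: prodr_ge0 => i _; exact: lit_content_ge0.
- move=> [i0 k] l; pose J := undup [seq x.1.1 | x <- ((i0, k), true) :: l].
  have uJ : uniq J by exact: undup_uniq.
  have i0J : i0 \in J by rewrite mem_undup mem_head.
  have lJ x : x \in l -> x.1.1 \in J.
    by move=> xl; rewrite mem_undup inE; apply/orP; right; apply/mapP; exists x.
  have l'J b x : x \in ((i0, k), b) :: l -> x.1.1 \in J.
    by rewrite inE => /orP[/eqP -> //|/lJ].
  rewrite !(prod_contentE uJ)//; [|exact: l'J..].
  rewrite !(bigD1_seq i0)//= /lits_at /= eqxx /= -/(lits_at i0 l).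
  rewrite (lit_content_split (cP i0) k) mulrDl.
  by congr (_ * _ + _ * _); apply: eq_bigr => i /negbTE ii0;
    rewrite eq_sym ii0.
- move=> l l' ll; have uJ := undup_uniq [seq x.1.1 | x <- l].
  rewrite [RHS](prod_contentE uJ); last first.
    by move=> x; rewrite -ll => xl; rewrite mem_undup; apply/mapP; exists x.
  apply: eq_bigr => i _; apply: lit_content_ext => // -[k b].
  by rewrite !mem_lits_at.
Qed.

End prod_content.

Section full_field.
Context d (W : measurableType d) d' (T : measurableType d').

Lemma measurable_fun_sub (G : set (set W)) (f : W -> T) : G `<=` measurable ->
  measurable_fun setT (f : g_sigma_algebraType G -> T) -> measurable_fun setT f.
Proof.
move=> Gm mf _ B mB; rewrite setTI.
have := measurable_pre mf mB; apply: smallest_sub => //.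
exact: sigma_algebra_measurable.
Qed.

(** The condition [D i] is part of the field of [i], which is therefore empty outside [D] and keeps
    such indices out of the finite lists. *)
Lemma independentP (R : realType) (P : probability W R) (I : choiceType)
    (D : set I) (X : I -> W -> T) : (forall i, measurable_fun setT (X i)) ->
  independent P D X <->
  indep_fields P (fun i => [set C | D i /\ [set X i @^-1` A | A in measurable] C]).
Proof.
move=> mX; split=> [iX s A us FA|iX s A us sD mA].
  have /choice[B HB] i : exists B, i \in s -> measurable B /\ X i @^-1` B = A i.
    have [/FA[_ [B mB e]]|] := boolP (i \in s); first by exists B.
    by exists setT.
  pose B' i := if i \in s then B i else setT.
  have mB' i : measurable (B' i) by rewrite /B'; case: ifP => // /HB[].
  have B'A i : i \in s -> X i @^-1` (B' i) = A i by rewrite /B' => s_i; rewrite s_i; case: (HB i s_i).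
  have := iX s B' us (fun i i_s => (FA i i_s).1) mB'.
  rewrite (eq_bigcapr B'A) (eq_big_seq (fun i => (pr P (A i))%:E)) => [e|i i_s].
    by rewrite /pr e prodEFin.
  rewrite B'A// prE// -B'A//; exact: measurable_pre.
rewrite prE; last by apply: fin_bigcap_measurable => // i _; exact: measurable_pre.
rewrite iX//; last by move=> i i_s; split; [exact: sD|exists (A i)].
rewrite -prodEFin; apply: eq_bigr => i _.
by rewrite prE//; exact: measurable_pre.
Qed.

End full_field.

(** The target depends on [j] because the tree process mixes maps in [Omega] with values in [S].
    That each single family of ball events has a true law [nu j] is what makes it come from a
    variable; the joint behaviour may be any content. *)
Lemma realize_family (R : realType) (J : countType) (E : J -> polishType R)
    (nu : forall j, probability (borel (E j)) R)
    (p : seq ((J * (nat * nat)) * bool) -> R) : lit_content p ->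
  (forall j l, p [seq ((j, x.1), x.2) | x <- l] = pr (nu j) (pat (@base R (E j)) l)) ->
  exists Y : forall j, measurableTypeR R -> E j,
    [/\ forall j, measurable_fun setT (Y j : _ -> borel (E j)),
        forall j (A : set (borel (E j))), measurable A ->
          pr (@unif01 R) (Y j @^-1` A) = pr (nu j) A
      & forall l, pr (@unif01 R) (pat (fun k => Y k.1 @^-1` @base R (E k.1) k.2) l) = p l].
Proof.
move=> cp pE; have [D mD pD] := realize_content cp; pose W := measurableTypeR R.
have H j : exists Y : W -> E j,
    measurable_fun setT (Y : g_sigma_algebraType (measurable : set (set W)) -> borel (E j)) /\
    forall m, pr (@unif01 R) ((Y @^-1` @base R (E j) m) `+` D (j, m)) = 0.
  apply: (@realize_base _ _ _ _ _ _ (fun m => D (j, m)) (nu j)) => // [m|l].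
    by apply: sub_sigma_algebra; exact: mD.
  by rewrite -(pat_map D (fun m => (j, m))) pD pE.
pose Y j := projT1 (cid (H j)); have HY j := projT2 (cid (H j)).
have mY j : measurable_fun setT (Y j : W -> borel (E j)).
  by apply: (@measurable_fun_sub _ _ _ _ measurable) => //; case: (HY j).
have YE l : pr (@unif01 R) (pat (fun k => Y k.1 @^-1` @base R (E k.1) k.2) l) = p l.
  rewrite -pD; apply: pr_pat_setY => // [k|[j m]]; last exact: (HY j).2.
  exact: (measurable_pre (mY _) (measurable_base _)).
exists Y; split => // j A mA.
suff /eq_lawP /(_ A mA) : law (@unif01 R) (mY j) =m nu j by [].
apply: borel_law_unique => l; rewrite pr_law -pE -YE.
by rewrite (pat_map _ (fun m => (j, m))).
Qed.

Section iid_exists.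
Context (R : realType) (S : polishType R) (E : ptopologicalType) (J : countType).
Variables (proj : J -> E -> S) (mk : (J -> S) -> E).
Hypothesis mproj : forall j, measurable_fun setT (proj j : borel E -> borel S).
Hypothesis projK : forall j f, proj j (mk f) = f j.
Hypothesis mE : forall d (T : measurableType d) (f : T -> E),
  (forall j, measurable_fun setT (fun t => proj j (f t) : borel S)) ->
  measurable_fun setT (f : T -> borel E).
Hypothesis mEpow : forall d (T : measurableType d) (f : T -> pow None E),
  (forall i, measurable_fun setT (fun t => f t i : borel E)) ->
  measurable_fun setT (f : T -> borel (pow None E)).

Let B (jm : J * (nat * nat)) : set (borel E) := proj jm.1 @^-1` base jm.2.

Let mB jm : measurable (B jm).
Proof. exact: (measurable_pre (mproj jm.1) (measurable_base jm.2)). Qed.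

Lemma coord_law_unique (P Q : probability (borel E) R) :
  (forall l, pr P (pat B l) = pr Q (pat B l)) -> P =m Q.
Proof.
move=> PQ; apply: (@prob_unique _ (borel E) R (range (pat B))) => //.
- suff H : measurable_fun setT (id : g_sigma_algebraType (range (pat B)) -> borel E).
    by move=> A mA; have := measurable_pre H mA.
  apply: mE => j; apply: measurable_fun_base => k.
  by apply: sub_sigma_algebra; exists [:: ((j, k), true)] => //;
    rewrite pat_cons pat_nil setIT.
- by move=> _ [l _ <-]; exact: measurable_pat.
- by move=> _ _ [l _ <-] [l' _ <-]; exists (l ++ l') => //; rewrite pat_cat.
- by move=> _ [l _ <-].
Qed.

(** An [E]-valued variable is assembled by [mk] from its [S]-valued coordinates, so only [S] has to
    be Polish: [J = unit] gives [S] itself and [J = idx n] gives S^n. *)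
Lemma iid_exists (nu : probability (borel E) R) :
  exists Q : probability (borel (pow None E)) R,
    iid Q setT (fun i x => x i : borel E) nu.
Proof.
pose p := prod_content (fun (_ : idx None) l => pr nu (pat B l)).
have cp : lit_content p.
  by apply: prod_content_lit_content => i; exact: pat_lit_content.
have p_at i l : p [seq ((i, x.1), x.2) | x <- l] = pr nu (pat B l).
  rewrite /p (@prod_contentE _ _ _ _ _ [:: i])//.
  - rewrite big_seq1; congr (pr nu (pat B _)); rewrite /lits_at.
    by elim: l => //= -[k b] l IH; rewrite eqxx/= IH.
  - by move=> i'; exact: pat_lit_content.
  - by move=> x /mapP[y _ ->]; rewrite mem_head.
pose flat (k : (idx None * J) * (nat * nat)) := (k.1.1, (k.1.2, k.2)).
have [|Y [mY _ pY]] := @realize_family R _ (fun=> S) (fun ij => law nu (mproj ij.2)) _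
    (lit_content_map flat cp).
  move=> [i j] l; rewrite -map_comp /= pr_law.
  have := p_at i [seq ((j, x.1), x.2) | x <- l]; rewrite -map_comp => ->.
  by rewrite (pat_map _ (fun m => (j, m))).
pose W := measurableTypeR R.
pose Z (u : W) : pow None E := fun i => mk (fun j => Y (i, j) u).
have mZi i : measurable_fun setT (fun u => Z u i : borel E).
  by apply: mE => j; rewrite (_ : (fun _ => _) = Y (i, j))//; apply/funext => u; exact: projK.
have mZ : measurable_fun setT (Z : W -> borel (pow None E)) by exact: mEpow.
pose YB (k : idx None * (J * (nat * nat))) : set W := Y (k.1, k.2.1) @^-1` base k.2.2.
have pYB l : pr (@unif01 R) (pat YB l) = p l.
  have := pY [seq (((x.1.1, x.1.2.1), x.1.2.2), x.2) | x <- l].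
  rewrite -map_comp (_ : map _ l = l) => [<-|]; last by rewrite -[RHS]map_id; apply: eq_map => -[[i []]].
  by rewrite (pat_map _ (fun k : idx None * (J * (nat * nat)) => ((k.1, k.2.1), k.2.2))).
have ZB i l : (fun u => Z u i) @^-1` pat B l = pat YB [seq ((i, x.1), x.2) | x <- l].
  rewrite (pat_map _ (fun k => (i, k))); apply/seteqP; split=> u H [[j m] b] kl;
    by have := H _ kl; rewrite /B /= projK.
exists (law (@unif01 R) mZ); split.
  move=> i _ A mA; rewrite lawE.
  change (law (@unif01 R) (mZi i) A = nu A).
  by apply: coord_law_unique => // l; rewrite pr_law ZB pYB p_at.
have mi i : measurable_fun setT (fun x : borel (pow None E) => x i : borel E).
  by apply: (@continuous_borel (pow None E) E); exact: pow_proj_continuous.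
apply/independentP => // s A us FA.
pose G (i : idx None) : set (set W) := [set (fun u => Z u i) @^-1` pat B l | l in setT].
have iG : indep_fields (@unif01 R) (fun i => <<s G i >>).
  apply: indep_sigma.
  - by move=> i _ [l _ <-]; exact: (measurable_pre (mZi i) (measurable_pat l mB)).
  - move=> i _ _ [l _ <-] [l' _ <-]; exists (l ++ l') => //.
    by rewrite pat_cat preimage_setI.
  - move=> {A FA} s' A us' FA.
    have /choice[f Hf] i : exists l, i \in s' -> (fun u => Z u i) @^-1` pat B l = A i.
      by have [/FA[l _ e]|] := boolP (i \in s'); [exists l|exists [::]].
    pose L := flatten [seq [seq ((i, x.1), x.2) | x <- f i] | i <- s'].
    have -> : \bigcap_(i in [set` s']) A i = pat YB L.
      apply/seteqP; split=> u H.
        move=> x /flattenP[_ /mapP[i i_s ->] xi].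
        by have := H i i_s; rewrite -Hf// ZB; apply.
      move=> i /= i_s; rewrite -Hf// ZB => x xi; apply: H.
      by apply/flattenP; exists [seq ((i, x0.1), x0.2) | x0 <- f i] => //;
        apply/mapP; exists i.
    rewrite pYB /p (prod_contentE _ us'); last 2 first.
    + by move=> i; exact: pat_lit_content.
    + by move=> x /flattenP[_ /mapP[i i_s ->] /mapP[y _ ->]].
    apply: eq_big_seq => i i_s; rewrite -Hf// ZB pYB p_at; congr pr.
    apply: eq_pat => -[k b]; rewrite mem_lits_at; apply/flattenP/idP.
      by move=> [_ /mapP[j js ->] /mapP[[k' b'] h] [-> -> ->]].
    move=> h; exists [seq ((i, x0.1), x0.2) | x0 <- f i].
      by apply/mapP; exists i.
    by apply/mapP; exists (k, b).
rewrite pr_law.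
have E1 : Z @^-1` (\bigcap_(i in [set` s]) A i) = \bigcap_(i in [set` s]) (Z @^-1` A i).
  by [].
rewrite E1 iG//.
move=> i /FA[_ [C mC <-]].
have H : measurable_fun setT ((fun u => Z u i) : g_sigma_algebraType (G i) -> borel E).
  apply: mE => j; apply: measurable_fun_base => k; apply: sub_sigma_algebra.
  by exists [:: ((j, k), true)] => //; rewrite pat_cons pat_nil setIT.
exact: (measurable_pre H mC).
Qed.

End iid_exists.

(* The two properties of Polish spaces that are needed of the state spaces S and
   S^n alike. *)
Record standard (R : realType) (E : ptopologicalType) : Prop := Standard {
  standard_pow : forall d (T : measurableType d) k (f : T -> pow k E),
    (forall i, measurable_fun setT (fun t => f t i : borel E)) ->
    measurable_fun setT (f : T -> borel (pow k E)) ;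
  standard_iid : forall nu : probability (borel E) R,
    exists Q : probability (borel (pow None E)) R,
      iid Q setT (fun i x => x i : borel E) nu }.

Lemma measurable_proj (E : ptopologicalType) k (i : idx k) :
  measurable_fun setT (fun x : borel (pow k E) => x i : borel E).
Proof.
by apply: (@continuous_borel (pow k E) E); exact: pow_proj_continuous.
Qed.

Section standard_instances.
Context (R : realType) (S : polishType R).

(** The double array is coded as a single sequence in S^oo, where measurability is coordinatewise,
    and decoding is continuous. *)
Lemma measurable_pow_pow n d (T : measurableType d) k (f : T -> pow k (pow n S)) :
  (forall i, measurable_fun setT (fun t => f t i : borel (pow n S))) ->
  measurable_fun setT (f : T -> borel (pow k (pow n S))).
Proof.
move=> mf.
pose h (t : T) : pow None S := fun m =>
  if unpickle (val m) is Some (i, j) then f t i j else point.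
pose phi (z : pow None S) : pow k (pow n S) :=
  fun i j => z (exist _ (pickle (i, j)) isT).
have -> : f = phi \o h.
  apply/funext => t; apply/funext => i; apply/funext => j.
  by rewrite /phi /h /= pickleK.
apply: (@measurableT_comp _ _ _ _ _ _ (phi : borel _ -> borel _)).
  apply: (@continuous_borel (pow None S) (pow k (pow n S))).
  apply: continuous_pow => i; apply: continuous_pow => j.
  exact: pow_proj_continuous.
apply: measurable_pow => m; rewrite /h; case: unpickle => [[i j]|//].
exact: (measurableT_comp (@measurable_proj _ n j) (mf i)).
Qed.

Lemma standard_polish : standard R S.
Proof.
split; first by move=> d T k f; exact: measurable_pow.
move=> nu; apply: (@iid_exists R S S unit (fun _ x => x) (fun f => f tt)) => //.
- by move=> [].
- by move=> d T f /(_ tt).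
- by move=> d T f; exact: measurable_pow.
Qed.

Lemma standard_polish_pow n : standard R (pow n S).
Proof.
split; first by move=> d T k f; exact: measurable_pow_pow.
move=> nu; apply: (@iid_exists R S (pow n S) (idx n) (fun j x => x j) id) => //.
- by move=> j; exact: measurable_proj.
- by move=> d T f; exact: measurable_pow.
- by move=> d T f; exact: measurable_pow_pow.
Qed.

End standard_instances.

(** * Cylinder events and laws of i.i.d. sequences *)

Section cylinders.
Context (R : realType) (E : ptopologicalType).
Hypothesis sE : standard R E.

Definition cyl k (s : seq (idx k)) (A : idx k -> set (borel E)) : set (borel (pow k E)) :=
  [set x | forall i, i \in s -> A i (x i)].

Lemma measurable_cyl k (s : seq (idx k)) A : (forall i, measurable (A i)) ->
  measurable (cyl s A).
Proof.
move=> mA; rewrite (_ : cyl s A = \bigcap_(i in [set` s]) ((fun x => x i) @^-1` A i))//.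
apply: fin_bigcap_measurable => // i _.
exact: (measurable_pre (@measurable_proj E k i)).
Qed.

Lemma cylI k (s s' : seq (idx k)) A A' :
  (forall i, measurable (A i)) -> (forall i, measurable (A' i)) ->
  exists s2 A2, [/\ uniq s2, forall i, measurable (A2 i) &
    cyl s A `&` cyl s' A' = cyl s2 A2].
Proof.
move=> mA mA'; exists (undup (s ++ s')), (fun i => (if i \in s then A i else setT) `&`
    (if i \in s' then A' i else setT)); split.
- exact: undup_uniq.
- by move=> i; apply: measurableI; case: ifP.
- apply/seteqP; split=> [x [h1 h2] i _|x H].
    by split; case: ifP => //; [exact: h1|exact: h2].
  by split=> i i_s; have := H i; rewrite mem_undup mem_cat i_s ?orbT;
    move=> /(_ isT)[].
Qed.

Lemma cyl1 k (i : idx k) (B : set (borel E)) :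
  (fun x : pow k E => x i) @^-1` B = cyl [:: i] (fun=> B).
Proof.
apply/seteqP; split=> x; last by apply; rewrite mem_head.
by move=> Bx j; rewrite inE => /eqP ->.
Qed.

Definition rects d (T : measurableType d) k : set (set (T * borel (pow k E))%type) :=
  [set C | exists B s A, [/\ measurable B, uniq s, forall i, measurable (A i) &
    C = B `*` cyl s A]].

Lemma rects_measurable d (T : measurableType d) k : @rects d T k `<=` measurable.
Proof.
by move=> _ [B [s [A [mB us mA ->]]]]; apply: measurableX => //; exact: measurable_cyl.
Qed.

Lemma rects_setI d (T : measurableType d) k : setI_closed (@rects d T k).
Proof.
move=> _ _ [B [s [A [mB us mA ->]]]] [B' [s' [A' [mB' us' mA' ->]]]].
have [s2 [A2 [us2 mA2 e]]] := cylI s s' mA mA'.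
exists (B `&` B'), s2, A2; split => //; first exact: measurableI.
by rewrite -e setXI.
Qed.

Lemma rects_generate d (T : measurableType d) k :
  measurable `<=` <<s @rects d T k >>.
Proof.
suff H : measurable_fun setT
    (id : g_sigma_algebraType (@rects d T k) -> (T * borel (pow k E))%type).
  by move=> A mA; have := measurable_pre H mA.
apply/measurable_fun_pairP; split.
  move=> _ B mB; rewrite setTI; apply: sub_sigma_algebra.
  exists B, [::], (fun=> setT); split => //.
  by apply/seteqP; split=> [[a x] h|[a x] []//]; split=> //= i.
apply: (standard_pow sE) => i _ B mB; rewrite setTI; apply: sub_sigma_algebra.
exists setT, [:: i], (fun=> B); split => //.
apply/seteqP; split=> -[a x] /=.
  by move=> Bx; split => // j; rewrite inE => /eqP ->.
by move=> [_ /(_ i (mem_head _ _))].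
Qed.

Lemma pair_pow_unique d (T : measurableType d) k
    (P Q : probability (T * borel (pow k E))%type R) :
  (forall B s A, measurable B -> uniq s -> (forall i, measurable (A i)) ->
    pr P (B `*` cyl s A) = pr Q (B `*` cyl s A)) -> P =m Q.
Proof.
move=> PQ; apply: (prob_unique (@rects_generate d T k)).
- exact: rects_measurable.
- exact: rects_setI.
- by move=> _ [B [s [A [mB us mA ->]]]]; exact: PQ.
Qed.

Lemma pow_unique k (P Q : probability (borel (pow k E)) R) :
  (forall s A, uniq s -> (forall i, measurable (A i)) ->
    pr P (cyl s A) = pr Q (cyl s A)) -> P =m Q.
Proof.
move=> PQ; pose G : set (set (borel (pow k E))) := [set C | exists s A,
  [/\ uniq s, forall i, measurable (A i) & C = cyl s A]].
apply: (@prob_unique _ _ R G).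
- suff H : measurable_fun setT (id : g_sigma_algebraType G -> borel (pow k E)).
    by move=> A mA; have := measurable_pre H mA.
  apply: (standard_pow sE) => i _ B mB; rewrite setTI; apply: sub_sigma_algebra.
  by exists [:: i], (fun=> B); split => //; rewrite -cyl1.
- by move=> _ [s [A [us mA ->]]]; exact: measurable_cyl.
- move=> _ _ [s [A [us mA ->]]] [s' [A' [us' mA' ->]]].
  have [s2 [A2 [us2 mA2 e]]] := cylI s s' mA mA'.
  by exists s2, A2; split.
- by move=> _ [s [A [us mA ->]]]; exact: PQ.
Qed.

End cylinders.

Section iid_law_facts.
Context (R : realType) (E : ptopologicalType).
Hypothesis sE : standard R E.

Lemma iid_law_iid (nu : probability (borel E) R) :
  iid (iid_law nu) setT (fun i x => x i : borel E) nu.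
Proof. exact: (getPex (standard_iid sE nu)). Qed.

Lemma pr_iid_law_cyl (nu : probability (borel E) R) s A : uniq s ->
  (forall i, measurable (A i)) ->
  pr (iid_law nu) (cyl s A) = \prod_(i <- s) pr nu (A i).
Proof.
move=> us mA; have [h1 h2] := iid_law_iid nu.
rewrite /pr (h2 s A us)//.
rewrite (eq_bigr (fun i => (pr nu (A i))%:E)) => [|i _]; first by rewrite prodEFin.
by rewrite -prE//; exact: h1.
Qed.

(** A node of the tree has children below [d] only, while [iid_law] lives on infinite sequences.
    Overwriting the coordinates outside [D] by a constant makes the two comparable without affecting
    random maps that read coordinates in [D] alone. *)
Definition cut (D : set nat) (z : pow None E) : pow None E :=
  fun i => if `[< D (val i) >] then z i else point.

Lemma measurable_cut D :
  measurable_fun setT (cut D : borel (pow None E) -> borel (pow None E)).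
Proof.
apply: (standard_pow sE) => i; rewrite /cut; case: asboolP => // _.
exact: measurable_proj.
Qed.

Section cut_law.
Context d1 (T1 : measurableType d1) (m1 : probability T1 R).
Variables (nu : probability (borel E) R) (D : set nat).

(** [o] has law [m1] and is independent of the coordinates of [Z] in [D], which are i.i.d. with law
    [nu]. The law of the coordinates outside [D] is left open. *)
Definition cut_product d (W : measurableType d) (P : probability W R)
    (o : W -> T1) (Z : W -> pow None E) :=
  [/\ measurable_fun setT o, measurable_fun setT (Z : W -> borel (pow None E)) &
   forall B s A, measurable B -> uniq s -> (forall i, i \in s -> D (val i)) ->
    (forall i, measurable (A i)) ->
    pr P (o @^-1` B `&` Z @^-1` (cyl s A)) = pr m1 B * \prod_(i <- s) pr nu (A i)].

(** A cut coordinate is constant, so it contributes 1 or 0 according to whether [point] satisfies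
    its condition. *)
Lemma cut_productE d (W : measurableType d) (P : probability W R) o Z :
  cut_product P o Z -> forall B s A, measurable B -> uniq s ->
    (forall i, measurable (A i)) ->
    pr P (o @^-1` B `&` (cut D \o Z) @^-1` (cyl s A)) = pr m1 B *
      \prod_(i <- s) if `[< D (val i) >] then pr nu (A i)
        else if `[< A i point >] then 1 else 0.
Proof.
move=> [mo mZ H] B s A mB us mA.
have [/allP Hs|/allPn[i i_s]] := boolP (all (fun i : idx None =>
    `[< D (val i) >] || `[< A i point >]) s).
  pose s' := [seq i <- s | `[< D (val i) >]].
  have -> : (cut D \o Z) @^-1` (cyl s A) = Z @^-1` (cyl s' A).
    apply/seteqP; split=> w h i.
      by rewrite mem_filter => /andP[Di i_s]; have := h i i_s; rewrite /= /cut Di.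
    move=> i_s; rewrite /= /cut; have := Hs i i_s.
    case: asboolP => [Di _|_ /asboolP //].
    by apply: h; rewrite mem_filter i_s andbT; apply/asboolP.
  rewrite H//; first last.
  - by move=> i; rewrite mem_filter => /andP[/asboolP].
  - exact: filter_uniq.
  congr (_ * _); rewrite big_filter big_mkcond/=; apply: eq_big_seq => i i_s.
  by have := Hs i i_s; case: asboolP => //= _ ->.
rewrite negb_or => /andP[/negbTE Di /negbTE Ai].
rewrite (_ : _ `&` _ = set0) ?pr_set0; last first.
  apply/seteqP; split=> // w [_ /(_ i i_s)]; rewrite /= /cut Di => h.
  by move/asboolP: Ai; apply.
by rewrite (big_rem i i_s)/= Di Ai mul0r mulr0.
Qed.

Lemma iid_law_cut_product :
  cut_product (m1 \x iid_law nu)%E fst snd.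
Proof.
split; [exact: measurable_fst|exact: measurable_snd|].
move=> B s A mB us _ mA; have mc := measurable_cyl s mA.
rewrite (_ : _ `&` _ = B `*` cyl s A); last by [].
transitivity (fine (m1 B * iid_law nu (cyl s A))%E).
  by congr fine; exact: product_measure1E.
by rewrite !prE// -EFinM/= pr_iid_law_cyl.
Qed.

Lemma cut_law d (W : measurableType d) (P : probability W R) o Z :
  cut_product P o Z -> forall C : set (T1 * borel (pow None E))%type, measurable C ->
  pr P [set w | C (o w, cut D (Z w))] =
  pr (m1 \x iid_law nu)%E [set az | C (az.1, cut D az.2)].
Proof.
move=> HW C mC; have [mo mZ _] := HW; have Hi := iid_law_cut_product.
have [mo' mZ' _] := Hi.
have mf d' (W' : measurableType d') (o' : W' -> T1) (Z' : W' -> pow None E) :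
    measurable_fun setT o' -> measurable_fun setT (Z' : W' -> borel (pow None E)) ->
    measurable_fun setT (fun w => (o' w, cut D (Z' w)) : (T1 * borel (pow None E))%type).
  move=> h1 h2; apply/measurable_fun_pairP; split => //.
  exact: (measurableT_comp (measurable_cut D) h2).
suff : law P (mf _ _ _ _ mo mZ) =m law (m1 \x iid_law nu)%E (mf _ _ _ _ mo' mZ').
  by move=> /eq_lawP /(_ C mC).
apply: pair_pow_unique => // B s A mB us mA; rewrite !pr_law.
by rewrite (cut_productE HW mB us mA) (cut_productE Hi mB us mA).
Qed.

End cut_law.
End iid_law_facts.

(** * The maps T and their iterates *)

Section apply_random_map.
Context d (Omega : measurableType d) (R : realType) (r : probability Omega R).

(** The integrand behind [rde_map], as one map on pairs. Reading the first terms of an infinite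
    sequence avoids transport along the arity. *)
Definition rapply (E : ptopologicalType) (g : random_map Omega E)
    (wx : Omega * borel (pow None E)) : borel E :=
  gam g wx.1 (restrict (arity g wx.1) wx.2).

Lemma measurable_rapply (E : ptopologicalType) (g : random_map Omega E) :
  measurable_fun setT (rapply g).
Proof.
move=> _ B mB; rewrite setTI.
have -> : rapply g @^-1` B = \bigcup_(k : natbar)
    ((fun wx => (wx.1, restrict k wx.2) : Omega * borel (pow k E)) @^-1`
     [set wx : Omega * borel (pow k E) | exists e : k = arity g wx.1,
        B (gam g wx.1 (eq_rect k (fun k' => pow k' E) wx.2 _ e))]).
  apply/seteqP; split=> [wx /= BG|[w x] [k _ [/= e]]].
    by exists (arity g wx.1) => //=; exists erefl.
  by subst k.
apply: countable_bigcupT_measurable => [|k]; first exact: countableP.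
have mh : measurable_fun setT (fun wx : Omega * borel (pow None E) =>
    (wx.1, restrict k wx.2) : Omega * borel (pow k E)).
  apply/measurable_fun_pairP; split; first exact: measurable_fst.
  by apply: (measurableT_comp (@measurable_restrict E k)); exact: measurable_snd.
exact: (measurable_pre mh (measurable_gam g (k := k) mB)).
Qed.

Lemma pr_Tmap (E : ptopologicalType) (g : random_map Omega E) nu A :
  pr (Tmap r g nu) A = pr (r \x iid_law nu)%E (rapply g @^-1` A).
Proof. by congr fine; apply: eq_integral => w _; rewrite /= xsectionE. Qed.

Lemma rapply_cut (E : ptopologicalType) (g : random_map Omega E) (D : set nat) w z :
  (forall i, below (arity g w) i -> D i) ->
  rapply g (w, cut D z) = rapply g (w, z).
Proof.
move=> gD; rewrite /rapply /=; congr (gam g w _); apply/funext => i.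
by rewrite /restrict /cut /=; case: asboolP => // -[]; exact: gD (valP i).
Qed.

(** T(nu) may be computed on any sample space with the right independence: cutting to [D] changes
    neither outcome, and the cut pairs have the same law. *)
Lemma pr_Tmap_law (E : ptopologicalType) (sE : standard R E)
    (g : random_map Omega E) nu (D : set nat)
    d' (W : measurableType d') (P : probability W R) (o : W -> Omega)
    (Z : W -> pow None E) :
  (forall w i, below (arity g w) i -> D i) -> cut_product r nu D P o Z ->
  forall A, measurable A ->
  pr P [set w | A (rapply g (o w, Z w))] = pr (Tmap r g nu) A.
Proof.
move=> gD HP A mA; rewrite pr_Tmap.
have mC := measurable_pre (@measurable_rapply _ g) mA.
have := cut_law sE HP mC; rewrite (_ : [set _ | _] = [set w | A (rapply g (o w, Z w))]).
  move=> ->; congr pr; apply/seteqP; split=> -[w z] /=; rewrite rapply_cut//; exact: gD.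
by apply/seteqP; split=> w /=; rewrite rapply_cut//; exact: gD.
Qed.

Definition law_image (E E' : ptopologicalType) (phi : E -> E')
    (nu : probability (borel E) R) (nu' : probability (borel E') R) :=
  forall A, measurable A -> pr nu' A = pr nu (phi @^-1` A).

(** Applying [phi] termwise to an i.i.d. sequence gives an i.i.d. sequence, and [phi] commutes with
    the random maps. Projections, reindexings of coordinates and the diagonal embedding are all of
    this kind. *)
Lemma Tmap_image (E E' : ptopologicalType) (sE : standard R E)
    (sE' : standard R E') (g : random_map Omega E) (g' : random_map Omega E')
    (phi : E -> E') :
  measurable_fun setT (phi : borel E -> borel E') ->
  (forall w z, rapply g' (w, fun i => phi (z i)) = phi (rapply g (w, z))) ->
  forall nu nu', law_image phi nu nu' ->
    law_image phi (Tmap r g nu) (Tmap r g' nu').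
Proof.
move=> mphi phiG nu nu' nunu' A mA.
rewrite -(@pr_Tmap_law _ sE' g' nu' setT _ _ (r \x iid_law nu)%E fst
  (fun wz i => phi (wz.2 i)))//.
  rewrite pr_Tmap; congr pr; apply/seteqP; split=> -[w z] /=; by rewrite phiG.
have [mo mZ H] := iid_law_cut_product sE r nu setT.
split=> //.
  apply: (standard_pow sE') => i; apply: (measurableT_comp mphi).
  exact: (measurableT_comp (@measurable_proj E None i)).
move=> B s C mB us _ mC.
have := H B s (fun i => phi @^-1` C i) mB us (fun _ _ => I).
rewrite /preimage/cyl/= => ->; last by move=> i; exact: (measurable_pre mphi (mC i)).
by congr (_ * _); apply: eq_bigr => i _; rewrite nunu'.
Qed.

Lemma iter_Tmap_image (E E' : ptopologicalType) (sE : standard R E)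
    (sE' : standard R E') (g : random_map Omega E) (g' : random_map Omega E')
    (phi : E -> E') :
  measurable_fun setT (phi : borel E -> borel E') ->
  (forall w z, rapply g' (w, fun i => phi (z i)) = phi (rapply g (w, z))) ->
  forall t nu nu', law_image phi nu nu' ->
    law_image phi (iter t (Tmap r g) nu) (iter t (Tmap r g') nu').
Proof.
move=> mphi phiG; elim=> //= t IH nu nu' h.
by apply: (Tmap_image sE sE') => //; exact: IH.
Qed.

Lemma iter_Tmap_eq (E : ptopologicalType) (sE : standard R E)
    (g : random_map Omega E) t (nu nu' : probability (borel E) R) : nu =m nu' ->
    iter t (Tmap r g) nu =m iter t (Tmap r g) nu'.
Proof.
move=> h; apply/eq_lawP => A mA; symmetry.
apply: (iter_Tmap_image sE sE (phi := id)) => // B mB.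
by apply/esym; move: B mB; apply/eq_lawP.
Qed.

Lemma iter_Tmap_fix (E : ptopologicalType) (sE : standard R E)
    (g : random_map Omega E) t (nu : probability (borel E) R) : Tmap r g nu =m nu ->
    iter t (Tmap r g) nu =m nu.
Proof.
move=> h; elim: t => //= t IH A mA.
rewrite -(h A mA); exact: (@iter_Tmap_eq E sE g 1 _ _ IH).
Qed.

End apply_random_map.

Section nvariate_images.
Context d (Omega : measurableType d) (R : realType) (r : probability Omega R).
Context (S : polishType R) (g : random_map Omega S).

Lemma iter_nvariate_image n m (h : idx m -> idx n) t nu nu' :
  law_image (fun (x : pow n S) => (fun i => x (h i)) : pow m S) nu nu' ->
  law_image (fun (x : pow n S) => (fun i => x (h i)) : pow m S)
    (iter t (Tmap r (nvariate n g)) nu) (iter t (Tmap r (nvariate m g)) nu').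
Proof.
move=> hh; apply: (@iter_Tmap_image _ _ _ r _ _ (standard_polish_pow S n)
  (standard_polish_pow S m) (nvariate n g) (nvariate m g) (fun x i => x (h i))) => //.
by apply: measurable_pow => i; exact: measurable_proj.
Qed.

Lemma iter_nvariate_proj n (j : idx n) t nu nu' :
  law_image (fun x : pow n S => x j) nu nu' ->
  law_image (fun x : pow n S => x j)
    (iter t (Tmap r (nvariate n g)) nu) (iter t (Tmap r g) nu').
Proof.
move=> hh; apply: (@iter_Tmap_image _ _ _ r _ _ (standard_polish_pow S n)
  (standard_polish S) (nvariate n g) g (fun x => x j)) => //.
exact: measurable_proj.
Qed.

Lemma Tmap_nvariate_diag n nu nu' :
  law_image (fun (x : S) => (fun _ => x) : pow n S) nu nu' ->
  law_image (fun (x : S) => (fun _ => x) : pow n S)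
    (Tmap r g nu) (Tmap r (nvariate n g) nu').
Proof.
move=> hh; apply: (@Tmap_image _ _ _ r _ _ (standard_polish S) (standard_polish_pow S n)
  g (nvariate n g) (fun x _ => x)) => //.
exact: measurable_diag.
Qed.

End nvariate_images.

(** * Bimeasures and couplings *)

Section second_moments.
Context d (T : measurableType d) (R : realType) (P : probability T R).

(** The double sum is the second moment of the linear combination of the indicators of the [E i]
    with coefficients [c i]. *)
Lemma sum_pr_setI_ge0 (I : finType) (E : I -> set T) (c : I -> R) :
  (forall i, measurable (E i)) ->
  0 <= \sum_i \sum_j c i * c j * pr P (E i `&` E j).
Proof.
move=> mE; rewrite pair_bigA /=.
pose f (ij : I * I) (x : T) : \bar R :=
  ((c ij.1 * c ij.2)%:E * (\1_(E ij.1 `&` E ij.2) x)%:E)%E.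
have mEE (ij : I * I) : measurable (E ij.1 `&` E ij.2) by exact: measurableI.
have iI (ij : I * I) : P.-integrable setT (fun x => (\1_(E ij.1 `&` E ij.2) x)%:E).
  exact: integrable_indic.
have fi ij : P.-integrable setT (f ij) by exact: integrableZl.
rewrite -lee_fin -sumEFin.
have -> : (\sum_(ij : I * I) (c ij.1 * c ij.2 * pr P (E ij.1 `&` E ij.2))%:E =
    \int[P]_x \sum_(ij : I * I) f ij x)%E.
  rewrite integral_sum//; apply: eq_bigr => ij _.
  rewrite /f integralZl// integral_indic// setIT EFinM; congr (_ * _)%E.
  by apply/esym; exact: prE.
apply: integral_ge0 => x _; rewrite /f.
rewrite (eq_bigr (fun ij : I * I =>
  ((c ij.1 * \1_(E ij.1) x) * (c ij.2 * \1_(E ij.2) x))%:E)); last first.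
  by move=> [i j] _ /=; rewrite indicI -EFinM; congr EFin; rewrite /=; ring.
rewrite sumEFin lee_fin.
rewrite -(pair_bigA _ (fun i j => (c i * \1_(E i) x) * (c j * \1_(E j) x)))/=.
under eq_bigr do rewrite -big_distrr/=.
by rewrite -big_distrl/= -expr2 sqr_ge0.
Qed.

End second_moments.

Section dominated_contents.
Context d (T : measurableType d) (R : realType) (m : probability T R).

(** Additivity is only finite; the bound by [m] supplies continuity along monotone sequences,
    uniformly over all dominated set functions. *)
Definition dominated (phi : set T -> R) :=
  (forall A, measurable A -> 0 <= phi A <= pr m A) /\
  (forall A B, measurable A -> measurable B ->
    phi A = phi (A `&` B) + phi (A `\` B)).

(** The sets with convergence form a lambda-system. Along an increasing union, stopping at stage n
    costs at most the [m]-measure of the remainder, uniformly in t, so the two limits can be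
    exchanged. *)
Lemma dominated_cvg (G : set (set T)) (phi : nat -> set T -> R)
    (psi : set T -> R) :
  G `<=` measurable -> measurable `<=` <<s G >> -> setI_closed G ->
  (forall t, dominated (phi t)) -> dominated psi ->
  (phi t setT @[t --> \oo] --> psi setT) ->
  (forall A, G A -> phi t A @[t --> \oo] --> psi A) ->
  forall A, measurable A -> phi t A @[t --> \oo] --> psi A.
Proof.
move=> Gm mG GI dphi dpsi phiT phiG A mA.
pose H := [set A | measurable A /\ phi t A @[t --> \oo] --> psi A].
suff : H A by case.
apply: (lambda_system_subset GI (D := setT)) (mG A mA) => //; last first.
  by move=> B GB; split; [exact: Gm|exact: phiG].
have sub f B C : dominated f -> measurable B -> measurable C -> B `<=` C ->
    f (C `\` B) = f C - f B.
  move=> [_ fa] mB mC BC; have := fa _ _ mC mB; rewrite setIC setIidl// => ->; ring.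
split => //.
- move=> B C CB [mB cB] [mC cC]; split; first exact: measurableD.
  rewrite sub//; under eq_fun do rewrite sub//.
  exact: cvgB.
- move=> F ndF HF.
  have mF n : measurable (F n) by case: (HF n).
  have mU : measurable (\bigcup_n F n) by exact: bigcup_measurable.
  split => //; apply/cvgrPdist_le => e e0.
  have e3 : 0 < e / 3 by rewrite divr_gt0.
  have /cvgrPdist_le /(_ _ e3) [n _ /(_ n (leqnn n)) /= nU] := @pr_cvg_up _ _ _ m F mF ndF.
  have FU : F n `<=` \bigcup_k F k by exact: bigcup_sup.
  have close f : dominated f -> `|f (\bigcup_k F k) - f (F n)| <= e / 3.
    move=> df; have [/(_ _ (measurableD mU (mF n))) /andP[h1 h2] _] := df.
    rewrite -sub// ger0_norm//; apply: (le_trans h2); apply: le_trans nU.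
    rewrite (pr_split m mU (mF n)) (_ : _ `&` F n = F n); last first.
      by rewrite setIC; exact/setIidl.
    by rewrite addrAC subrr add0r ler_norm.
  have [_ /cvgrPdist_le /(_ _ e3)] := HF n.
  apply: filterS => t ht.
  have := close _ dpsi; have := close _ (dphi t); move: ht.
  by rewrite !ler_norml => /andP[? ?] /andP[? ?] /andP[? ?]; apply/andP; split; lra.
Qed.

End dominated_contents.

Section bimeasures.
Context d (T : measurableType d) (R : realType) (m : probability T R).

(** What remains of a coupling of [m] with itself when it is tested on rectangles only. Every
    condition passes to pointwise limits, whereas an actual measure on the product would have to be
    recovered after the limit. *)
Record bimeasure (beta : set T -> set T -> R) : Prop := Bimeasure {
  bimeasure_ge0 : forall A B, measurable A -> measurable B -> 0 <= beta A B ;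
  bimeasure_splitl : forall A B C, measurable A -> measurable B -> measurable C ->
    beta A C = beta (A `&` B) C + beta (A `\` B) C ;
  bimeasure_splitr : forall A B C, measurable A -> measurable B -> measurable C ->
    beta C A = beta C (A `&` B) + beta C (A `\` B) ;
  bimeasure_l : forall A, measurable A -> beta A setT = pr m A ;
  bimeasure_r : forall A, measurable A -> beta setT A = pr m A }.

Lemma bimeasure_dominatedl beta B : bimeasure beta -> measurable B ->
  dominated m (beta^~ B).
Proof.
move=> hb mB; split=> [A mA|A C mA mC]; last exact: bimeasure_splitl.
rewrite bimeasure_ge0//= -(bimeasure_l hb mA) (bimeasure_splitr hb measurableT mB mA).
by rewrite setTI lerDl bimeasure_ge0//; exact: measurableD.
Qed.

Lemma bimeasure_dominatedr beta B : bimeasure beta -> measurable B ->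
  dominated m (beta B).
Proof.
move=> hb mB; split=> [A mA|A C mA mC]; last exact: bimeasure_splitr.
rewrite bimeasure_ge0//= -(bimeasure_r hb mA) (bimeasure_splitl hb measurableT mB mA).
by rewrite setTI lerDl bimeasure_ge0//; exact: measurableD.
Qed.

Lemma bimeasure_cvg (G : set (set T)) (beta : nat -> set T -> set T -> R) b :
  G `<=` measurable -> measurable `<=` <<s G >> -> setI_closed G ->
  (forall t, bimeasure (beta t)) -> bimeasure b ->
  (forall A B, G A -> G B -> beta t A B @[t --> \oo] --> b A B) ->
  forall A B, measurable A -> measurable B ->
    beta t A B @[t --> \oo] --> b A B.
Proof.
move=> Gm mG GI hbeta hb cG.
have H B A : G B -> measurable A -> beta t A B @[t --> \oo] --> b A B.
  move=> GB; have mB := Gm _ GB.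
  apply: (@dominated_cvg _ _ _ m G (fun t => (beta t)^~ B) (b^~ B)) => //.
  - by move=> t; exact: bimeasure_dominatedl.
  - exact: bimeasure_dominatedl.
  - under eq_fun do rewrite (bimeasure_r (hbeta _) mB).
    by rewrite (bimeasure_r hb mB); exact: cvg_cst.
  - by move=> C GC; exact: cG.
move=> A B mA; apply: (@dominated_cvg _ _ _ m G (fun t => (beta t) A) (b A)) => //.
- by move=> t; exact: bimeasure_dominatedr.
- exact: bimeasure_dominatedr.
- under eq_fun do rewrite (bimeasure_l (hbeta _) mA).
  by rewrite (bimeasure_l hb mA); exact: cvg_cst.
- by move=> C GC; exact: H.
Qed.

Lemma bimeasure_eq (G : set (set T)) b b' :
  G `<=` measurable -> measurable `<=` <<s G >> -> setI_closed G ->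
  bimeasure b -> bimeasure b' -> (forall A B, G A -> G B -> b A B = b' A B) ->
  forall A B, measurable A -> measurable B -> b A B = b' A B.
Proof.
move=> Gm mG GI hb hb' bb' A B mA mB.
have := @bimeasure_cvg G (fun=> b) b' Gm mG GI (fun=> hb) hb'.
move=> /(_ _ A B mA mB) H; apply/esym; apply: cvg_unique (H _) _ => //.
  by move=> A' B' GA' GB'; rewrite bb'//; exact: cvg_cst.
exact: cvg_cst.
Qed.

Lemma bimeasure_lim (beta : nat -> set T -> set T -> R) b :
  (forall t, bimeasure (beta t)) ->
  (forall A B, measurable A -> measurable B ->
    beta t A B @[t --> \oo] --> b A B) -> bimeasure b.
Proof.
move=> hbeta cb; split.
- move=> A B mA mB; apply: (cvgr_to_ge (cb A B mA mB)).
  by apply: nearW => t; exact: bimeasure_ge0.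
- move=> A B C mA mB mC.
  have e : (fun t => beta t A C) =
      (fun t => beta t (A `&` B) C + beta t (A `\` B) C).
    by apply/funext => t; exact: (bimeasure_splitl (hbeta t)).
  have := cb A C mA mC; rewrite e => h; apply: (cvg_unique _ h) => //.
  by apply: cvgD; apply: cb => //; [exact: measurableI|exact: measurableD].
- move=> A B C mA mB mC.
  have e : (fun t => beta t C A) =
      (fun t => beta t C (A `&` B) + beta t C (A `\` B)).
    by apply/funext => t; exact: (bimeasure_splitr (hbeta t)).
  have := cb C A mC mA; rewrite e => h; apply: (cvg_unique _ h) => //.
  by apply: cvgD; apply: cb => //; [exact: measurableI|exact: measurableD].
- move=> A mA.
  have e : (fun t => beta t A setT) = (fun=> pr m A).
    by apply/funext => t; exact: (bimeasure_l (hbeta t)).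
  have := cb A setT mA measurableT; rewrite e => h; apply: (cvg_unique _ h) => //.
  exact: cvg_cst.
- move=> A mA.
  have e : (fun t => beta t setT A) = (fun=> pr m A).
    by apply/funext => t; exact: (bimeasure_r (hbeta t)).
  have := cb setT A measurableT mA; rewrite e => h; apply: (cvg_unique _ h) => //.
  exact: cvg_cst.
Qed.

Lemma coupling_bimeasure d' (W : measurableType d') (P : probability W R)
    (f f' : W -> T) : measurable_fun setT f -> measurable_fun setT f' ->
  (forall A, measurable A -> pr P (f @^-1` A) = pr m A) ->
  (forall A, measurable A -> pr P (f' @^-1` A) = pr m A) ->
  bimeasure (fun A B => pr P (f @^-1` A `&` f' @^-1` B)).
Proof.
move=> mf mf' hf hf'.
have mpf A : measurable A -> measurable (f @^-1` A) by exact: measurable_pre.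
have mpf' A : measurable A -> measurable (f' @^-1` A) by exact: measurable_pre.
split.
- by move=> A B mA mB; exact: pr_ge0.
- move=> A B C mA mB mC.
  rewrite (@pr_split _ _ _ P (f @^-1` A `&` f' @^-1` C) (f @^-1` B)); last 2 first.
  + by apply: measurableI; [exact: mpf|exact: mpf'].
  + exact: mpf.
  by congr (pr P _ + pr P _); apply/seteqP; split=> w /=; firstorder.
- move=> A B C mA mB mC.
  rewrite (@pr_split _ _ _ P (f @^-1` C `&` f' @^-1` A) (f' @^-1` B)); last 2 first.
  + by apply: measurableI; [exact: mpf|exact: mpf'].
  + exact: mpf'.
  by congr (pr P _ + pr P _); apply/seteqP; split=> w /=; firstorder.
- by move=> A mA; rewrite preimage_setT setIT hf.
- by move=> A mA; rewrite preimage_setT setTI hf'.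
Qed.

End bimeasures.

Notation two := (Some 2%N).

Definition fst2 : idx two := exist _ 0%N isT.
Definition snd2 : idx two := exist _ 1%N isT.

Lemma idx2_case (i : idx two) : i = fst2 \/ i = snd2.
Proof. by case: i => [[|[|//]] h]; [left|right]; exact: val_inj. Qed.

Definition select n (j k : idx n) : idx two -> idx n :=
  fun i => if val i == 0%N then j else k.

Lemma pr_setX d1 (T1 : measurableType d1) d2 (T2 : measurableType d2)
    (R : realType) (P : probability T1 R) (Q : probability T2 R) C D :
  measurable C -> measurable D -> pr (P \x Q)%E (C `*` D) = pr P C * pr Q D.
Proof.
move=> mC mD; transitivity (fine (P C * Q D)%E).
  by congr fine; exact: product_measure1E.
by rewrite (prE P mC) (prE Q mD).
Qed.

Section pairs.
Context (R : realType) (S : polishType R).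
Local Notation law1 := (probability (borel S) R).

Definition pair_event n (j k : idx n) (A B : set (borel S)) : set (borel (pow n S)) :=
  [set x | A (x j) /\ B (x k)].

Lemma measurable_coord n (j : idx n) (A : set (borel S)) : measurable A ->
  measurable ([set x | A (x j)] : set (borel (pow n S))).
Proof. by move=> mA; exact: (measurable_pre (@measurable_proj S n j) mA). Qed.

Lemma measurable_pair_event n (j k : idx n) A B : measurable A -> measurable B ->
  measurable (pair_event j k A B).
Proof. by move=> mA mB; apply: measurableI; exact: measurable_coord. Qed.

Lemma pow2_unique (P Q : probability (borel (pow two S)) R) :
  (forall A B, measurable A -> measurable B ->
    pr P (pair_event fst2 snd2 A B) = pr Q (pair_event fst2 snd2 A B)) -> P =m Q.
Proof.
move=> PQ; apply: (pow_unique (standard_polish S)) => s A us mA.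
pose A' i := if i \in s then A i else setT.
have mA' i : measurable (A' i) by rewrite /A'; case: ifP.
rewrite (_ : cyl s A = pair_event fst2 snd2 (A' fst2) (A' snd2)); first exact: PQ.
apply/seteqP; split=> x h.
  by split; rewrite /A'; case: ifP => // /h.
move=> i i_s; have [h1 h2] := h; have [e|e] := idx2_case i; subst i.
  by move: h1; rewrite /A' i_s.
by move: h2; rewrite /A' i_s.
Qed.

Lemma measurable_reindex n m (h : idx m -> idx n) : measurable_fun setT
  ((fun (x : pow n S) => (fun i => x (h i)) : pow m S) : borel _ -> borel _).
Proof. by apply: measurable_pow => i; exact: measurable_proj. Qed.

Lemma pair_image n (j k : idx n) (nu : probability (borel (pow n S)) R)
    (nu2 : probability (borel (pow two S)) R) :
  (forall A B, measurable A -> measurable B ->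
    pr nu (pair_event j k A B) = pr nu2 (pair_event fst2 snd2 A B)) ->
  law_image (fun (x : pow n S) => (fun i => x (select j k i)) : pow two S) nu nu2.
Proof.
move=> H; suff /eq_lawP E : nu2 =m law nu (measurable_reindex (select j k)).
  by move=> A mA; rewrite E.
by apply: pow2_unique => A B mA mB; rewrite -H.
Qed.

Definition prod2 (mu : law1) : probability (borel (pow two S)) R :=
  law (iid_law mu) (@measurable_restrict S two).

Definition nth_idx (i : nat) : idx None := exist _ i isT.

Lemma pr_iid_pair (mu : law1) (i j : idx None) A B : i != j ->
  measurable A -> measurable B ->
  pr (iid_law mu) (pair_event i j A B) = pr mu A * pr mu B.
Proof.
move=> ij mA mB; pose C k := if k == i then A else B.
have mC k : measurable (C k) by rewrite /C; case: ifP.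
have Ci : C i = A by rewrite /C eqxx.
have Cj : C j = B by rewrite /C eq_sym (negbTE ij).
rewrite (_ : pair_event i j A B = cyl [:: i; j] C).
  rewrite (pr_iid_law_cyl (standard_polish S))//= ?inE ?andbT//.
  by rewrite !big_cons big_nil Ci Cj mulr1.
apply/seteqP; split=> x h.
  by move=> k; rewrite !inE => /orP[/eqP ->|/eqP ->]; rewrite ?Ci ?Cj; case: h.
by split; [rewrite -Ci|rewrite -Cj]; apply: h; rewrite !inE eqxx ?orbT.
Qed.

Lemma pr_iid_coord (mu : law1) (i : idx None) (A : set (borel S)) : measurable A ->
  pr (iid_law mu) [set x : pow None S | A (x i)] = pr mu A.
Proof.
move=> mA; have [h _] := iid_law_iid (standard_polish S) mu.
by rewrite /pr -(h i I A mA).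
Qed.

Lemma pr_prod2 (mu : law1) A B : measurable A -> measurable B ->
  pr (prod2 mu) (pair_event fst2 snd2 A B) = pr mu A * pr mu B.
Proof. exact: (@pr_iid_pair mu (nth_idx 0) (nth_idx 1)). Qed.

End pairs.

Section nvariate_iterates.
Context d (Omega : measurableType d) (R : realType) (r : probability Omega R).
Context (S : polishType R) (g : random_map Omega S) (mu : probability (borel S) R).
Hypothesis mu_fix : Tmap r g mu =m mu.

Local Notation nmap n := (Tmap r (nvariate n g)).

Definition joint t (A B : set (borel S)) : R :=
  pr (iter t (nmap two) (prod2 mu)) (pair_event fst2 snd2 A B).

Definition marg n (nu : probability (borel (pow n S)) R) :=
  forall (i : idx n) (A : set (borel S)), measurable A -> pr nu [set x : pow n S | A (x i)] = pr mu A.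

Lemma has_marginalsP n (nu : probability (borel (pow n S)) R) :
  has_marginals mu nu <-> marg nu.
Proof.
split=> H i A mA; first by rewrite /pr H.
by rewrite !prE ?H//; exact: measurable_coord.
Qed.

Lemma iter_marg n (nu : probability (borel (pow n S)) R) t :
  marg nu -> marg (iter t (nmap n) nu).
Proof.
move=> H i A mA.
have := @iter_nvariate_proj _ _ _ r _ g n i t nu mu.
move=> /(_ (fun B mB => esym (H i B mB)) A mA); move=> <-.
by move: A mA; apply/eq_lawP; exact: (iter_Tmap_fix (standard_polish S)).
Qed.

(** Selecting two coordinates commutes with the n-variate maps, so the law of a pair after t steps
    depends only on its initial law. *)
Lemma iter_pair n (j k : idx n) nu nu2 t :
  (forall A B, measurable A -> measurable B ->
    pr nu (pair_event j k A B) = pr nu2 (pair_event fst2 snd2 A B)) ->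
  forall A B, measurable A -> measurable B ->
    pr (iter t (nmap n) nu) (pair_event j k A B) =
    pr (iter t (nmap two) nu2) (pair_event fst2 snd2 A B).
Proof.
move=> H A B mA mB.
have := iter_nvariate_image r g t (pair_image H).
by move=> /(_ _ (measurable_pair_event fst2 snd2 mA mB)) ->.
Qed.

Lemma iter_pair_prod n (j k : idx n) nu t :
  (forall A B, measurable A -> measurable B ->
    pr nu (pair_event j k A B) = pr mu A * pr mu B) ->
  forall A B, measurable A -> measurable B ->
    pr (iter t (nmap n) nu) (pair_event j k A B) = joint t A B.
Proof. by move=> H; apply: iter_pair => A B mA mB; rewrite pr_prod2// H. Qed.

Lemma prod2_marg : marg (prod2 mu).
Proof.
by move=> i A mA; rewrite -(@pr_iid_coord _ _ mu (nth_idx (val i)) A mA).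
Qed.

Lemma joint_marg t : marg (iter t (nmap two) (prod2 mu)).
Proof. exact: iter_marg prod2_marg. Qed.

Lemma joint_bimeasure t : bimeasure mu (joint t).
Proof.
apply: (@coupling_bimeasure _ (borel S) R mu _ _ (iter t (nmap two) (prod2 mu))
  (fun x => x fst2) (fun x => x snd2)).
- exact: measurable_proj.
- exact: measurable_proj.
- by move=> A mA; exact: joint_marg.
- by move=> A mA; exact: joint_marg.
Qed.

Lemma jointC t A B : measurable A -> measurable B -> joint t A B = joint t B A.
Proof.
move=> mA mB; rewrite -(@iter_pair_prod two snd2 fst2 (prod2 mu))//.
  by congr pr; apply/seteqP; split=> x [].
move=> C D mC mD; rewrite mulrC -pr_prod2//.
by congr pr; apply/seteqP; split=> x [].
Qed.

(* Couple the two coordinates with a third one that is independent of them. *)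
Lemma iter_disagree n (nu : probability (borel (pow n S)) R) (j k : idx n) t A :
  marg nu -> measurable A ->
  pr (iter t (nmap n) nu) (pair_event j k A (~` A)) <= 2 * joint t A (~` A).
Proof.
move=> hnu mA; have mA' := measurableC mA.
pose f (xy : borel (pow n S) * borel S) : pow (Some 3%N) S := fun i =>
  match val i with 0%N => xy.1 j | 1%N => xy.1 k | _ => xy.2 end.
have mf : measurable_fun setT (f : _ -> borel (pow (Some 3%N) S)).
  apply: measurable_pow => -[[|[|i]] h]; rewrite /f/=.
  - exact: (measurableT_comp (@measurable_proj S n j) measurable_fst).
  - exact: (measurableT_comp (@measurable_proj S n k) measurable_fst).
  - exact: measurable_snd.
pose nu3 := law (nu \x mu)%E mf.
pose i0 : idx (Some 3%N) := exist _ 0%N isT.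
pose i1 : idx (Some 3%N) := exist _ 1%N isT.
pose i2 : idx (Some 3%N) := exist _ 2%N isT.
pose nu2 := law nu (measurable_reindex (select j k)).
have E : pr (iter t (nmap n) nu) (pair_event j k A (~` A)) =
         pr (iter t (nmap _) nu3) (pair_event i0 i1 A (~` A)).
  rewrite (@iter_pair n j k nu nu2)// (@iter_pair _ i0 i1 nu3 nu2)//.
  move=> B C mB mC; have := pr_setX nu mu (measurable_pair_event j k mB mC) measurableT.
  rewrite pr_setT mulr1 /nu2 /nu3 !pr_law => <-.
  by congr pr; apply/seteqP; split=> -[x y] /= h; [split|case: h].
rewrite E; have mpe := fun j k => measurable_pair_event j k mA mA'.
have h02 : pr (iter t (nmap _) nu3) (pair_event i0 i2 A (~` A)) = joint t A (~` A).
  apply: iter_pair_prod => // B C mB mC.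
  by rewrite -(hnu j B mB) -pr_setX//; exact: measurable_coord.
have h21 : pr (iter t (nmap _) nu3) (pair_event i2 i1 A (~` A)) = joint t A (~` A).
  apply: iter_pair_prod => // B C mB mC.
  rewrite mulrC -(hnu k C mC) -pr_setX//; last exact: measurable_coord.
  by rewrite /nu3 pr_law; congr pr; apply/seteqP; split=> -[x y] /= [].
rewrite mulr_natl mulr2n -{1}h02 -h21.
apply: le_trans (pr_setU_le _ (mpe _ i0 i2) (mpe _ i2 i1)).
apply: pr_le; [exact: mpe|by apply: measurableU; exact: mpe|].
(* On whichever side of [A] the third coordinate lies, it disagrees with one of the other two. *)
move=> x [xA xnA]; have [x2|x2] := pselect (A (x i2)); first by right.
by left.
Qed.

End nvariate_iterates.

(** * Monotonicity and coalescence *)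

Section monotone.
Context d (Omega : measurableType d) (R : realType) (r : probability Omega R).
Context (S : polishType R) (g : random_map Omega S) (mu : probability (borel S) R).
Hypothesis mu_fix : Tmap r g mu =m mu.

Local Notation nmap n := (Tmap r (nvariate n g)).
Local Notation joint := (joint r g mu).

(* The averages of the indicators of A over n coordinates that share the
   random maps of the first t steps, respectively t + 1 steps, have an L2
   distance whose square tends to joint t.+1 A A - joint t A A. *)
Lemma joint_nondecreasing t A : measurable A -> joint t A A <= joint t.+1 A A.
Proof.
move=> mA; pose k0 := iid_law mu; pose k1 := nmap None k0.
(* Even positions carry a sample of [k0], odd positions an independent sample of [k1], which is [k0]
   after one step of the maps. Position b + 2 i holds the i-th entry of kind b. *)
pose f (xy : borel (pow None S) * borel (pow None S)) : pow None S := fun m =>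
  if odd (val m) then xy.2 (nth_idx (val m)./2) else xy.1 (nth_idx (val m)./2).
have mf : measurable_fun setT (f : (borel (pow None S) * borel (pow None S))%type -> borel (pow None S)).
  apply: measurable_pow => m; rewrite /f; case: (odd _).
    exact: (measurableT_comp (@measurable_proj S None _) measurable_snd).
  exact: (measurableT_comp (@measurable_proj S None _) measurable_fst).
pose nu0 := law (k0 \x k1)%E mf.
have marg0 : marg mu k0 by move=> i B mB; exact: pr_iid_coord.
have marg1 : marg mu k1 by apply: (@iter_marg _ _ _ r _ g mu mu_fix None k0 1).
have fE (i : nat) (b : bool) xy :
    f xy (nth_idx (b + i.*2)) = if b then xy.2 (nth_idx i) else xy.1 (nth_idx i).
  by rewrite /f /= half_bit_double oddD odd_double addbF oddb.
have nuE (i j : nat) (b c : bool) B C : measurable B -> measurable C ->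
    pr nu0 (pair_event (nth_idx (b + i.*2)) (nth_idx (c + j.*2)) B C) =
    match b, c with
    | true, true => pr k1 (pair_event (nth_idx i) (nth_idx j) B C)
    | false, false => pr k0 (pair_event (nth_idx i) (nth_idx j) B C)
    | _, _ => pr mu B * pr mu C
    end.
  move=> mB mC; rewrite /nu0 pr_law.
  have -> : f @^-1` pair_event (nth_idx (b + i.*2)) (nth_idx (c + j.*2)) B C =
      [set xy | B (if b then xy.2 (nth_idx i) else xy.1 (nth_idx i)) /\
                C (if c then xy.2 (nth_idx j) else xy.1 (nth_idx j))].
    by apply/seteqP; split=> xy; rewrite /pair_event /= !fE.
  have mp := measurable_pair_event (nth_idx i) (nth_idx j) mB mC.
  case: b c => -[].
  - transitivity (pr (k0 \x k1)%E (setT `*` pair_event (nth_idx i) (nth_idx j) B C)).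
      by congr pr; apply/seteqP; split=> [[x y]|[x y] []].
    by rewrite pr_setX// pr_setT mul1r.
  - transitivity (pr (k0 \x k1)%E ([set x : pow None S | C (x (nth_idx j))] `*`
        [set x : pow None S | B (x (nth_idx i))])).
      by congr pr; apply/seteqP; split=> -[x y] /= [].
    rewrite pr_setX; [|exact: measurable_coord..].
    by rewrite marg0// marg1// mulrC.
  - transitivity (pr (k0 \x k1)%E ([set x : pow None S | B (x (nth_idx i))] `*`
        [set x : pow None S | C (x (nth_idx j))])); first by [].
    rewrite pr_setX; [|exact: measurable_coord..].
    by rewrite marg0// marg1.
  - transitivity (pr (k0 \x k1)%E (pair_event (nth_idx i) (nth_idx j) B C `*` setT)).
      by congr pr; apply/seteqP; split=> [[x y]|[x y] []].
    by rewrite pr_setX// pr_setT mulr1.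
have k1E (i j : nat) B C : i != j -> measurable B -> measurable C ->
    pr k1 (pair_event (nth_idx i) (nth_idx j) B C) =
    pr (nmap two (prod2 mu)) (pair_event fst2 snd2 B C).
  move=> ij mB mC.
  apply: (@iter_pair _ _ _ r _ g None (nth_idx i) (nth_idx j) k0 (prod2 mu) 1) => //.
  by move=> B' C' mB' mC'; rewrite pr_prod2// pr_iid_pair//.
pose E (p : nat * bool) : set (borel (pow None S)) :=
  [set z : pow None S | A (z (nth_idx (p.2 + p.1.*2)))].
pose nut := iter t (nmap None) nu0.
have diagE p : pr nut (E p `&` E p) = pr mu A.
  rewrite setIid /nut; apply: (iter_marg mu_fix) => // m B mB.
  have -> : m = nth_idx (odd (val m) + (val m)./2.*2).
    by apply: val_inj; rewrite /= odd_double_half.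
  have := nuE (val m)./2 (val m)./2 (odd (val m)) (odd (val m)) B setT mB measurableT.
  have pT n (P : probability (borel (pow n S)) R) (i : idx n) :
      pr P (pair_event i i B setT) = pr P [set x : pow n S | B (x i)].
    by congr pr; apply/seteqP; split=> [x []|x].
  by rewrite pT => ->; case: (odd _); rewrite pT ?marg0 ?marg1.
pose a := joint t A A; pose a' := joint t.+1 A A.
(* Two distinct entries from [k1] have already shared one step and reach [joint t.+1]; every other
   pair starts independent and reaches [joint t]. *)
have nutE (i j : nat) (b c : bool) : (b == c) ==> (i != j) ->
    pr nut (E (i, b) `&` E (j, c)) = if b && c then a' else a.
  move=> h; rewrite (_ : E _ `&` E _ =
    pair_event (nth_idx (b + i.*2)) (nth_idx (c + j.*2)) A A)//.
  have := nuE i j b c; case: b c h => -[] /= ij H.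
  - rewrite /a' /joint iterSr; apply: iter_pair => // B C mB mC.
    by rewrite H// k1E.
  - exact: iter_pair_prod.
  - exact: iter_pair_prod.
  - apply: iter_pair_prod => // B C mB mC; rewrite H//; exact: pr_iid_pair.
rewrite leNgt; apply/negP => lt.
(* With signs + and - for the two kinds, each pair of distinct indices contributes a - 2 a + a' = Y
   and each single index contributes X. The second moment over n + 1 indices is then quadratic in n
   + 1 with leading coefficient Y, which therefore cannot be negative. *)
pose Y := a' - a; pose X := 2 * pr mu A - 2 * a.
have Y0 : 0 < - Y by rewrite oppr_gt0 subr_lt0.
have key (n : nat) : 0 <= (n.+1%:R : R) * (n.+1%:R * Y + (X - Y)).
  have := @sum_pr_setI_ge0 _ _ _ nut _
    (fun p : 'I_n.+1 * bool => E (nat_of_ord p.1, p.2))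
    (fun p => if p.2 then -1 else 1).
  have mE p : measurable (E p) by exact: measurable_coord.
  move=> /(_ (fun p => mE _)); congr (0 <= _).
  rewrite -(pair_bigA _ (fun i b => \sum_q (if b then -1 else 1) * (if q.2 then -1 else 1) *
    pr nut (E (nat_of_ord i, b) `&` E (nat_of_ord q.1, q.2))))/=.
  under eq_bigr => i _ do rewrite big_bool /= -!(pair_bigA _ (fun j c => _ * (if c then -1 else 1) *
    pr nut (E (nat_of_ord i, _) `&` E (nat_of_ord j, c))))/= -big_split/=.
  rewrite (eq_bigr (fun=> n.+1%:R * Y + (X - Y))) => [|i _].
    by rewrite sumr_const card_ord [RHS]mulr_natl.
  rewrite (eq_bigr (fun i0 : 'I_n.+1 => Y + if i0 == i then X - Y else 0)).
    rewrite big_split/= sumr_const card_ord -big_mkcond/=.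
    by rewrite big_pred1_eq mulr_natl.
  move=> j _; rewrite !big_bool /= !(nutE _ _ true false)// !(nutE _ _ false true)//.
  have [->|ij] := eqVneq j i; first by rewrite !diagE /X /Y /=; ring.
  by rewrite !nutE /= 1?eq_sym// /Y; ring.
have [n nY] : exists n : nat, X - Y < n%:R * (- Y).
  exists (Num.bound `|(X - Y) / - Y|); rewrite -ltr_pdivrMr//.
  exact: le_lt_trans (ler_norm _) (archi_boundP (normr_ge0 _)).
have := key n; rewrite pmulr_rge0 ?ltr0n// -natr1 mulrDl mul1r.
by move: nY; rewrite mulrN; lra.
Qed.

End monotone.

(** * Limits of joint laws as fixed points *)

Section bimeasure_law.
Context (R : realType) (S : polishType R) (mu : probability (borel S) R).

(** Additivity in each argument makes the values on patterns a content, and the two marginals are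
    the true law [mu], which is what [realize_family] asks for. [bimeasure_eq] extends the identity
    from patterns to all pairs of Borel sets. *)
Lemma bimeasure_law (beta : set (borel S) -> set (borel S) -> R) :
  bimeasure mu beta ->
  exists nu : probability (borel (pow two S)) R,
    forall A B, measurable A -> measurable B ->
      pr nu (pair_event fst2 snd2 A B) = beta A B.
Proof.
move=> hb; pose K := (bool * (nat * nat))%type.
have mb l : measurable (pat (@base R S) l : set (borel S)).
  by apply: measurable_pat; exact: measurable_base.
pose p (l : seq (K * bool)) :=
  beta (pat (@base R S) (lits_at true l)) (pat (@base R S) (lits_at false l)).
have patE k l : pat (@base R S) l `&` base k = pat (@base R S) ((k, true) :: l) :> set S.
  by rewrite pat_cons setIC.
have patC k l : pat (@base R S) l `\` base k = pat (@base R S) ((k, false) :: l) :> set S.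
  by rewrite pat_cons setIC.
have cp : lit_content p.
  split.
  - by rewrite /p /= pat_nil (bimeasure_l hb)// pr_setT.
  - by move=> l; exact: (bimeasure_ge0 hb).
  - move=> [[] k] l; rewrite /p /lits_at/= -/(lits_at true l) -/(lits_at false l).
      by rewrite (bimeasure_splitl hb _ (measurable_base k))// patE patC.
    by rewrite (bimeasure_splitr hb _ (measurable_base k))// patE patC.
  - move=> l l' ll; congr (beta _ _); apply: eq_pat => -[k b];
      by rewrite !mem_lits_at.
have lift c l : lits_at c [seq ((c, x.1), x.2) | x <- l] = l :> seq ((nat * nat) * bool).
  by rewrite /lits_at; elim: l => //= -[k b] l IH; rewrite eqxx/= IH.
have lift' c c' l : c' != c -> lits_at c [seq ((c', x.1), x.2) | x <- l] = [::] :> seq ((nat * nat) * bool).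
  by rewrite /lits_at => /negbTE cc; elim: l => //= -[k b] l IH; rewrite cc.
have [|Y [mY lY pY]] := @realize_family R _ (fun=> S) (fun=> mu) _ cp.
  move=> c l; rewrite /p; case: c; rewrite lift lift'// pat_nil.
    exact: (bimeasure_l hb).
  exact: (bimeasure_r hb).
pose W := measurableTypeR R.
pose Z (u : W) : pow two S := fun i => Y (val i == 0%N) u.
have mZ : measurable_fun setT (Z : W -> borel (pow two S)).
  by apply: measurable_pow => i; exact: mY.
exists (law (@unif01 R) mZ).
have nuE l l' : pr (law (@unif01 R) mZ) (pair_event fst2 snd2 (pat (@base R S) l) (pat (@base R S) l')) =
    beta (pat (@base R S) l) (pat (@base R S) l').
  pose L := [seq ((true, x.1), x.2) | x <- l] ++ [seq ((false, x.1), x.2) | x <- l'].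
  have lT : lits_at true L = l.
    by rewrite /lits_at filter_cat map_cat -/(lits_at _ _) -/(lits_at _ _) lift lift'// cats0.
  have lF : lits_at false L = l'.
    by rewrite /lits_at filter_cat map_cat -/(lits_at _ _) -/(lits_at _ _) lift lift'.
  transitivity (p L); last by rewrite /p lT lF.
  rewrite -pY pr_law pat_cat (pat_map _ (fun m => (true, m))).
  by rewrite (pat_map _ (fun m => (false, m))).
have gen : @measurable _ (borel S) `<=` <<s range (pat (@base R S)) >>.
  apply: borel_base => k; apply: sub_sigma_algebra.
  by exists [:: (k, true)] => //; rewrite pat_cons pat_nil setIT.
apply: (bimeasure_eq _ gen _ _ hb).
- by move=> _ [l _ <-]; exact: mb.
- by move=> _ _ [l _ <-] [l' _ <-]; exists (l ++ l') => //; rewrite pat_cat.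
- apply: (@coupling_bimeasure _ (borel S) R mu _ W (@unif01 R) (Y true) (Y false)) => // A mA;
    exact: (lY _ A mA).
- by move=> _ _ [l _ <-] [l' _ <-]; exact: nuE.
Qed.

End bimeasure_law.

Section limit.
Context d (Omega : measurableType d) (R : realType) (r : probability Omega R).
Context (S : polishType R) (g : random_map Omega S) (mu : probability (borel S) R).

Local Notation nmap n := (Tmap r (nvariate n g)).

Lemma cvg_prodr (I : Type) (s : seq I) (u : nat -> I -> R) (v : I -> R) :
  (forall i, u t i @[t --> \oo] --> v i) ->
  \prod_(i <- s) u t i @[t --> \oo] --> \prod_(i <- s) v i.
Proof.
move=> uv; elim: s => [|i s IH].
  by under eq_fun do rewrite big_nil; rewrite big_nil; exact: cvg_cst.
by under eq_fun do rewrite big_cons; rewrite big_cons; exact: cvgM.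
Qed.

(* Both sides are bimeasures in (A, B), with the same marginals for all t, when
   they are read on Omega * S^oo before the random map is applied. *)
Lemma Tmap_pair_cvg (nu : nat -> probability (borel (pow two S)) R) nu' :
  (forall t, marg mu (nu t)) -> marg mu nu' ->
  (forall A B, measurable A -> measurable B ->
    pr (nu t) (pair_event fst2 snd2 A B) @[t --> \oo] -->
    pr nu' (pair_event fst2 snd2 A B)) ->
  forall A B, measurable A -> measurable B ->
    pr (nmap two (nu t)) (pair_event fst2 snd2 A B) @[t --> \oo] -->
    pr (nmap two nu') (pair_event fst2 snd2 A B).
Proof.
move=> nu_marg nu'_marg nuc A B mA mB.
have sS := standard_polish S; have s2 := standard_polish_pow S two.
pose T := (Omega * borel (pow None S))%type.
pose m := (r \x iid_law mu)%E.
pose W := (Omega * borel (pow None (pow two S)))%type.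
pose f (c : idx two) (wz : W) : T := (wz.1, fun i => wz.2 i c).
have mf c : measurable_fun setT (f c).
  apply/measurable_fun_pairP; split; first exact: measurable_fst.
  apply: measurable_pow => i.
  exact: (measurableT_comp (@measurable_proj S two c)
    (measurableT_comp (@measurable_proj (pow two S) None i) measurable_snd)).
pose Q (n : probability (borel (pow two S)) R) := (r \x iid_law n)%E.
(* A rectangle involves finitely many coordinates, so its probability is a finite product of pair
   probabilities under [n], each of which converges. *)
have crossE n C s D C' s' D' : measurable C -> measurable C' ->
    (forall i, measurable (D i)) -> (forall i, measurable (D' i)) ->
    pr (Q n) (f fst2 @^-1` (C `*` cyl s D) `&` f snd2 @^-1` (C' `*` cyl s' D')) =
    pr r (C `&` C') * \prod_(i <- undup (s ++ s'))
      pr n (pair_event fst2 snd2 (if i \in s then D i else setT)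
                                 (if i \in s' then D' i else setT)).
  move=> mC mC' mD mD'.
  pose E (i : idx None) : set (borel (pow two S)) :=
     pair_event fst2 snd2 (if i \in s then D i else setT)
                          (if i \in s' then D' i else setT).
  have mE i : measurable (E i) by apply: measurable_pair_event; case: ifP.
  rewrite -(pr_iid_law_cyl s2 n (undup_uniq _) mE) -pr_setX//; last 2 first.
  - exact: measurableI.
  - exact: measurable_cyl.
  congr pr; apply/seteqP; split=> -[w z] /=.
    move=> [[Cw h] [C'w h']]; split=> //= i; rewrite /E /pair_event => _ /=.
    by split; case: ifP => //; [exact: h|exact: h'].
  move=> [[Cw C'w] h]; split; split=> //= i i_s.
    by have [] := h i; rewrite ?mem_undup ?mem_cat ?i_s.
  by have [] := h i; rewrite ?mem_undup ?mem_cat ?i_s ?orbT.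
have lawf n c : marg mu n -> forall C, measurable C ->
    pr (Q n) (f c @^-1` C) = pr m C.
  move=> hn; suff /eq_lawP H : law (Q n) (mf c) =m m by exact: H.
  apply: (pair_pow_unique sS) => C s D mC us mD; rewrite pr_law.
  rewrite pr_setX//; last exact: measurable_cyl.
  rewrite (pr_iid_law_cyl sS)//.
  pose E (i : idx None) : set (borel (pow two S)) := [set x : pow two S | D i (x c)].
  have mE i : measurable (E i) by exact: measurable_coord.
  transitivity (pr r C * \prod_(i <- s) pr n (E i)).
    rewrite -(pr_iid_law_cyl s2 n us mE) -pr_setX//; exact: measurable_cyl.
  by congr (_ * _); apply: eq_bigr => i _; exact: hn.
have hb n : marg mu n -> bimeasure m (fun C D =>
    pr (Q n) (f fst2 @^-1` C `&` f snd2 @^-1` D)).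
  by move=> hn; apply: coupling_bimeasure => // C mC; exact: lawf.
have E n : pr (nmap two n) (pair_event fst2 snd2 A B) =
    pr (Q n) (f fst2 @^-1` (rapply g @^-1` A) `&` f snd2 @^-1` (rapply g @^-1` B)).
  by rewrite pr_Tmap.
under eq_fun do rewrite E; rewrite E.
apply: (bimeasure_cvg (m := m) (G := @rects S _ Omega None)
  (beta := fun t C D => pr (Q (nu t)) (f fst2 @^-1` C `&` f snd2 @^-1` D))
  (b := fun C D => pr (Q nu') (f fst2 @^-1` C `&` f snd2 @^-1` D))).
- exact: rects_measurable.
- exact: (rects_generate sS).
- exact: rects_setI.
- by move=> t; exact: hb.
- exact: hb.
- move=> _ _ [C [s [D [mC us mD ->]]]] [C' [s' [D' [mC' us' mD' ->]]]].
  under eq_fun do rewrite crossE//; rewrite crossE//.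
  apply: cvgMr; apply: cvg_prodr => i; apply: nuc; by case: ifP.
- exact: (measurable_pre (@measurable_rapply _ _ _ _)).
- exact: (measurable_pre (@measurable_rapply _ _ _ _)).
Qed.

End limit.

Section coalescence.
Context d (Omega : measurableType d) (R : realType) (r : probability Omega R).
Context (S : polishType R) (g : random_map Omega S) (mu : probability (borel S) R).
Hypothesis mu_fix : Tmap r g mu =m mu.

Local Notation nmap n := (Tmap r (nvariate n g)).
Local Notation joint := (joint r g mu).

Definition coalescent := forall A : set (borel S), measurable A ->
  joint t A (~` A) @[t --> \oo] --> 0.

(** Monotonicity settles A = B. For disjoint sets, symmetry allows polarization through the union; a
    general pair splits into the intersection and the two differences. *)
Lemma joint_cvg A B : measurable A -> measurable B -> cvg (joint t A B @[t --> \oo]).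
Proof.
have hb t := joint_bimeasure mu_fix t.
have same C : measurable C -> cvg (joint t C C @[t --> \oo]).
  move=> mC; apply: nondecreasing_is_cvgn.
    apply/nondecreasing_seqP => t; exact: joint_nondecreasing.
  exists 1 => _ [t _ <-].
  have [/(_ C mC)/andP[_ h] _] := bimeasure_dominatedl (hb t) mC.
  by apply: (le_trans h); exact: pr_le1.
have disj C D : measurable C -> measurable D -> C `&` D = set0 ->
    cvg (joint t C D @[t --> \oo]).
  move=> mC mD CD; have mU := measurableU _ _ mC mD.
  have e1 : (C `|` D) `&` C = C by rewrite setUK.
  have e2 : (C `|` D) `\` C = D.
    by rewrite setDUl setDv set0U; apply/setDidPl; rewrite setIC.
  have -> : (fun t => joint t C D) = (fun t =>
      2^-1 * (joint t (C `|` D) (C `|` D) - joint t C C - joint t D D)).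
    apply/funext => t.
    rewrite (bimeasure_splitl (hb t) mU mC mU) e1 e2.
    rewrite (bimeasure_splitr (hb t) mU mC mC) (bimeasure_splitr (hb t) mU mC mD) e1 e2.
    rewrite (jointC r g mu t mD mC); lra.
  apply/cvg_ex; eexists; apply: cvgM; first exact: cvg_cst.
  apply: cvgB; last exact: same.
  by apply: cvgB; exact: same.
move=> mA mB; have mI := measurableI _ _ mA mB.
have mAB := measurableD mA mB; have mBA := measurableD mB mA.
have -> : (fun t => joint t A B) = (fun t =>
    (joint t (A `&` B) (A `&` B) + joint t (A `&` B) (B `\` A)) +
    (joint t (A `\` B) (A `&` B) + joint t (A `\` B) (B `\` A))).
  apply/funext => t; rewrite (bimeasure_splitl (hb t) mA mB mB).
  rewrite (bimeasure_splitr (hb t) mB mA mI) (bimeasure_splitr (hb t) mB mA mAB).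
  by rewrite (setIC B A).
apply/cvg_ex; eexists; apply: cvgD; apply: cvgD.
- exact: same.
- by apply: disj => //; apply/seteqP; split=> x //; rewrite /setI /setD /=; tauto.
- by apply: disj => //; apply/seteqP; split=> x //; rewrite /setI /setD /=; tauto.
- by apply: disj => //; apply/seteqP; split=> x //; rewrite /setI /setD /=; tauto.
Qed.

Lemma marg_pair_l (nu : probability (borel (pow two S)) R) A :
  pr nu (pair_event fst2 snd2 A setT) = pr nu [set x : pow two S | A (x fst2)].
Proof. by congr pr; apply/seteqP; split=> [x []|x]. Qed.

Lemma marg_pair_r (nu : probability (borel (pow two S)) R) A :
  pr nu (pair_event fst2 snd2 setT A) = pr nu [set x : pow two S | A (x snd2)].
Proof. by congr pr; apply/seteqP; split=> [x []|x]. Qed.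

Lemma coalescent_of_unique :
  (forall nu : probability (borel (pow two S)) R,
    has_marginals mu nu -> symmetric_law nu -> nmap two nu =m nu ->
    nu =m diag_law two mu) -> coalescent.
Proof.
move=> uniq.
pose beta A B := lim (joint t A B @[t --> \oo]).
have cb A B : measurable A -> measurable B ->
    joint t A B @[t --> \oo] --> beta A B.
  by move=> mA mB; exact: joint_cvg.
have hb : bimeasure mu beta by exact: (bimeasure_lim (joint_bimeasure mu_fix) cb).
have [nu nuE] := bimeasure_law hb.
have nu_marg : marg mu nu.
  move=> i A mA; have [->|->] := idx2_case i.
    by rewrite -marg_pair_l nuE// (bimeasure_l hb).
  by rewrite -marg_pair_r nuE// (bimeasure_r hb).
have betaC A B : measurable A -> measurable B -> beta A B = beta B A.
  move=> mA mB; rewrite /beta.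
  suff -> : (fun t => joint t A B) = (fun t => joint t B A) by [].
  by apply/funext => t; exact: jointC.
have nu_sym : symmetric_law nu.
  move=> s bs A mA.
  have ms := @measurable_reindex R S _ _ s.
  suff /eq_lawP /(_ A mA) : law nu ms =m nu.
    rewrite pr_law => h; rewrite !prE ?h//.
    exact: (measurable_pre ms mA).
  apply: pow2_unique => B C mB mC; rewrite pr_law.
  have sinj := bij_inj bs.
  (* Injectivity leaves the identity and the swap; the swap is handled by the symmetry of [beta]. *)
  have [e0|e0] := idx2_case (s fst2); have [e1|e1] := idx2_case (s snd2).
  - by have := sinj fst2 snd2; rewrite e0 e1 => /(_ erefl) /(congr1 val).
  - by congr pr; apply/seteqP; split=> x; rewrite /pair_event /= e0 e1.
  - rewrite nuE// betaC// -nuE//; congr pr.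
    by apply/seteqP; split=> x; rewrite /pair_event /= e0 e1 => -[].
  - by have := sinj fst2 snd2; rewrite e0 e1 => /(_ erefl) /(congr1 val).
have nu_fix : nmap two nu =m nu.
  apply: pow2_unique => A B mA mB; rewrite nuE//.
  (* The shifted sequence is the image of the sequence under T^(2), so by continuity its limit is
     both [beta A B] and the value of T^(2) at [nu]. *)
  have h : joint t.+1 A B @[t --> \oo] --> pr (nmap two nu) (pair_event fst2 snd2 A B).
    apply: (@Tmap_pair_cvg _ _ _ r _ g mu (fun t => iter t (nmap two) (prod2 mu))) => //.
      by move=> t; exact: joint_marg.
    by move=> C D mC mD; rewrite nuE//; exact: cb.
  apply: (cvg_unique _ h) => //.
  by have := cb A B mA mB; rewrite -(cvg_shiftS (fun t => joint t A B)).
have nu_diag := uniq nu ((has_marginalsP _ _).2 nu_marg) nu_sym nu_fix.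
move=> A mA; have mA' := measurableC mA.
suff <- : beta A (~` A) = 0 by exact: cb.
move/eq_lawP: nu_diag => nu_diag; rewrite -nuE// nu_diag; last exact: measurable_pair_event.
rewrite (_ : pr (diag_law two mu) _ = pr mu (A `&` ~` A))// setICr.
exact: pr_set0.
Qed.

(** A fixed point equals all its iterates, so the disagreement bound holds for every t and the mass
    of A x ~A is 0. Hence nu(A x B) is the [mu]-measure of the intersection, as for the diagonal
    law. *)
Lemma unique_of_coalescent : coalescent ->
  [/\ has_marginals mu (diag_law two mu),
      symmetric_law (diag_law two mu),
      nmap two (diag_law two mu) =m diag_law two mu
    & forall nu : probability (borel (pow two S)) R,
        has_marginals mu nu -> symmetric_law nu -> nmap two nu =m nu ->
        nu =m diag_law two mu].
Proof.
move=> coal; split=> //.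
- apply/eq_lawP => A mA.
  have := @Tmap_nvariate_diag _ _ _ r _ g two mu (diag_law two mu) (fun _ _ => erefl) A mA.
  move=> ->; transitivity (pr mu ((@diag R S two) @^-1` A)); last by [].
  move/eq_lawP: mu_fix; apply.
  exact: (measurable_pre (@measurable_diag R S two) mA).
- move=> nu /has_marginalsP hnu _ nu_fix.
  have nu0 A : measurable A -> pr nu (pair_event fst2 snd2 A (~` A)) = 0.
    move=> mA; have mP := measurable_pair_event fst2 snd2 mA (measurableC mA).
    apply/eqP; rewrite eq_le pr_ge0 andbT.
    have h : 2 * joint t A (~` A) @[t --> \oo] --> (2 * 0 : R).
      by apply: cvgMr; exact: coal.
    rewrite mulr0 in h; apply: (cvgr_to_ge h); apply: nearW => t.
    have := @iter_disagree _ _ _ r _ g mu two nu fst2 snd2 t A hnu mA.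
    suff -> : pr (iter t (nmap two) nu) (pair_event fst2 snd2 A (~` A)) =
              pr nu (pair_event fst2 snd2 A (~` A)) by [].
    have /eq_lawP H := @iter_Tmap_fix _ _ _ r _ (standard_polish_pow S two) (nvariate two g) t nu nu_fix.
    exact: H.
  have hb : bimeasure mu (fun A B => pr nu (pair_event fst2 snd2 A B)).
    apply: (@coupling_bimeasure _ (borel S) R mu _ _ nu
      (fun x => x fst2) (fun x => x snd2)).
    + exact: measurable_proj.
    + exact: measurable_proj.
    + by move=> A mA; exact: hnu.
    + by move=> A mA; exact: hnu.
  apply: pow2_unique => A B mA mB.
  have mA' := measurableC mA.
  have mAB := measurableD mB mA; have mI := measurableI _ _ mB mA.
  have z : pr nu (pair_event fst2 snd2 A (B `\` A)) = 0.
    apply: pr_sub0 (nu0 A mA); try exact: measurable_pair_event.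
    by move=> x [? []].
  have z' : pr nu (pair_event fst2 snd2 (~` A) (B `&` A)) = 0.
    have /pr_sub0 : pair_event fst2 snd2 (~` A) (B `&` A) `<=`
        pair_event fst2 snd2 (~` A) (~` ~` A).
      by move=> x [? []]; rewrite setCK.
    by apply; [exact: measurable_pair_event|rewrite setCK; exact: measurable_pair_event|exact: nu0].
  rewrite (bimeasure_splitr hb mB mA mA) z addr0.
  have := bimeasure_r hb mI.
  rewrite (bimeasure_splitl hb measurableT mA mI) setTI setTD z' addr0 => ->.
  by rewrite setIC.
Qed.

End coalescence.

(** * Weak convergence *)

Section bounded_integrals.
Context d (T : measurableType d) (R : realType) (P : probability T R).

Lemma continuous_measurable_real (E : ptopologicalType) (f : E -> R) :
  continuous f -> measurable_fun setT (f : borel E -> R).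
Proof.
move=> /continuousP cf; apply: (measurability _ (RGenOpens.measurableE R)) => //.
move=> _ [_ [x [y ->]] <-]; rewrite setTI; apply: open_borel; apply: cf.
exact: interval_open.
Qed.

Lemma bounded_integrable (f : T -> R) M : measurable_fun setT f ->
  (forall x, `|f x| <= M) -> P.-integrable setT (EFin \o f).
Proof.
move=> mf fM; apply: measurable_bounded_integrable => //.
  by apply: (@le_lt_trans _ _ 1%E); [exact: probability_le1|rewrite ltry].
exists M; split; first exact: num_real.
by move=> y My x _; apply: le_trans (fM x) _; exact: ltW.
Qed.

Lemma Rintegral_pr (A : set T) : measurable A -> (\int[P]_x \1_A x)%R = pr P A.
Proof. by move=> mA; rewrite /Rintegral integral_indic// setIT. Qed.

(** The integrands differ by at most e off [B] and by at most 2 M on [B]. *)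
Lemma Rintegral_close (f h : T -> R) M e (B : set T) :
  measurable_fun setT f -> measurable_fun setT h -> measurable B ->
  (forall x, `|f x| <= M) -> (forall x, `|h x| <= M) -> 0 <= e ->
  (forall x, ~ B x -> `|f x - h x| <= e) ->
  `|(\int[P]_x f x)%R - (\int[P]_x h x)%R| <= e + 2 * M * pr P B.
Proof.
move=> mf mh mB fM hM e0 fh.
have M0 : 0 <= M by apply: le_trans (fM point).
have If := bounded_integrable mf fM; have Ih := bounded_integrable mh hM.
have mfh : measurable_fun setT (fun x => f x - h x) by exact: measurable_funB.
have Ifh : P.-integrable setT (EFin \o (fun x => f x - h x)).
  apply: (@bounded_integrable _ (M + M)) => // x.
  by apply: le_trans (ler_normB _ _) _; exact: lerD.
have M20 : 0 <= 2 * M by rewrite mulr_ge0.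
have I01 x : 0 <= (\1_B x : R) <= 1.
  by rewrite indicE; case: (_ \in _); rewrite /= ?lexx ler01.
have mI : measurable_fun setT (fun x => 2 * M * \1_B x : R).
  by apply: measurable_funM.
have II : P.-integrable setT (EFin \o (fun x => 2 * M * \1_B x)).
  apply: (@bounded_integrable _ (2 * M)) => // x.
  have /andP[h1 h2] := I01 x.
  by rewrite ger0_norm; [rewrite ler_piMr|rewrite mulr_ge0].
rewrite -RintegralB//; apply: le_trans (le_normr_Rintegral _ Ifh) _ => //.
have -> : e + 2 * M * pr P B = (\int[P]_x (e + 2 * M * \1_B x))%R.
  rewrite RintegralD//; last first.
    by apply: (@bounded_integrable _ e) => // x; rewrite ger0_norm.
  rewrite Rintegral_cst// RintegralZl//; last first.
    apply: (@bounded_integrable _ 1) => // x.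
    by have /andP[h1 h2] := I01 x; rewrite ger0_norm.
  by rewrite Rintegral_pr// [X in e * X](pr_setT P) mulr1.
apply: le_Rintegral => //.
- apply: (@bounded_integrable _ (M + M)); first exact: measurableT_comp.
  by move=> x; rewrite normr_id; apply: le_trans (ler_normB _ _) _; exact: lerD.
- apply: (@bounded_integrable _ (e + 2 * M)); first exact: measurable_funD.
  move=> x; have /andP[h1 h2] := I01 x; rewrite ger0_norm.
    by rewrite lerD2l ler_piMr.
  by rewrite addr_ge0// mulr_ge0.
- move=> x _; have [Bx|Bx] := pselect (B x).
    rewrite indicE mem_set// mulr1; apply: le_trans (ler_normB _ _) _.
    have := fM x; have := hM x; lra.
  by rewrite indicE memNset// mulr0 addr0; exact: fh.
Qed.

End bounded_integrals.

Lemma weak_cvgP (R : realType) (E : ptopologicalType)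
    (nu : nat -> probability (borel E) R) (nu' : probability (borel E) R) :
  weak_cvg nu nu' <->
  forall f : E -> R, continuous f -> (exists M, forall x, `|f x| <= M) ->
    (\int[nu t]_x f x)%R @[t --> \oo] --> (\int[nu']_x f x)%R.
Proof.
have EI (P : probability (borel E) R) (f : E -> R) : continuous f ->
    (exists M, forall x, `|f x| <= M) ->
    (\int[P]_x (f x)%:E)%E = ((\int[P]_x f x)%R)%:E.
  move=> cf [M fM].
  have I := @bounded_integrable _ (borel E) R P f M (continuous_measurable_real cf) fM.
  by rewrite /Rintegral fineK//; exact: integrable_fin_num I.
split=> H f cf bf; have := H f cf bf.
  rewrite EI// => /fine_cvg; apply: cvg_trans; apply: near_eq_cvg.
  by apply: nearW => t.
move=> h; rewrite EI//; under eq_fun do rewrite EI//.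
by apply: cvg_EFin => //; apply: nearW => t.
Qed.

Lemma cvg0_bigcup d (T : measurableType d) (R : realType)
    (P : nat -> probability T R) (I : choiceType) (s : seq I) (B : I -> set T) :
  (forall i, measurable (B i)) ->
  (forall i, i \in s -> pr (P t) (B i) @[t --> \oo] --> 0) ->
  pr (P t) (\bigcup_(i in [set` s]) B i) @[t --> \oo] --> 0.
Proof.
move=> mB; elim: s => [|i s IH] H.
  rewrite (_ : [set` [::]] = set0) ?bigcup_set0; last by apply/seteqP; split.
  by under eq_fun do rewrite pr_set0; exact: cvg_cst.
have mU : measurable (\bigcup_(i in [set` s]) B i).
  by apply: fin_bigcup_measurable.
have h : pr (P t) (B i) + pr (P t) (\bigcup_(i in [set` s]) B i) @[t --> \oo] --> (0 + 0 : R).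
  apply: cvgD; first by apply: H; rewrite mem_head.
  by apply: IH => j js; apply: H; rewrite inE js orbT.
rewrite addr0 in h; apply: (squeeze_cvgr _ (cvg_cst 0) h); apply: nearW => t.
rewrite pr_ge0/=; apply: le_trans (pr_setU_le _ (mB i) mU).
rewrite !bigcup_seq big_cons; apply: pr_le => //; rewrite -?bigcup_seq;
  exact: measurableU.
Qed.

Section weak_convergence.
Context d (Omega : measurableType d) (R : realType) (r : probability Omega R).
Context (S : polishType R) (g : random_map Omega S) (mu : probability (borel S) R).
Hypothesis mu_fix : Tmap r g mu =m mu.

Local Notation nmap n := (Tmap r (nvariate n g)).
Local Notation joint := (joint r g mu).

Lemma Rintegral_law d1 (T1 : measurableType d1) d2 (T2 : measurableType d2)
    (P : probability T1 R) (X : T1 -> T2) (mX : measurable_fun setT X)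
    (f : T2 -> R) M :
  measurable_fun setT f -> (forall x, `|f x| <= M) ->
  (\int[law P mX]_x f x)%R = (\int[P]_x f (X x))%R.
Proof.
move=> mf fM; rewrite /Rintegral; congr fine.
apply: (@integral_distribution _ _ _ _ _ P (mfun_Sub (mem_set mX)) (EFin \o f)).
  exact/measurable_EFinP.
apply: (@bounded_integrable _ _ _ P (f \o X) M) => [|x]; last exact: fM.
exact: measurableT_comp.
Qed.

Lemma Rintegral_eq_law d1 (T1 : measurableType d1) (P Q : probability T1 R)
    (f : T1 -> R) : P =m Q -> (\int[P]_x f x)%R = (\int[Q]_x f x)%R.
Proof.
by move=> PQ; rewrite /Rintegral; congr fine; apply: eq_measure_integral => A mA _; exact: PQ.
Qed.

(** The function [h], which copies coordinate [j0] to all places, has the target as its integral for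
    every t, so it suffices that f and h are close with high probability. Each diagonal point has a
    ball and finitely many coordinates such that f is within e' of h while [x j0] and these
    coordinates lie in the ball. Finitely many such choices carry all but e' of the mass of [mu],
    and coalescence brings the chosen coordinates into the ball of [x j0]. *)
Lemma weak_cvg_of_coalescent n (nu : probability (borel (pow n S)) R) :
  coalescent r g mu -> n <> Some 0%N -> marg mu nu ->
  weak_cvg (fun t => iter t (nmap n) nu) (diag_law n mu).
Proof.
move=> coal n0 hnu; apply/weak_cvgP => f cf [M fM].
have [j0 _] : exists j0 : idx n, True.
  by case: n n0 {nu hnu f cf fM} => [[//|n] _|_]; exists (exist _ 0%N isT).
have mf := continuous_measurable_real cf.
have M0 : 0 <= M by apply: le_trans (fM (fun=> point)).
pose h (x : pow n S) : R := f (fun _ => x j0).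
have mh : measurable_fun setT (h : borel (pow n S) -> R).
  apply: (measurableT_comp mf).
  exact: (measurableT_comp (@measurable_diag R S n) (@measurable_proj S n j0)).
pose nut t := iter t (nmap n) nu.
have hdiag t : (\int[diag_law n mu]_x f x)%R = (\int[nut t]_x h x)%R.
  transitivity (\int[law mu (@measurable_diag R S n)]_x f x)%R; first by [].
  rewrite (@Rintegral_law _ _ _ (borel (pow n S)) _ _ _ f M mf fM).
  transitivity (\int[law (nut t) (@measurable_proj S n j0)]_x f (@diag R S n x))%R.
    apply: Rintegral_eq_law; apply/eq_lawP => A mA; rewrite pr_law.
    by rewrite (iter_marg mu_fix t hnu j0 mA).
  rewrite (@Rintegral_law _ _ _ (borel S) _ _ _ (fun x => f (@diag R S n x)) M)//.
  exact: (measurableT_comp mf (@measurable_diag R S n)).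
apply/cvgrPdist_le => e e0.
(* The final error is e' off the bad set plus 2 M times the bound 2 e' for its probability. *)
pose e' := e / (1 + 4 * M).
have M1 : 0 < 1 + 4 * M by lra.
have e'0 : 0 < e' by rewrite divr_gt0.
pose good (kJ : (nat * nat) * seq (idx n)) := forall x : pow n S,
  base kJ.1 (x j0) -> (forall j, j \in kJ.2 -> base kJ.1 (x j)) ->
  `|f x - h x| <= e'.
pose V (kJ : (nat * nat) * seq (idx n)) : set S :=
  if `[< good kJ >] then base kJ.1 else set0.
have mV kJ : measurable (V kJ : set (borel S)).
  by rewrite /V; case: ifP => // _; exact: measurable_base.
have Vcover : \bigcup_kJ V kJ = setT.
  apply/seteqP; split=> // s _.
  (* Neighbourhoods of a diagonal point with one common ball for finitely many coordinates already
     form a filter converging to it. *)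
  pose F : set_system (pow n S) := filter_from [set kJ | base kJ.1 s]
    (fun kJ : (nat * nat) * seq (idx n) =>
      [set x : pow n S | forall j, j \in kJ.2 -> base kJ.1 (x j)]).
  have FF : Filter F.
    apply: filter_from_filter.
      have [k [ks _]] := base_nbhs (@filterT _ (nbhs s) _).
      by exists (k, [::]).
    move=> [k1 J1] [k2 J2] /= h1 h2.
    have /base_nbhs[k [ks kk]] : nbhs s (base k1 `&` base k2).
      by apply: filterI; apply: open_nbhs_nbhs; split => //; exact: base_open.
    exists (k, J1 ++ J2) => // x /= H.
    have Hk j : j \in J1 ++ J2 -> (base k1 `&` base k2) (x j) by move=> /H; exact: kk.
    by split=> j jJ; have [] := Hk j _; rewrite // mem_cat jJ ?orbT.
  pose cs : pow n S := fun=> s.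
  have Fs : F --> cs.
    apply: pow_cvg => i A /base_nbhs[k [ks kA]]; exists (k, [:: i]) => //= x.
    by move=> /(_ i (mem_head _ _)) /kA.
  have e2 : 0 < e' / 2 by rewrite divr_gt0.
  have fF : f x @[x --> F] --> f cs := cvg_trans (cvg_app f Fs) (cf cs).
  move: fF => /cvgrPdist_le /(_ _ e2) [[k J] /= ks kJ].
  exists (k, J) => //; rewrite /V; case: asboolP => // -[] x /= xj0 xJ.
  have h1 := kJ x xJ.
  (* The constant sequence at [x j0] lies in the same neighbourhood, which controls [h x]. *)
  have h2 := kJ (fun=> x j0) (fun _ _ => xj0).
  have -> : f x - h x = (f cs - h x) - (f cs - f x).
    by ring.
  apply: le_trans (ler_normB _ _) _; rewrite [leRHS]splitr.
  exact: lerD.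
pose W N : set (borel S) := \bigcup_(i in [set i | (i < N)%N])
  if unpickle i is Some kJ then V kJ else set0.
have mVo i : measurable ((if unpickle i is Some kJ then V kJ else set0) : set (borel S)).
  by case: unpickle.
have mW N : measurable (W N) by apply: bigcup_measurable => i _.
have [N WN] : exists N, pr mu (~` W N) <= e'.
  have ndW : nondecreasing_seq W.
    move=> m N' mn; apply/subsetPset => s [i /= im iV].
    by exists i => //; exact: leq_trans mn.
  have := @pr_cvg_up _ _ _ mu W mW ndW.
  rewrite (_ : \bigcup_N W N = setT) ?pr_setT; last first.
    apply/seteqP; split=> // s _; have : (\bigcup_kJ V kJ) s by rewrite Vcover.
    move=> [kJ _ Vs]; exists (pickle kJ).+1 => //; exists (pickle kJ) => //=.
    by rewrite pickleK.
  move=> /cvgrPdist_le /(_ _ e'0) [N _ /(_ N (leqnn N)) /= HN].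
  by exists N; rewrite pr_setC//; exact: le_trans (ler_norm _) HN.
pose bad (kJ : (nat * nat) * seq (idx n)) : set (borel (pow n S)) :=
  \bigcup_(j in [set` kJ.2]) pair_event j0 j (base kJ.1) (~` base kJ.1).
have mpb k (j : idx n) : measurable (pair_event j0 j (base k) (~` base k)).
  by apply: measurable_pair_event; [|apply: measurableC]; exact: measurable_base.
have mbad kJ : measurable (bad kJ) by apply: fin_bigcup_measurable.
have bad0 kJ : pr (nut t) (bad kJ) @[t --> \oo] --> 0.
  apply: cvg0_bigcup => [j|j _]; first exact: mpb.
  have hb : 2 * joint t (base kJ.1) (~` base kJ.1) @[t --> \oo] --> (2 * 0 : R).
    by apply: cvgM; [exact: cvg_cst|apply: coal; exact: measurable_base].
  rewrite mulr0 in hb; apply: (squeeze_cvgr _ (cvg_cst 0) hb); apply: nearW => t.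
  rewrite pr_ge0/=; apply: iter_disagree => //; exact: measurable_base.
pose badN : set (borel (pow n S)) := \bigcup_(i in [set` iota 0 N])
  if unpickle i is Some kJ then bad kJ else set0.
have mbado i : measurable ((if unpickle i is Some kJ then bad kJ else set0) : set (borel (pow n S))).
  by case: unpickle.
have mbadN : measurable badN by apply: fin_bigcup_measurable.
have badN0 : pr (nut t) badN @[t --> \oo] --> 0.
  apply: cvg0_bigcup => [i|i _]; first exact: mbado.
  case: unpickle => [kJ|]; first exact: bad0.
  by under eq_fun do rewrite pr_set0; exact: cvg_cst.
pose B : set (borel (pow n S)) := [set x : pow n S | (~` W N) (x j0)] `|` badN.
have mW' : measurable ([set x : pow n S | (~` W N) (x j0)] : set (borel (pow n S))).
  by apply: measurable_coord; exact: measurableC.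
have mB : measurable B by exact: measurableU.
have /cvgrPdist_le /(_ _ e'0) := badN0.
apply: filterS => t; rewrite sub0r normrN ger0_norm ?pr_ge0// => tbad.
rewrite (hdiag t) distrC.
have off x : ~ B x -> `|f x - h x| <= e'.
  move=> nB; have [i /= iN iV] : W N (x j0).
    by apply: contrapT => nW; apply: nB; left.
  have nbad : ~ badN x by move=> ?; apply: nB; right.
  case E : (unpickle i : option ((nat * nat) * seq (idx n))) iV => [kJ|//].
  rewrite /V; case: asboolP => // gkJ xk; apply: gkJ => // j jJ.
  apply: contrapT => nxj; apply: nbad; exists i; first by rewrite /= mem_iota.
  by rewrite E; exists j.
have hM x : `|h x| <= M by exact: fM.
apply: le_trans (Rintegral_close (nut t) mf mh mB fM hM (ltW e'0) off) _.
have hB : pr (nut t) B <= e' + e'.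
  apply: le_trans (pr_setU_le _ mW' mbadN) _; apply: lerD => //.
  by rewrite (iter_marg mu_fix t hnu j0 (measurableC (mW N))).
apply: (@le_trans _ _ (e' + 2 * M * (e' + e'))).
  by rewrite lerD2l ler_wpM2l// mulr_ge0.
rewrite (_ : e' + _ = e' * (1 + 4 * M)); last by ring.
by rewrite /e' divfK// gt_eqF.
Qed.

(** The product of one ramp in both coordinates is continuous and at most the indicator of U x U,
    while its integral on the diagonal is at least [pr mu (A m)], which is close to [pr mu U]. So
    [joint t U U] approaches its upper bound [pr mu U], and the difference is the disagreement. *)
Lemma coalescent_base_of_weak :
  weak_cvg (fun t => iter t (nmap two) (prod2 mu)) (diag_law two mu) ->
  forall k, joint t (base k) (~` base k) @[t --> \oo] --> 0.
Proof.
move=> /weak_cvgP wc k; set U : set (borel S) := base k.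
have mU : measurable U by exact: measurable_base.
have [f [cf f01 f0 f1]] := @base_approx R S k.
have mfm m := continuous_measurable_real (cf m).
(* Asking for the value 1 from index m onwards makes these sets increase with m. *)
pose A m : set (borel S) := \bigcap_(i in [set i | (m <= i)%N]) (f i @^-1` [set 1]).
have mA m : measurable (A m).
  apply: bigcap_measurable; first by exists m => /=.
  by move=> i _; exact: (measurable_pre (mfm i)).
have ndA : nondecreasing_seq A.
  by move=> m n mn; apply/subsetPset => y H i /= ni; apply: H; exact: leq_trans ni.
have AU : \bigcup_m A m = U.
  apply/seteqP; split=> [y [m _ Am]|y Uy].
    apply: contrapT => nU; have := Am m (leqnn m); rewrite /= (f0 m y nU).
    by move=> /esym /eqP; rewrite oner_eq0.
  by have [m _ Hm] := f1 y Uy; exists m => // i /= mi; exact: Hm.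
apply/cvgrPdist_le => e e0; have e2 : 0 < e / 2 by rewrite divr_gt0.
have := @pr_cvg_up _ _ _ mu A mA ndA; rewrite AU.
move=> /cvgrPdist_le /(_ _ e2) [m _ /(_ m (leqnn m)) /= Hm].
pose F (x : pow two S) : R := f m (x fst2) * f m (x snd2).
have cF : continuous F.
  move=> x; apply: continuousM.
    exact: (continuous_comp (@pow_proj_continuous _ two fst2 x) (cf m _)).
  exact: (continuous_comp (@pow_proj_continuous _ two snd2 x) (cf m _)).
have F1 x : `|F x| <= 1.
  have /andP[a0 a1] := f01 m (x fst2); have /andP[b0 b1] := f01 m (x snd2).
  by rewrite ger0_norm ?mulr_ge0// mulr_ile1.
have mF := continuous_measurable_real cF.
have := wc F cF (ex_intro _ 1 F1) => /cvgrPdist_le /(_ _ e2).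
apply: filterS => t /= Ht; rewrite sub0r normrN ger0_norm ?pr_ge0//.
have hb := joint_bimeasure mu_fix t.
have E : joint t U (~` U) = pr mu U - joint t U U.
  by rewrite -(bimeasure_l hb mU) (bimeasure_splitr hb measurableT mU mU) setTI setTD; ring.
rewrite E.
have h1 : pr mu (A m) <= (\int[diag_law two mu]_x F x)%R.
  have -> : (\int[diag_law two mu]_x F x)%R =
    (\int[law mu (@measurable_diag R S two)]_x F x)%R by [].
  rewrite (@Rintegral_law _ _ _ (borel (pow two S)) _ _ _ F 1 mF F1) -(Rintegral_pr mu (mA m)).
  apply: le_Rintegral => //.
  - exact: integrable_indic.
  - apply: (@bounded_integrable _ (borel S) R mu _ 1) => [|x]; last exact: F1.
    exact: (measurableT_comp mF (@measurable_diag R S two)).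
  - move=> x _; rewrite indicE; case: (boolP (x \in A m)) => /= [/set_mem Ax|_].
      by have := Ax m (leqnn m); rewrite /F/diag /= => ->; rewrite mulr1.
    have /andP[a0 _] := f01 m x; exact: mulr_ge0.
have mUU := measurable_pair_event fst2 snd2 mU mU.
have h2 : (\int[iter t (nmap two) (prod2 mu)]_x F x)%R <= joint t U U.
  rewrite /joint -(Rintegral_pr _ mUU); apply: le_Rintegral => //.
  - by apply: (@bounded_integrable _ _ R _ _ 1).
  - exact: integrable_indic.
  - move=> x _; have /andP[a0 a1] := f01 m (x fst2); have /andP[b0 b1] := f01 m (x snd2).
    rewrite indicE; case: (boolP (x \in pair_event fst2 snd2 U U)) => /= [_|].
      exact: mulr_ile1.
    move=> /negP nUU; rewrite /F; have [u1|u1] := pselect (U (x fst2)); last first.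
      by rewrite (f0 m _ u1) mul0r.
    have [u2|u2] := pselect (U (x snd2)); last by rewrite (f0 m _ u2) mulr0.
    by case: nUU; rewrite inE.
move: Hm Ht; rewrite !ler_norml => /andP[_ Hm] /andP[_ Ht]; lra.
Qed.

End weak_convergence.

(** * Random maps on trees *)

Section trees.
Context dO (Omega : measurableType dO) (R : realType) (r : probability Omega R).
Variable d : natbar.
Local Notation word := (seq (idx d)).

Section evaluation.
Context (E : ptopologicalType) (g : random_map Omega E).
Hypothesis gd : forall w, le_natbar (arity g w) d.

Definition node (w : Omega) (x : idx d -> E) : E :=
  gam g w (fun j => x (widen_idx (gd w) j)).

(** Padding the children by [point] beyond [d] gives the infinite sequence that [rapply] reads; by
    the bound on the arity the padding is never consulted. *)
Definition extend (x : idx d -> E) : pow None E :=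
  fun m => if insub (val m) is Some j then x j else point.

Lemma nodeE w x : node w x = rapply g (w, extend x).
Proof.
rewrite /node /rapply /=; congr (gam g w _); apply/funext => j.
rewrite /restrict /extend /= (insubT (below d) (below_le (gd w) (valP j))).
by congr (x _); exact: val_inj.
Qed.

Lemma measurable_extend (sE : standard R E) d' (T : measurableType d')
    (x : T -> idx d -> E) :
  (forall j, measurable_fun setT (fun t => x t j : borel E)) ->
  measurable_fun setT ((fun t => extend (x t)) : T -> borel (pow None E)).
Proof.
move=> mx; apply: (standard_pow sE) => m; rewrite /extend.
by case: insub => [j|//]; exact: mx.
Qed.

Lemma measurable_node (sE : standard R E) d' (T : measurableType d')
    (o : T -> Omega) (x : T -> idx d -> E) :
  measurable_fun setT o ->
  (forall j, measurable_fun setT (fun t => x t j : borel E)) ->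
  measurable_fun setT ((fun t => node (o t) (x t)) : T -> borel E).
Proof.
move=> mo mx; under eq_fun do rewrite nodeE.
apply: (measurableT_comp (@measurable_rapply _ Omega E g)).
apply/measurable_fun_pairP; split; first exact: mo.
exact: measurable_extend.
Qed.

(** Here [t] counts levels below [i], so the leaf values sit at depth [size i + t]; maps and values
    are addressed by full words. *)
Fixpoint ev (t : nat) (o : word -> Omega) (z : word -> E) (i : word) : E :=
  if t is t'.+1 then node (o i) (fun j => ev t' o z (rcons i j)) else z i.

Lemma ev_add s t o z i : ev (s + t) o z i = ev s o (ev t o z) i.
Proof.
elim: s i => //= s IH i; congr (node _ _); apply/funext => j; exact: IH.
Qed.

Lemma measurable_ev (sE : standard R E) d' (T : measurableType d') t
    (o : word -> T -> Omega) (z : word -> T -> E) i :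
  (forall k, (size k < t + size i)%N -> measurable_fun setT (o k)) ->
  (forall k, size k = (t + size i)%N -> measurable_fun setT (z k : T -> borel E)) ->
  measurable_fun setT ((fun w => ev t (o^~ w) (z^~ w) i) : T -> borel E).
Proof.
elim: t i => [|t IH] i mo mz /=; first exact: mz.
apply: measurable_node => // [|j].
  by apply: mo; rewrite addSn ltnS leq_addl.
by apply: IH => k; rewrite size_rcons addnS => ?; [apply: mo|apply: mz].
Qed.

Lemma measurable_ev_event (sE : standard R E) d' (T : measurableType d') t
    (o : word -> T -> Omega) (z : word -> T -> E) i (A : set (borel E)) :
  measurable A ->
  (forall k, (size k < t + size i)%N -> measurable_fun setT (o k)) ->
  (forall k, size k = (t + size i)%N -> measurable_fun setT (z k : T -> borel E)) ->
  measurable [set w | A (ev t (o^~ w) (z^~ w) i)].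
Proof. by move=> mA mo mz; exact: (measurable_pre (measurable_ev sE mo mz) mA). Qed.

Definition preimages (W : Type) d' (T : measurableType d') (f : W -> T) : set (set W) :=
  [set f @^-1` A | A in measurable].

Lemma preimages_setI (W : Type) d' (T : measurableType d') (f : W -> T) :
  setI_closed (preimages f).
Proof.
move=> _ _ [A mA <-] [B mB <-]; exists (A `&` B); first exact: measurableI.
by rewrite preimage_setI.
Qed.

Lemma preimages_setT (W : Type) d' (T : measurableType d') (f : W -> T) :
  preimages f setT.
Proof. by exists setT => //; rewrite preimage_setT. Qed.

(* The information used to evaluate a tree cut at depth s: the maps strictly
   above depth s, and the values at depth s. *)
Definition stage_field (W : Type) (o : word -> W -> Omega) (z : word -> W -> E) s (i : word) :
    set (set W) :=
  if (size i < s)%N then preimages (o i)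
  else if size i == s then @preimages _ _ (borel E) (z i) else [set setT].

Lemma stage_field_setI (W : Type) (o : word -> W -> Omega) (z : word -> W -> E) s i :
  setI_closed (stage_field o z s i).
Proof.
rewrite /stage_field; case: ifP => _; first exact: preimages_setI.
case: eqP => _; first exact: preimages_setI.
by move=> _ _ -> ->; rewrite setIT.
Qed.

Lemma stage_field_setT (W : Type) (o : word -> W -> Omega) (z : word -> W -> E) s i :
  stage_field o z s i setT.
Proof.
rewrite /stage_field; case: ifP => _; first exact: preimages_setT.
by case: eqP => _ //; exact: preimages_setT.
Qed.

Context dW (W : measurableType dW) (P : probability W R).

Lemma preimages_measurable d' (T : measurableType d') (f : W -> T) :
  measurable_fun setT f -> preimages f `<=` measurable.
Proof. by move=> mf _ [A mA <-]; exact: (measurable_pre mf mA). Qed.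

(** One finite stage of a tree process, with leaf law [nu] left free: the maps strictly above depth
    [s] and the values at depth [s]. The process itself, artificial leaves and pairs of values are
    all handled through it. *)
Record stage (o : word -> W -> Omega) (z : word -> W -> E)
    (nu : probability (borel E) R) s : Prop := Stage {
  stage_mo : forall i, measurable_fun setT (o i) ;
  stage_mz : forall i, size i = s -> measurable_fun setT (z i : W -> borel E) ;
  stage_lawo : forall i A, (size i < s)%N -> measurable A ->
    pr P (o i @^-1` A) = pr r A ;
  stage_lawz : forall i (A : set (borel E)), size i = s -> measurable A ->
    pr P (z i @^-1` A) = pr nu A ;
  stage_indep : indep_fields P (stage_field o z s) }.

Lemma stage_field_measurable o z nu s i : stage o z nu s ->
  stage_field o z s i `<=` measurable.
Proof.
move=> hs; rewrite /stage_field; case: ifP => _.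
  by apply: preimages_measurable; exact: (stage_mo hs).
case: eqP => [si|_]; last by move=> _ ->.
by apply: preimages_measurable; exact: (stage_mz hs si).
Qed.

Lemma stage_cut_product (sE : standard R E) o z nu s i : stage o z nu s.+1 ->
  size i = s ->
  cut_product r nu [set m | below d m] P (o i)
    (fun w => extend (fun j => z (rcons i j) w)).
Proof.
move=> hs si; have mzj j : measurable_fun setT (z (rcons i j) : W -> borel E).
  by apply: (stage_mz hs); rewrite size_rcons si.
split; [exact: (stage_mo hs)|exact: measurable_extend|].
move=> B l A mB ul lD mA.
have [js e] : exists js : seq (idx d), l = [seq nth_idx (val j) | j <- js].
  elim: l lD {ul} => [|m l IH] lD; first by exists [::].
  have [|js ->] := IH; first by move=> m' m'l; apply: lD; rewrite inE m'l orbT.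
  exists (exist _ (val m) (lD m (mem_head _ _)) :: js) => /=.
  by congr (_ :: _); exact: val_inj.
have ujs : uniq js by move: ul; rewrite e => /map_uniq.
(* A child of [i] is recognized by its last letter, the head of [rev k]. *)
pose A' (k : word) : set W := if k == i then o i @^-1` B
  else if rev k is j :: _ then z k @^-1` (A (nth_idx (val j))) else setT.
have A'i : A' i = o i @^-1` B by rewrite /A' eqxx.
have ri j : (rcons i j == i) = false.
  by apply/eqP => /(congr1 size); rewrite size_rcons => /eqP; rewrite eqn_leq ltnn.
have A'j j : A' (rcons i j) = z (rcons i j) @^-1` (A (nth_idx (val j))).
  by rewrite /A' ri rev_rcons.
have ih : indep_fields P (stage_field o z s.+1) by case: hs.
have := ih (i :: [seq rcons i j | j <- js]) A'.
rewrite big_cons big_map A'i (stage_lawo hs)//; last by rewrite si.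
rewrite (eq_bigr (fun j => pr nu (A (nth_idx (val j))))); last first.
  by move=> j _; rewrite A'j (stage_lawz hs)// size_rcons si.
move=> H; rewrite e big_map -H.
- congr pr; rewrite bigcap_seq_cons A'i; congr (_ `&` _).
  apply/seteqP; split=> w h.
    move=> _ /mapP[j jjs ->]; rewrite A'j; have := h (nth_idx (val j)).
    rewrite /extend /= valK; apply; by apply/mapP; exists j.
  move=> m; move=> /mapP[j jjs ->]; rewrite /extend /= valK.
  by have := h (rcons i j); rewrite A'j; apply; apply/mapP; exists j.
- rewrite /= map_inj_uniq// ?ujs ?andbT; last by move=> j j' /rcons_inj[].
  by apply/mapP => -[j _ /eqP]; rewrite eq_sym ri.
- move=> k; rewrite inE => /orP[/eqP ->|/mapP[j _ ->]].
    by rewrite A'i /stage_field si ltnS leqnn; exists B.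
  rewrite A'j /stage_field size_rcons si ltnn eqxx.
  by exists (A (nth_idx (val j))).
Qed.

(** A word at depth [s] and its children form a block. Blocks are disjoint, so the values computed
    in them are independent, and by the definition of T each has law T(nu). *)
Lemma stage_step (sE : standard R E) o z nu s : stage o z nu s.+1 ->
  stage o (fun i w => node (o i w) (fun j => z (rcons i j) w)) (Tmap r g nu) s.
Proof.
move=> hs; split.
- exact: (stage_mo hs).
- move=> i si; apply: measurable_node => //; first exact: (stage_mo hs).
  by move=> j; apply: (stage_mz hs); rewrite size_rcons si.
- by move=> i A si; apply: (stage_lawo hs); exact: ltnW.
- move=> i A si mA.
  have gD w k : below (arity g w) k -> [set m | below d m] k.
    exact: below_le (gd w).
  rewrite -(pr_Tmap_law sE gD (stage_cut_product sE hs si) mA).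
  by congr pr; apply/seteqP; split=> w /=; rewrite nodeE.
(* Sends a word of depth s + 1 to its parent and fixes all others; its fibres are the blocks. *)
pose h (i : word) : word := if size i == s.+1 then take s i else i.
have hid i : (size i <= s)%N -> h i = i.
  by move=> si; rewrite /h; case: eqP => // e; move: si; rewrite e ltnn.
have hrc i j : size i = s -> h (rcons i j) = i.
  by move=> si; rewrite /h size_rcons si eqxx -cats1 take_size_cat.
have ih : indep_fields P (stage_field o z s.+1) by case: hs.
have := @indep_group _ _ _ P _ _ (stage_field o z s.+1) h.
move=> /(_ (fun i => @stage_field_measurable _ _ _ _ i hs) (fun i => @stage_field_setI _ _ _ _ i)
  (fun i => @stage_field_setT _ _ _ _ i) ih).
apply: indep_fieldsW => i.
set G := \bigcup_(_ in _) _.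
have GF k : h k = i -> stage_field o z s.+1 k `<=` <<s G >>.
  by move=> hk A FA; apply: sub_sigma_algebra; exists k.
have moG : (size i <= s)%N -> measurable_fun setT (o i : g_sigma_algebraType G -> Omega).
  move=> si _ A mA; rewrite setTI; apply: (GF i (hid _ si)).
  by rewrite /stage_field ltnS si; exists A.
rewrite {1}/stage_field; case: ltnP => si.
  by move=> _ [A mA <-]; apply: (measurable_pre (moG (ltnW si)) mA).
case: eqP => [e|_]; last by move=> _ ->; exact: (@measurableT _ (g_sigma_algebraType G)).
have := @measurable_node sE _ (g_sigma_algebraType G) (o i)
  (fun w j => z (rcons i j) w) (moG (eq_leq e)).
move=> mn _ [A mA <-]; apply: (measurable_pre (mn _) mA) => j _ C mC; rewrite setTI.
apply: (GF (rcons i j) (hrc _ _ e)).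
by rewrite /stage_field size_rcons e ltnn eqxx; exists C.
Qed.

Lemma ev_stage (sE : standard R E) t o z nu s : stage o z nu (t + s) ->
  stage o (fun i w => ev t (o^~ w) (z^~ w) i) (iter t (Tmap r g) nu) s.
Proof.
elim: t s => [|t IH] s hs; first by [].
have := IH s.+1; rewrite addnS => /(_ hs) h.
exact: (stage_step sE h).
Qed.

Lemma ev_root_law (sE : standard R E) t o z nu (A : set (borel E)) :
  stage o z nu t -> measurable A ->
  pr P [set w | A (ev t (o^~ w) (z^~ w) [::])] = pr (iter t (Tmap r g) nu) A.
Proof.
move=> hs mA; have := @ev_stage sE t o z nu 0; rewrite addn0 => /(_ hs) h.
by rewrite -(stage_lawz h (i := [::]) _ mA).
Qed.

End evaluation.
End trees.

(** * Product spaces and uniqueness of the law of a stage *)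

Section product_independence.
Context d1 (W : measurableType d1) d2 (Z : measurableType d2) (R : realType).
Variables (P : probability W R) (Q : probability Z R).

Lemma indep_inj (I J : choiceType) (f : I -> J) (F : J -> set (set W)) :
  injective f -> indep_fields P F -> indep_fields P (F \o f).
Proof.
move=> fi iF s A us FA.
pose B k := \bigcap_(i in [set i | i \in s /\ f i = k]) A i.
have BE i : i \in s -> B (f i) = A i.
  move=> i_s; apply/seteqP; split=> [w|w Aw j [_ /fi -> //]].
  by apply; split.
have := iF [seq f i | i <- s] B.
rewrite big_map map_inj_uniq// => /(_ us) H.
rewrite -(eq_big_seq _ (fun i i_s => congr1 (pr P) (BE i i_s))) -H.
  congr pr; apply/seteqP; split=> w h.
    by move=> _ /mapP[i i_s ->]; rewrite BE//; exact: h.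
  by move=> i i_s; rewrite -BE//; apply: h; exact: map_f.
by move=> _ /mapP[i i_s ->]; rewrite BE//; exact: FA.
Qed.

Lemma indep_prod (I J : choiceType) (F : I -> set (set W)) (G : J -> set (set Z)) :
  (forall i, F i `<=` measurable) -> (forall j, G j `<=` measurable) ->
  indep_fields P F -> indep_fields Q G ->
  indep_fields (P \x Q)%E (fun k : I + J => match k with
    | inl i => [set fst @^-1` A | A in F i]
    | inr j => [set snd @^-1` A | A in G j] end).
Proof.
move=> Fm Gm iF iG s A us FA.
have /choice[B HB] (i : I) : exists B : set W, inl i \in s -> F i B /\ fst @^-1` B = A (inl i).
  have [/FA[B FB e]|_] := boolP (inl i \in s); first by exists B.
  by exists setT.
have /choice[C HC] (j : J) : exists C : set Z, inr j \in s -> G j C /\ snd @^-1` C = A (inr j).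
  have [/FA[C GC e]|_] := boolP (inr j \in s); first by exists C.
  by exists setT.
pose s1 := pmap (fun k : I + J => if k is inl i then Some i else None) s.
pose s2 := pmap (fun k : I + J => if k is inr i then Some i else None) s.
have m1 i : (i \in s1) = (inl i \in s).
  rewrite mem_pmap; apply/mapP/idP => [[[j|j] js]|h]; last by exists (inl i).
    by move=> [->].
  by [].
have m2 i : (i \in s2) = (inr i \in s).
  rewrite mem_pmap; apply/mapP/idP => [[[j|j] js]|h]; last by exists (inr i).
    by [].
  by move=> [->].
have u1 : uniq s1.
  by apply: (pmap_uniq (g := inl)) us => -[].
have u2 : uniq s2.
  by apply: (pmap_uniq (g := inr)) us => -[].
have pe : perm_eq s ([seq inl i | i <- s1] ++ [seq inr j | j <- s2]).
  apply: uniq_perm => //.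
    rewrite cat_uniq !map_inj_uniq ?u1 ?u2 ?andbT//; try by move=> ? ? [].
    by apply/hasPn => _ /mapP[j _ ->]; apply/negP => /mapP[].
  move=> [i|j]; rewrite mem_cat.
    rewrite mem_map ?m1; last by move=> ? ? [].
    by rewrite [X in _ || X](_ : _ = false) ?orbF//; apply/negP => /mapP[].
  rewrite [X in X || _](_ : _ = false); last by apply/negP => /mapP[].
  by rewrite mem_map ?m2// => ? ? [].
have mB : measurable (\bigcap_(i in [set` s1]) B i).
  by apply: fin_bigcap_measurable => // i /=; rewrite m1 => /HB[/Fm].
have mC : measurable (\bigcap_(i in [set` s2]) C i).
  by apply: fin_bigcap_measurable => // i /=; rewrite m2 => /HC[/Gm].
have -> : \bigcap_(k in [set` s]) A k =
    (\bigcap_(i in [set` s1]) B i) `*` (\bigcap_(i in [set` s2]) C i).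
  apply/seteqP; split=> -[w z] h.
    split=> i /=; rewrite ?m1 ?m2 => i_s.
      by have [_ e] := HB i i_s; have := h _ i_s; rewrite -e.
    by have [_ e] := HC i i_s; have := h _ i_s; rewrite -e.
  case: h => h1 h2 [i|j] i_s.
    by have [_ <-] := HB i i_s; apply: h1; rewrite /= m1.
  by have [_ <-] := HC j i_s; apply: h2; rewrite /= m2.
rewrite pr_setX// iF//; last by move=> i; rewrite m1 => /HB[].
rewrite iG//; last by move=> i; rewrite m2 => /HC[].
rewrite (perm_big _ pe)/= big_cat !big_map/=; congr (_ * _).
  apply: eq_big_seq => i; rewrite m1 => /HB[/Fm mBi <-].
  by rewrite -[LHS]mulr1 -(pr_setT Q) -pr_setX//; congr pr; apply/seteqP; split=> [[w z] []|[w z]].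
apply: eq_big_seq => i; rewrite m2 => /HC[/Gm mBi <-].
by rewrite -[LHS]mul1r -(pr_setT P) -pr_setX//; congr pr; apply/seteqP; split=> [[w z] []|[w z]].
Qed.

(** If every section had probability at least c, Fubini would give E at least c. The swap is there
    because the product measure integrates over its first factor, while the sections here fix the
    second variable. *)
Lemma exists_section (E : set (W * Z)) (c : R) : measurable E ->
  pr (P \x Q)%E E < c -> exists z, pr P [set w | E (w, z)] < c.
Proof.
move=> mE Ec; apply: contrapT => nz.
have Ez z : c <= pr P [set w | E (w, z)].
  by rewrite leNgt; apply/negP => h; apply: nz; exists z.
pose swap (zw : Z * W) := (zw.2, zw.1).
have ms : measurable_fun setT swap.
  by apply/measurable_fun_pairP; split; [exact: measurable_snd|exact: measurable_fst].
have sE : pr (P \x Q)%E E = pr (Q \x P)%E (swap @^-1` E).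
  have e A B : measurable A -> measurable B ->
      law (Q \x P)%E ms (A `*` B) = (P A * Q B)%E.
    move=> mA mB; transitivity ((Q \x P)%E (B `*` A)).
      by change ((Q \x P)%E (swap @^-1` (A `*` B)) = (Q \x P)%E (B `*` A)); congr ((Q \x P)%E _); apply/seteqP; split=> -[z w] [].
    by rewrite muleC; exact: product_measure1E.
  congr fine; exact: (@product_measure_unique _ _ _ _ _ P Q (law (Q \x P)%E ms)).
have mS := measurable_pre ms mE.
have c0 : 0 <= c by apply: le_trans (pr_ge0 (P \x Q)%E E) (ltW Ec).
move: Ec; apply/negP; rewrite -leNgt sE -lee_fin.
rewrite [leRHS](_ : _ = (Q \x P)%E (swap @^-1` E)); last by rewrite [RHS](prE (Q \x P)%E mS).
have sec z : xsection (swap @^-1` E) z = [set w | E (w, z)] by rewrite xsectionE.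
rewrite (_ : (Q \x P)%E _ = (\int[Q]_z P [set w | E (w, z)])%E); last first.
  by apply: eq_integral => z _; rewrite /= sec.
have -> : c%:E = (\int[Q]_z (cst c%:E) z)%E.
  rewrite integral_cst// [X in (_ * X)%E](_ : _ = 1%E) ?mule1//.
  exact: (probability_setT Q).
apply: ge0_le_integral => //.
  rewrite (_ : (fun z => _) = (fun z => P (xsection (swap @^-1` E) z))).
    exact: measurable_fun_xsection.
  by apply/funext => z; rewrite sec.
move=> z _; rewrite /= -sec prE; last exact: measurable_xsection.
by rewrite sec lee_fin.
Qed.

End product_independence.

Section indep_law.
Context dV (V : measurableType dV) (R : realType) (I : choiceType).
Variables (H : I -> set (set V)) (P Q : probability V R).
Hypothesis Hm : forall i, H i `<=` measurable.
Hypothesis HI : forall i, setI_closed (H i).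
Hypothesis HT : forall i, H i setT.
Hypothesis genH : measurable `<=` <<s \bigcup_i H i >>.

Lemma indep_law_unique : indep_fields P H -> indep_fields Q H ->
  (forall i A, H i A -> pr P A = pr Q A) -> P =m Q.
Proof.
move=> iP iQ PQ.
pose G : set (set V) := [set C | exists s (A : I -> set V),
  [/\ uniq s, forall i, H i (A i) & C = \bigcap_(i in [set` s]) A i]].
apply: (@prob_unique _ V R G).
- apply: subset_trans genH _; apply: sub_sigma_algebra2 => C [i _ HC].
  exists [:: i], (fun j => if j == i then C else setT); split => //.
    by move=> j; case: eqP => [->|_].
  by rewrite bigcap_seq big_seq1 eqxx.
- by move=> _ [s [A [us HA ->]]]; apply: fin_bigcap_measurable => // i _; exact: Hm.
- move=> _ _ [s [A [us HA ->]]] [s' [A' [us' HA' ->]]].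
  exists (undup (s ++ s')), (fun i => (if i \in s then A i else setT) `&`
    (if i \in s' then A' i else setT)); split.
  + exact: undup_uniq.
  + by move=> i; apply: HI; case: ifP.
  + apply/seteqP; split=> [v [h h'] i _|v h].
      by split; case: ifP => // i_s; [exact: h|exact: h'].
    split=> i /= i_s; have := h i; rewrite /= mem_undup mem_cat i_s ?orbT => /(_ isT) [].
      by [].
    by [].
- move=> _ [s [A [us HA ->]]]; rewrite iP// iQ//.
  by apply: eq_bigr => i _; exact: PQ.
Qed.

End indep_law.

Section stage_law.
Context dO (Omega : measurableType dO) (R : realType) (r : probability Omega R).
Variable d : natbar.
Local Notation word := (seq (idx d)).
Context (E : ptopologicalType) (nu : probability (borel E) R).

Definition config : Type := ((word -> Omega) * (word -> E))%type.

Definition above (i : word) (v : config) := v.1 i.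
Definition at_depth (i : word) (v : config) := v.2 i.

Definition stage_gen s : set (set config) :=
  \bigcup_i @stage_field _ Omega d E config above at_depth s i.

(** Configurations with the sigma-field of what stage [s] reveals; realizations on different sample
    spaces are compared by mapping them here. *)
Definition stage_space s := g_sigma_algebraType (stage_gen s).

Lemma measurable_above s i : (size i < s)%N ->
  measurable_fun setT (above i : stage_space s -> Omega).
Proof.
move=> si _ A mA; rewrite setTI; apply: sub_sigma_algebra; exists i => //.
by rewrite /stage_field si; exists A.
Qed.

Lemma measurable_at_depth s i : size i = s ->
  measurable_fun setT (at_depth i : stage_space s -> borel E).
Proof.
move=> si _ A mA; rewrite setTI; apply: sub_sigma_algebra; exists i => //.
by rewrite /stage_field si ltnn eqxx; exists A.
Qed.

Definition collect (W : Type) (o : word -> W -> Omega) (z : word -> W -> E) (w : W) :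
  config := (o^~ w, z^~ w).

Section one_stage.
Context dW (W : measurableType dW) (P : probability W R).
Variables (o : word -> W -> Omega) (z : word -> W -> E) (s : nat).

Lemma collect_stage_field i A : stage_field above at_depth s i A ->
  stage_field o z s i (collect o z @^-1` A).
Proof.
rewrite /stage_field; case: ifP => _; first by move=> [B mB <-]; exists B.
case: eqP => _; first by move=> [B mB <-]; exists B.
by move=> ->; rewrite /= preimage_setT.
Qed.

Hypothesis hs : stage r P o z nu s.

Lemma measurable_collect :
  measurable_fun setT (collect o z : W -> stage_space s).
Proof.
apply: (@measurability _ _ W (stage_space s) setT _ (stage_gen s)) => //.
move=> _ [A [i _ FA] <-]; rewrite setTI.
exact: (stage_field_measurable hs (collect_stage_field FA)).
Qed.

Lemma collect_indep : indep_fields (law P measurable_collect)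
  (@stage_field _ Omega d E config above at_depth s).
Proof.
move=> l A ul FA; rewrite pr_law.
rewrite (_ : _ @^-1` _ = \bigcap_(i in [set` l]) (collect o z @^-1` A i)).
  by apply: (stage_indep hs ul) => i /FA; exact: collect_stage_field.
by rewrite preimage_bigcap.
Qed.

End one_stage.

(** Independence and the one-variable laws determine the joint law, so an event of a stage has the
    same probability in every realization. *)
Lemma stage_unique dW (W : measurableType dW) (P : probability W R)
    dW' (W' : measurableType dW') (P' : probability W' R) o z o' z' s
    (C : set (stage_space s)) :
  stage r P o z nu s -> stage r P' o' z' nu s -> measurable C ->
  pr P (collect o z @^-1` C) = pr P' (collect o' z' @^-1` C).
Proof.
move=> hs hs' mC.
have /eq_lawP H : law P (measurable_collect hs) =m law P' (measurable_collect hs').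
  apply: (@indep_law_unique _ (stage_space s) R _
    (@stage_field _ Omega d E config above at_depth s)).
  - by move=> i A FA; apply: sub_sigma_algebra; exists i.
  - by move=> i; exact: stage_field_setI.
  - by move=> i; exact: stage_field_setT.
  - by [].
  - exact: collect_indep.
  - exact: collect_indep.
  - move=> i A; rewrite /stage_field !pr_law.
    case: ifP => [si|_]; [|case: eqP => [si|_]].
    + by move=> [B mB <-]; rewrite (stage_lawo hs si mB) (stage_lawo hs' si mB).
    + by move=> [B mB <-]; rewrite (stage_lawz hs si mB) (stage_lawz hs' si mB).
    + by move=> ->; rewrite !preimage_setT !pr_setT.
exact: H.
Qed.

End stage_law.

Section leaves.
Context dO (Omega : measurableType dO) (R : realType) (r : probability Omega R).
Variable d : natbar.
Local Notation word := (seq (idx d)).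
Context (S : polishType R) (mu : probability (borel S) R).

Definition leaf (i : word) (z : borel (pow None S)) : S := z (nth_idx (pickle i)).

Lemma measurable_leaf i : measurable_fun setT (leaf i : borel (pow None S) -> borel S).
Proof. exact: measurable_proj. Qed.

Lemma leaf_law i (A : set (borel S)) : measurable A ->
  pr (iid_law mu) (leaf i @^-1` A) = pr mu A.
Proof. exact: (pr_iid_coord mu). Qed.

Lemma leaf_indep :
  indep_fields (iid_law mu) (fun i => @preimages _ _ (borel S) (leaf i)).
Proof.
have [_ /independentP H] := iid_law_iid (standard_polish S) mu.
have inj : injective (fun i : word => nth_idx (pickle i)).
  by move=> i j [] /(pcan_inj pickleK).
have := H (fun i => @measurable_proj S None i).
move=> /(indep_inj inj); apply: indep_fieldsW => i A FA; exact: (conj I FA).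
Qed.

Section leaf_stages.
Context dW (W : measurableType dW) (P : probability W R).
Variables (o : word -> W -> Omega) (s : nat).
Hypothesis mo : forall i, measurable_fun setT (o i).
Hypothesis lawo : forall i A, measurable A -> pr P (o i @^-1` A) = pr r A.
Hypothesis indo : indep_fields P (fun i => preimages (o i)).

Local Notation Wz := (W * borel (pow None S))%type.

Lemma leaf_stage :
  stage r (P \x iid_law mu)%E (fun i (wz : Wz) => o i wz.1)
    (fun i (wz : Wz) => leaf i wz.2) mu s.
Proof.
split.
- by move=> i; apply: (measurableT_comp (mo i)); exact: measurable_fst.
- by move=> i _; apply: (measurableT_comp (measurable_leaf i)); exact: measurable_snd.
- move=> i A _ mA; transitivity (pr (P \x iid_law mu)%E ((o i @^-1` A) `*` setT)).
    by congr pr; apply/seteqP; split=> [[w z]|[w z] []].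
  rewrite pr_setX ?pr_setT ?mulr1 ?lawo//; exact: (measurable_pre (mo i) mA).
- move=> i A _ mA.
  transitivity (pr (P \x iid_law mu)%E (setT `*` (leaf i @^-1` A))).
    by congr pr; apply/seteqP; split=> [[w z]|[w z] []].
  rewrite pr_setX ?pr_setT ?mul1r ?leaf_law//.
  exact: (measurable_pre (measurable_leaf i) mA).
- have := @indep_prod _ _ _ _ _ P (iid_law mu) _ _ _ _
    (fun i => preimages_measurable (mo i))
    (fun i => @preimages_measurable _ _ _ (borel S) _ (measurable_leaf i)) indo leaf_indep.
  (* Each word contributes either its map or its leaf, an injective selection from two independent
     families. *)
  pose f (i : word) : word + word := if (size i < s)%N then inl i else inr i.
  have fi : injective f.
    by move=> i j; rewrite /f; do 2 case: ifP => _; move=> // [].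
  move=> /(indep_inj fi); apply: indep_fieldsW => i A; rewrite /stage_field /f /=.
  case: ifP => _; first by move=> [B mB <-]; exists (o i @^-1` B) => //; exists B.
  case: eqP => _; first by move=> [B mB <-]; exists (leaf i @^-1` B) => //; exists B.
  by move=> ->; exists setT => //; exists setT.
Qed.

End leaf_stages.

Definition pairing (x y : S) : pow two S := fun j => if val j == 0%N then x else y.

Section pair_stages.
Context dW (W : measurableType dW) (P : probability W R).
Variables (o : word -> W -> Omega) (X : word -> W -> S) (s : nat).
Hypothesis hs : stage r P o (X : word -> W -> borel S) mu s.

Local Notation Wz := (W * borel (pow None S))%type.

(** Regrouping by words puts the value at [i] and the fresh leaf at [i] into one block; the two are
    independent, so the pair has law mu x mu. *)
Lemma pair_stage :
  stage r (P \x iid_law mu)%E (fun i (wz : Wz) => o i wz.1)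
    (fun i (wz : Wz) => pairing (X i wz.1) (leaf i wz.2)) (prod2 mu) s.
Proof.
have mX i : size i = s -> measurable_fun setT (X i : W -> borel S).
  exact: (stage_mz hs).
have mpair d' (T : measurableType d') (x y : T -> S) :
    measurable_fun setT (x : T -> borel S) -> measurable_fun setT (y : T -> borel S) ->
    measurable_fun setT (fun t => pairing (x t) (y t) : borel (pow two S)).
  by move=> mx my; apply: measurable_pow => j; rewrite /pairing; case: eqP.
have mz i : size i = s -> measurable_fun setT
    ((fun wz : Wz => pairing (X i wz.1) (leaf i wz.2)) : Wz -> borel (pow two S)).
  move=> si; apply: mpair.
    by apply: (measurableT_comp (mX i si)); exact: measurable_fst.
  by apply: (measurableT_comp (measurable_leaf i)); exact: measurable_snd.
split => //.
- by move=> i; apply: (measurableT_comp (stage_mo hs i)); exact: measurable_fst.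
- move=> i A si mA; transitivity (pr (P \x iid_law mu)%E ((o i @^-1` A) `*` setT)).
    by congr pr; apply/seteqP; split=> [[w z]|[w z] []].
  rewrite pr_setX ?pr_setT ?mulr1 ?(stage_lawo hs si)//.
  exact: (measurable_pre (stage_mo hs i) mA).
- move=> i A si; move: A; apply/(eq_lawP (law (P \x iid_law mu)%E (mz i si)) (prod2 mu)).
  apply: pow2_unique => A B mA mB; rewrite pr_law pr_prod2//.
  transitivity (pr (P \x iid_law mu)%E ((X i @^-1` A) `*` (leaf i @^-1` B))).
    by congr pr; apply/seteqP; split=> [[w z] []|[w z] []].
  rewrite pr_setX ?(stage_lawz hs si) ?leaf_law//.
    exact: (measurable_pre (mX i si) mA).
  exact: (measurable_pre (measurable_leaf i) mB).
- have iF := @indep_prod _ _ _ _ _ P (iid_law mu) _ _ _ _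
    (fun i => @stage_field_measurable _ _ _ r _ _ _ _ _ _ _ _ _ i hs)
    (fun i => @preimages_measurable _ _ _ (borel S) _ (measurable_leaf i))
    (stage_indep hs) leaf_indep.
  set F := (F in indep_fields _ F) in iF.
  pose h (k : word + word) : word := match k with inl i => i | inr i => i end.
  have := @indep_group _ _ _ (P \x iid_law mu)%E _ _ F h.
  have Fm k : F k `<=` measurable.
    case: k => i _ [A FA <-].
      rewrite -[X in measurable X]setTI; apply: measurable_fst => //.
      exact: (stage_field_measurable hs FA).
    rewrite -[X in measurable X]setTI; apply: measurable_snd => //.
    exact: (@preimages_measurable _ _ _ (borel S) _ (measurable_leaf i) _ FA).
  have FI k : setI_closed (F k).
    case: k => i _ _ [A FA <-] [B FB <-]; exists (A `&` B) => //.
      exact: stage_field_setI.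
    exact: preimages_setI.
  have FT k : F k setT.
    case: k => i; exists setT => //; first exact: stage_field_setT.
    exact: (@preimages_setT _ _ (borel S)).
  move=> /(_ Fm FI FT iF); apply: indep_fieldsW => i.
  set G := \bigcup_(_ in _) _.
  have FG k : h k = i -> F k `<=` <<s G >>.
    by move=> hk A FA; apply: sub_sigma_algebra; exists k.
  rewrite {1}/stage_field; case: ltnP => si.
    move=> _ [A mA <-]; apply: (FG (inl i)) => //; exists (o i @^-1` A) => //.
    by rewrite /stage_field si; exists A.
  case: eqP => [e|_]; last by move=> _ ->; exact: (@measurableT _ (g_sigma_algebraType G)).
  have := mpair _ (g_sigma_algebraType G) (fun wz => X i wz.1) (fun wz => leaf i wz.2).
  move=> mp _ [A mA <-]; apply: (measurable_pre (mp _ _) mA) => _ B mB; rewrite setTI.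
    apply: (FG (inl i)) => //; exists (X i @^-1` B) => //.
    by rewrite /stage_field e ltnn eqxx; exists B.
  by apply: (FG (inr i)) => //; exists (leaf i @^-1` B) => //; exists B.
Qed.

Variable g : random_map Omega S.
Hypothesis gd : forall w, le_natbar (arity g w) d.

Lemma ev_nvariate n t (o' : word -> Omega) (z : word -> pow n S) i c :
  ev (g := nvariate n g) gd t o' z i c = ev gd t o' (fun k => z k c) i.
Proof.
elim: t i => //= t IH i; rewrite /node /= /nvariate_gam.
by congr (gam g _ _); apply/funext => j; exact: IH.
Qed.

End pair_stages.

(** Evaluating from the values [X] and from fresh leaves with the same maps is a single evaluation
    of the bivariate maps on pairs with law mu x mu. *)
Lemma pr_disagree (g : random_map Omega S) (gd : forall w, le_natbar (arity g w) d)
    dW (W : measurableType dW) (P : probability W R) o (X : word -> W -> S) t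
    (A B : set (borel S)) :
  stage r P o (X : word -> W -> borel S) mu t -> measurable A -> measurable B ->
  pr (P \x iid_law mu)%E [set wz | A (ev gd t (o^~ wz.1) (X^~ wz.1) [::]) /\
    B (ev gd t (o^~ wz.1) (leaf^~ wz.2) [::])] = joint r g mu t A B.
Proof.
move=> hs mA mB; have mp := measurable_pair_event fst2 snd2 mA mB.
rewrite /joint -(@ev_root_law _ _ _ r _ _ (nvariate two g) gd _ _ _
  (standard_polish_pow S two) _ _ _ _ _ (pair_stage hs) mp).
congr pr; apply/seteqP; split=> wz; rewrite /pair_event /= !ev_nvariate.
  by [].
by [].
Qed.

End leaves.

(** * Endogeny *)

Section approximation.
Context dW (W : measurableType dW) (R : realType) (P : probability W R).

Lemma pr_setY_ae (A B N : set W) : measurable A -> measurable B -> measurable N ->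
  P N = 0%E -> (forall w, ~ N w -> A w <-> B w) -> pr P (A `+` B) = 0.
Proof.
move=> mA mB mN N0 AB; apply: (@pr_sub0 _ _ _ _ _ N) => //.
- exact: measurableY.
- by move=> w AYB; apply: contrapT => /AB[h1 h2]; case: AYB => -[h]; apply; auto.
- by rewrite /pr N0.
Qed.

Lemma pr_setY_triangle (A B C : set W) :
  measurable A -> measurable B -> measurable C ->
  pr P (A `+` C) <= pr P (A `+` B) + pr P (B `+` C).
Proof.
move=> mA mB mC; have mAB := measurableY mA mB; have mBC := measurableY mB mC.
apply: le_trans (pr_setU_le P mAB mBC); apply: pr_le.
- exact: measurableY.
- exact: measurableU.
- move=> w [[h1 h2]|[h1 h2]]; have [Bw|nB] := pselect (B w).
  + by right; left.
  + by left; left.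
  + by left; right.
  + by right; right.
Qed.

Lemma setY_lim_sup (A : set W) (B : (set W)^nat) :
  A `+` lim_sup_set B `<=` lim_sup_set (fun n => A `+` B n).
Proof.
move=> w [[Aw nB]|[Bw nA]] n _; last first.
  by have [m nm Bm] := Bw n I; exists m => //; right.
apply: contrapT => H; apply: nB => p _.
exists (maxn n p); first by rewrite /= leq_maxr.
apply: contrapT => nBm; apply: H; exists (maxn n p); first by rewrite /= leq_maxl.
by left.
Qed.

Lemma lim_sup_null (F : (set W)^nat) : (forall n, measurable (F n)) ->
  (forall n, pr P (F n) <= (2 ^ n.+1)%:R^-1) -> pr P (lim_sup_set F) = 0.
Proof.
move=> mF F2; rewrite /pr lim_sup_set_cvg0//.
apply: (@le_lt_trans _ _ 1%E); last exact: ltry.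
apply: le_trans (epsilon_trick0 xpredT ler01); apply: lee_nneseries => // n _.
by rewrite [X in (X <= _)%E](prE P (mF n)) lee_fin div1r.
Qed.

(** The errors are summable, so by Borel-Cantelli almost every point is classified correctly by all
    but finitely many [B n], hence by their upper limit. *)
Lemma limit_event (A : set W) (B : (set W)^nat) : measurable A ->
  (forall n, measurable (B n)) ->
  (forall n, pr P (A `+` B n) <= (2 ^ n.+1)%:R^-1) ->
  pr P (A `+` lim_sup_set B) = 0.
Proof.
move=> mA mB AB; have mE n := measurableY mA (mB n).
have mls (F : (set W)^nat) : (forall n, measurable (F n)) -> measurable (lim_sup_set F).
  by move=> mF; apply: bigcapT_measurable => n; apply: bigcup_measurable.
apply: (@pr_sub0 _ _ _ _ _ (lim_sup_set (fun n => A `+` B n))).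
- by apply: measurableY => //; exact: mls.
- exact: mls.
- exact: setY_lim_sup.
- exact: lim_sup_null.
Qed.

Variables (F : nat -> set (set W)).
Hypothesis Fm : forall t, F t `<=` measurable.
Hypothesis FS : forall t, sigma_algebra setT (F t).
Hypothesis F_nd : forall t s, (t <= s)%N -> F t `<=` F s.

(** The approximable events form a sigma-field: complements and finite unions keep the property, and
    a countable union is close to a finite one. *)
Lemma approx_sigma A : <<s \bigcup_t F t >> A -> forall e, 0 < e ->
  exists t B, F t B /\ pr P (A `+` B) < e.
Proof.
pose H : set (set W) := [set A | measurable A /\ forall e, 0 < e ->
  exists t B, F t B /\ pr P (A `+` B) < e].
suff : <<s \bigcup_t F t >> `<=` H by move=> h /h[].
have FC t B : F t B -> F t (~` B) by have [_ h _] := FS t; move=> /h; rewrite setTD.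
have FU t B C : F t B -> F t C -> F t (B `|` C).
  have [F0 _ h] := FS t => FB FC'; rewrite -bigcup2E; apply: h => -[|[|n]] //=.
have HU A1 A2 : H A1 -> H A2 -> H (A1 `|` A2).
  move=> [mA1 H1] [mA2 H2]; split=> [|e e0]; first exact: measurableU.
  have e2 : 0 < e / 2 by rewrite divr_gt0.
  have [t1 [B1 [FB1 e1]]] := H1 _ e2; have [t2 [B2 [FB2 e2']]] := H2 _ e2.
  exists (maxn t1 t2), (B1 `|` B2); split.
    by apply: FU; [apply: F_nd FB1|apply: F_nd FB2]; rewrite ?leq_maxl ?leq_maxr.
  have [mB1 mB2] := (Fm FB1, Fm FB2).
  rewrite [ltRHS](splitr e); apply: le_lt_trans (ltrD e1 e2').
  apply: le_trans (pr_setU_le _ _ _); [|exact: measurableY..].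
  apply: pr_le; [|apply: measurableU; exact: measurableY|].
    by apply: measurableY; exact: measurableU.
  move=> w [[[h|h] /not_orP[n1 n2]]|[[h|h] /not_orP[n1 n2]]].
  - by left; left.
  - by right; left.
  - by left; right.
  - by right; right.
apply: smallest_sub => [|A0 [t _ FA]]; last first.
  split=> [|e e0]; first exact: Fm FA.
  by exists t, A0; split => //; rewrite setYK pr_set0.
split.
- split=> // e e0; exists 0%N, set0; have [F0 _ _] := FS 0; split => //.
  by rewrite setYK pr_set0.
- move=> A1 [mA1 H1]; rewrite setTD; split=> [|e e0]; first exact: measurableC.
  have [t [B [FB Be]]] := H1 _ e0; exists t, (~` B); split; first exact: FC.
  rewrite (_ : _ `+` _ = A1 `+` B)//; apply/seteqP; split=> w.
    by move=> [[h h']|[h h']]; [right|left]; split => //; apply: contrapT.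
  by move=> [[h h']|[h h']]; [right|left]; split => //; apply.
move=> U HUn; pose V n := \bigcup_(i < n) U i.
have HV n : H (V n).
  elim: n => [|n IH]; rewrite /V.
    rewrite bigcup_mkord big_ord0; split => // e e0; exists 0%N, set0.
    by have [F0 _ _] := FS 0; split => //; rewrite setYK pr_set0.
  by rewrite bigcup_mkord big_ord_recr -bigcup_mkord /=; apply: HU.
have mUU : measurable (\bigcup_n U n) by apply: bigcup_measurable => n _; case: (HUn n).
split => // e e0; have e2 : 0 < e / 2 by rewrite divr_gt0.
have UV : \bigcup_n V n = \bigcup_n U n.
  apply/seteqP; split=> [w [n _ [i _ h]]|w [n _ h]]; first by exists i.
  by exists n.+1 => //; exists n => //=.
have : pr P (V n) @[n --> \oo] --> pr P (\bigcup_n U n).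
  rewrite -UV; apply: pr_cvg_up => [n|m n mn]; first by case: (HV n).
  by apply/subsetPset => w [i im h]; exists i => //; exact: leq_trans mn.
move=> /cvgrPdist_lt /(_ _ e2)[n _ /(_ n (leqnn n))] /= Vn.
have [mV /(_ _ e2)[t [B [FB Be]]]] := HV n; exists t, B; split => //.
have mB := Fm FB.
have VU : V n `<=` \bigcup_n U n by rewrite -UV => w h; exists n.
have d0 : pr P ((\bigcup_n U n) `\` V n) < e / 2.
  have := pr_split P mUU mV; rewrite (setIidr VU) => E.
  by move: Vn; rewrite E addrAC subrr add0r => /(le_lt_trans (ler_norm _)).
rewrite [ltRHS](splitr e); apply: le_lt_trans (ltrD d0 Be).
apply: le_trans (pr_setU_le _ _ _); [|exact: measurableD|exact: measurableY].
apply: pr_le; [exact: measurableY| |].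
  by apply: measurableU; [exact: measurableD|exact: measurableY].
move=> w [[h nB]|[Bw nU]]; last by right; right; split => // /VU.
by have [Vw|nV] := pselect (V n w); [right; left|left].
Qed.

End approximation.

Section recursive_tree_processes.
Context (R : realType) (S Omega : polishType R).
Variables (r : probability (borel Omega) R) (g : random_map (borel Omega) S).
Variables (d : natbar) (gd : forall w, le_natbar (arity g w) d).
Variable mu : probability (borel S) R.
Local Notation word := (seq (idx d)).

Lemma ev_const t (o : word -> Omega) (x : word -> S) i :
  (forall i, x i = node (g := g) gd (o i) (fun j => x (rcons i j))) ->
  ev gd t o x i = x i.
Proof.
move=> H; elim: t i => //= t IH i; rewrite [RHS]H; congr (node _ _ _).
by apply/funext => j.
Qed.

Section sample_space.
Context dW (W : measurableType dW) (P : probability W R).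

(** Writes an event of the maps as a condition on configurations, the form in which [stage_unique]
    can carry it to another sample space. *)
Lemma sigma_gen_above (om : word -> W -> borel Omega) t B :
  sigma_gen [set i | (size i < t)%N] om B ->
  exists2 B0 : set (word -> borel Omega),
    measurable ((fun v => B0 v.1) : set (stage_space (borel Omega) d S t)) &
    B = [set w | B0 (om^~ w)].
Proof.
pose H : set (set W) := [set B | exists2 B0 : set (word -> borel Omega),
  measurable ((fun v => B0 v.1) : set (stage_space (borel Omega) d S t)) &
  B = [set w | B0 (om^~ w)]].
suff : sigma_gen [set i | (size i < t)%N] om `<=` H by exact.
apply: smallest_sub => [|_ [i /= it [A mA <-]]]; last first.
  exists [set o | A (o i)] => //.
  exact: (measurable_pre (@measurable_above _ (borel Omega) d S t i it) mA).
split.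
- by exists set0 => //; exact: measurable0.
- move=> _ [B0 mB0 ->]; rewrite setTD; exists (~` B0) => //.
  exact: measurableC.
- move=> F /(_ _)/cid2-/all_sig2[B0 mB0 FE].
  exists (\bigcup_n B0 n).
    rewrite (_ : (fun _ => _) = \bigcup_n (fun v => B0 n v.1)).
      by apply: bigcup_measurable => n _; exact: mB0.
    by apply/seteqP; split=> v [n _ h]; exists n.
  by apply/seteqP; split=> w [n _ h]; exists n => //; move: h; rewrite FE.
Qed.

Variables (om : word -> {RV P >-> borel Omega}) (X : word -> {RV P >-> borel S}).
Local Notation omf := (fun i => om i : W -> borel Omega).
Local Notation Xf := (fun i => X i : W -> borel S).
Local Notation root t w := (ev gd t (fun i => om i w) (fun i => X i w) [::]).
Local Notation leaf_root t w z := (ev gd t (fun i => om i w) (fun i => leaf i z) [::]).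

Let mo i : measurable_fun setT (om i : W -> borel Omega). Proof. by []. Qed.
Let mX i : measurable_fun setT (X i : W -> borel S). Proof. by []. Qed.

Let measurable_root t (A : set (borel S)) : measurable A -> measurable [set w | A (root t w)].
Proof.
move=> mA.
by apply: (@measurable_ev_event _ _ R d S g gd (standard_polish S) _ W t omf Xf [::] A mA).
Qed.

Let measurable_leaf_root t (A : set (borel S)) : measurable A ->
  measurable [set wz : W * borel (pow None S) | A (leaf_root t wz.1 wz.2)].
Proof.
move=> mA; apply: (@measurable_ev_event _ _ R d S g gd (standard_polish S) _
  (W * borel (pow None S))%type t (fun i wz => om i wz.1) (fun i wz => leaf i wz.2)
  [::] A mA) => i _.
  by apply: (measurableT_comp (mo i)); exact: measurable_fst.
by apply: (measurableT_comp (measurable_leaf i)); exact: measurable_snd.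
Qed.

Lemma rtp_of_stages :
  (forall t, (1 <= t)%N -> stage r P omf
    Xf mu t) ->
  {ae P, forall w, forall i : word,
    X i w = gam g (om i w) (fun j => X (rcons i (widen_idx (gd _) j)) w)} ->
  is_rtp r gd mu om X.
Proof.
move=> hs ae.
split=> [|t t1|//].
  split=> [i _ A mA|].
    rewrite (prE P (measurable_pre (mo i) mA)) (prE r mA).
    by rewrite (stage_lawo (hs (size i).+1 isT)).
  apply/independentP => // s A us FA.
  (* Finitely many maps lie above some finite depth, so one stage yields their independence. *)
  pose t := (\max_(i <- s) size i).+1.
  apply: (stage_indep (hs t isT) us) => i i_s.
  have st : (size i < t)%N by rewrite ltnS; exact: leq_bigmax_seq.
  rewrite /stage_field st.
  by have [_] := FA i i_s.
have ht := hs t t1; split; first split=> [i si A mA|].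
- rewrite (prE P (measurable_pre (mX i) mA)) (prE mu mA).
  by rewrite (stage_lawz ht si).
- apply/independentP => // s A us FA.
  apply: (stage_indep ht us) => i /FA [/= si FAi].
  by rewrite /stage_field si ltnn eqxx.
- move=> A B sA sB.
  have := @indep_group _ _ _ P _ _ (stage_field omf
    Xf t) (fun i => (size i < t)%N).
  move=> /(_ (fun i => @stage_field_measurable _ _ _ r _ _ _ _ _ _ _ _ _ i ht)
    (fun i => @stage_field_setI _ _ _ _ _ _ _ _ i) (fun i => @stage_field_setT _ _ _ _ _ _ _ _ i)
    (stage_indep ht)) iG.
  set G := fun b => <<s _ >> in iG.
  have GA : G false A.
    apply: sub_sigma_algebra2 sA => _ [i /= si [C mC <-]]; exists i.
      by rewrite /= si ltnn.
    by rewrite /stage_field si ltnn eqxx; exists C.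
  have GB : G true B.
    apply: sub_sigma_algebra2 sB => _ [i /= si [C mC <-]]; exists i => //.
    by rewrite /stage_field si; exists C.
  have Gm b : G b `<=` measurable.
    apply: smallest_sub; first exact: sigma_algebra_measurable.
    by move=> C [i _]; exact: (stage_field_measurable ht).
  have mA := Gm _ _ GA; have mB := Gm _ _ GB.
  rewrite !prE//; last exact: measurableI.
  rewrite -EFinM; congr EFin.
  have := iG [:: false; true] (fun b => if b then B else A) isT.
  rewrite !big_cons big_nil mulr1 !bigcap_seq_cons bigcap_seq big_nil setIT.
  by apply=> -[].
Qed.

Hypothesis rtp : is_rtp r gd mu om X.

Lemma rtp_om :
  (forall i A, measurable A -> pr P (om i @^-1` A) = pr r A) /\
  indep_fields P (fun i => preimages (om i : W -> borel Omega)).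
Proof.
have [[lo io] _ _] := rtp.
split=> [i A mA|]; first by rewrite /pr -(lo i I A mA).
have /independentP := io; move=> /(_ mo); apply: indep_fieldsW => i A FA.
exact: (conj I FA).
Qed.

(** Independence among the maps, among the values at depth [t] and between the two groups combine;
    all other words carry the trivial event [setT]. *)
Lemma rtp_stage t : (1 <= t)%N -> stage r P omf Xf mu t.
Proof.
move=> t1; have [lo io] := rtp_om.
have [_ /(_ _ t1) [[lX iX] oX] _] := rtp.
split => //.
- by move=> i A _; exact: lo.
- by move=> i A si mA; rewrite /pr -(lX i si A mA).
have /independentP := iX; move=> /(_ mX) {}iX.
move=> s A us FA.
pose s1 := [seq i <- s | (size i < t)%N]; pose s2 := [seq i <- s | size i == t].
have FA1 i : i \in s1 -> preimages (om i : W -> borel Omega) (A i).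
  by rewrite mem_filter => /andP[si /FA]; rewrite /stage_field si.
have FA2 i : i \in s2 -> size i = t /\ @preimages _ _ (borel S) (X i) (A i).
  rewrite mem_filter => /andP[/eqP si /FA].
  by rewrite /stage_field si ltnn eqxx.
have A3 i : i \in s -> i \notin s1 -> i \notin s2 -> A i = setT.
  move=> i_s; rewrite !mem_filter i_s !andbT => /negbTE n1 /negbTE n2.
  by have := FA i i_s; rewrite /stage_field n1 n2.
have -> : \bigcap_(i in [set` s]) A i =
    (\bigcap_(i in [set` s2]) A i) `&` (\bigcap_(i in [set` s1]) A i).
  apply/seteqP; split=> [w h|w [h2 h1] i i_s].
    by split=> i /=; rewrite mem_filter => /andP[_ /h].
  have [/h1//|n1] := boolP (i \in s1); have [/h2//|n2] := boolP (i \in s2).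
  by rewrite A3.
have u1 : uniq s1 by exact: filter_uniq.
have u2 : uniq s2 by exact: filter_uniq.
have sg1 : sigma_gen [set i | (size i < t)%N] omf
    (\bigcap_(i in [set` s1]) A i).
  apply: (@fin_bigcap_measurable _ (g_sigma_algebraType
    [set om i @^-1` A | i in [set i | (size i < t)%N] & A in measurable])).
    exact: finite_seq.
  move=> i /= i_s; apply: sub_sigma_algebra.
  have [B mB BE] := FA1 i i_s; exists i; last by exists B.
  by move: i_s; rewrite mem_filter => /andP[].
have sg2 : sigma_gen [set i | size i = t] Xf
    (\bigcap_(i in [set` s2]) A i).
  apply: (@fin_bigcap_measurable _ (g_sigma_algebraType
    [set X i @^-1` A | i in [set i | size i = t] & A in (measurable : set (set (borel S)))])).
    exact: finite_seq.
  move=> i /= i_s; apply: sub_sigma_algebra.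
  by have [si [B mB BE]] := FA2 i i_s; exists i => //; exists B.
transitivity (pr P (\bigcap_(i in [set` s2]) A i) * pr P (\bigcap_(i in [set` s1]) A i)).
  have m1 : measurable (\bigcap_(i in [set` s1]) A i).
    by apply: fin_bigcap_measurable => // i /FA1 [B mB <-]; exact: (measurable_pre (mo i) mB).
  have m2 : measurable (\bigcap_(i in [set` s2]) A i).
    by apply: fin_bigcap_measurable => // i /FA2 [_ [B mB <-]]; exact: (measurable_pre (mX i) mB).
  by apply: EFin_inj; rewrite EFinM -!prE//; [exact: oX|exact: measurableI].
rewrite iX// io// /s1 /s2 !big_filter mulrC.
rewrite [RHS](bigID (fun i => size i < t)%N)/=; congr (_ * _).
rewrite [RHS](bigID (fun i => size i == t))/= [X in _ * X]big_seq_cond.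
rewrite [X in _ * X]big1 ?mulr1; last first.
  move=> i /and3P[i_s n1 n2]; rewrite A3 ?pr_setT// mem_filter ?(negbTE n1)//.
  by rewrite (negbTE n2).
apply: eq_bigl => i; rewrite andbC; case: eqP => //= ->.
by rewrite ltnn.
Qed.

Lemma pr_root t (A : set (borel S)) : measurable A ->
  pr P ((X [::] @^-1` A) `+`
    [set w | A (root t w)]) = 0.
Proof.
move=> mA; have [_ _ [N [mN N0 NP]]] := rtp.
apply: (pr_setY_ae _ _ mN N0).
- exact: (measurable_pre (mX [::]) mA).
- exact: measurable_root.
- move=> w Nw; rewrite /= ev_const// => i; apply: contrapT => h.
  by apply/Nw/NP => /= /(_ i).
Qed.

(** The values at depth [t] may be replaced by fresh leaves jointly with any event of the maps
    above, since both settings realize the same stage. *)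
Lemma leaf_independence t B (A : set (borel S)) : (1 <= t)%N ->
  sigma_gen [set i | (size i < t)%N] omf B ->
  measurable A ->
  pr P (B `&` [set w | A (root t w)]) =
  pr (P \x iid_law mu)%E [set wz | B wz.1 /\
    A (leaf_root t wz.1 wz.2)].
Proof.
move=> t1 /sigma_gen_above[B0 mB0 ->] mA; have [lo io] := rtp_om.
pose C : set (stage_space (borel Omega) d S t) :=
  (fun v => B0 v.1) `&` [set v | A (ev gd t v.1 v.2 [::])].
have mC : measurable C.
  apply: measurableI => //.
  apply: (measurable_pre (@measurable_ev _ _ R d S g gd (standard_polish S) _
    (stage_space (borel Omega) d S t) t (@above _ _ _ _) (@at_depth _ _ _ _) [::] _ _) mA).
    by move=> i; rewrite addn0; exact: measurable_above.
  by move=> i; rewrite addn0; exact: measurable_at_depth.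
exact: (stage_unique (rtp_stage t1) (leaf_stage mu t mo lo io) mC).
Qed.

Lemma coalescent_of_endogenous : rtp_endogenous om X -> coalescent r g mu.
Proof.
move=> [Y [mY [N [mN N0 NP]]]] A mA.
have gen_meas (D : set word) : sigma_gen D omf `<=` measurable.
  apply: smallest_sub; first exact: sigma_algebra_measurable.
  by move=> _ [i _ [B mB <-]]; exact: (measurable_pre (mo i) mB).
pose F t := sigma_gen [set i : word | (size i < t)%N] omf.
have FY : <<s \bigcup_t F t >> (Y @^-1` A).
  apply: sub_sigma_algebra2 (mY A mA) => _ [i _ [B mB <-]].
  by exists (size i).+1 => //; apply: sub_sigma_algebra; exists i; [exact: ltnSn|exists B].
have YX : pr P ((X [::] @^-1` A) `+` (Y @^-1` A)) = 0.
  apply: (pr_setY_ae _ _ mN N0).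
  - exact: (measurable_pre (mX [::]) mA).
  - exact: (gen_meas _ _ (mY A mA)).
  - move=> w Nw; rewrite /= (_ : X [::] w = Y w)//.
    by apply: contrapT => h; apply/Nw/NP.
apply/cvgrPdist_lt => e e0; have e2 : 0 < e / 2 by rewrite divr_gt0.
have [|||t0 [B [FB Be]]] := @approx_sigma _ W R P F _ _ _ _ FY _ e2.
- by move=> t; exact: gen_meas.
- by move=> t; exact: smallest_sigma_algebra.
- move=> t s ts; apply: sub_sigma_algebra2 => _ [i it [C mC <-]]; exists i.
    exact: leq_trans it ts.
  by exists C.
(* Stages of the process are available from depth 1 on, hence the 1. *)
exists (maxn t0 1) => // t /=; rewrite geq_max => /andP[t0t t1].
rewrite sub0r normrN ger0_norm; last exact: pr_ge0.
have mB : measurable B := gen_meas _ _ FB.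
have FtB : F t B.
  apply: sub_sigma_algebra2 FB => _ [i it [C mC <-]]; exists i; last by exists C.
  exact: leq_trans it t0t.
pose V := [set w | A (root t w)].
have mV : measurable V.
  exact: measurable_root.
have VB : pr P (V `+` B) < e / 2.
  have mYA := gen_meas _ _ (mY A mA); have mXA := measurable_pre (mX [::]) mA.
  apply: le_lt_trans Be; apply: le_trans (pr_setY_triangle _ mV mXA mB) _.
  rewrite setYC (pr_root t mA) add0r.
  by apply: le_trans (pr_setY_triangle _ mXA mYA mB) _; rewrite YX add0r.
rewrite -(pr_disagree gd (rtp_stage t1) mA (measurableC mA)).
have H1 : pr P (V `\` B) < e / 2.
  apply: le_lt_trans VB; apply: pr_le; [exact: measurableD|exact: measurableY|].
  by move=> w h; left.
have H2 : pr P (B `&` ~` V) < e / 2.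
  apply: le_lt_trans VB; apply: pr_le; [exact: measurableD|exact: measurableY|].
  by move=> w h; right.
rewrite [ltRHS](splitr e); apply: le_lt_trans (ltrD H1 H2).
(* As [B] concerns maps above depth t, on [B] the root computed from fresh leaves misses [A] with
   the same probability as the root computed from the process. *)
have -> := leaf_independence t1 FtB (measurableC mA).
have -> : pr P (V `\` B) = pr (P \x iid_law mu)%E ((V `\` B) `*` setT).
  by rewrite pr_setX ?pr_setT ?mulr1//; exact: measurableD.
have ml : measurable [set wz : W * borel (pow None S) |
    A (leaf_root t wz.1 wz.2)].
  exact: measurable_leaf_root.
have mVB : measurable ((V `\` B) `*` (setT : set (borel (pow None S)))).
  by apply: measurableX => //; exact: measurableD.
have mBl : measurable [set wz : W * borel (pow None S) | B wz.1 /\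
    (~` A) (leaf_root t wz.1 wz.2)].
  apply: measurableI; last exact: measurableC.
  by rewrite -[X in measurable X]setTI; exact: measurable_fst.
have mVt : measurable [set wz : W * borel (pow None S) | V wz.1].
  by rewrite -[X in measurable X]setTI; exact: measurable_fst.
apply: le_trans (pr_setU_le _ mVB mBl); apply: pr_le.
- by apply: measurableI => //; exact: measurableC.
- exact: measurableU.
- move=> wz [h1 h2]; have [h|h] := pselect (B wz.1); first by right.
  by left.
Qed.

(** Condition (b) gives the law [mu] from depth 1 on; the root is one application of the maps to
    depth 1, so its law is T(mu). *)
Lemma root_law (A : set (borel S)) : Tmap r g mu =m mu -> measurable A ->
  pr P (X [::] @^-1` A) = pr mu A.
Proof.
move=> mu_fix mA.
have mV : measurable [set w | A (root 1 w)].
  exact: measurable_root.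
rewrite (pr_setY_eq (measurable_pre (mX [::]) mA) mV (pr_root 1 mA)).
have := @ev_root_law _ _ _ r d S g gd _ W P (standard_polish S) 1 _ _ mu A
  (rtp_stage (leqnn 1)) mA; move=> ->.
by have /eq_lawP := mu_fix; apply.
Qed.

Lemma endogenous_of_coalescent_base : Tmap r g mu =m mu ->
  (forall k, joint r g mu t (base k) (~` base k) @[t --> \oo] --> 0) ->
  rtp_endogenous om X.
Proof.
move=> mu_fix coal.
pose G : set (set W) := [set om i @^-1` A | i in setT & A in measurable].
have Gm : G `<=` measurable.
  by move=> _ [i _ [B mB <-]]; exact: (measurable_pre (mo i) mB).
have sGm : <<s G >> `<=` measurable.
  by apply: smallest_sub => //; exact: sigma_algebra_measurable.
have mb k := @measurable_base R S k.
have step k n : exists B, <<s G >> B /\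
    pr P ((X [::] @^-1` base k) `+` B) <= (2 ^ n.+1)%:R^-1.
  pose c : R := (2 ^ n.+1)%:R^-1; have c0 : 0 < c by rewrite invr_gt0 ltr0n expn_gt0.
  have c2 : 0 < c / 2 by rewrite divr_gt0.
  have /cvgrPdist_lt /(_ _ c2)[t0 _ Ht0] := coal k.
  pose t := maxn t0 1; have t1 : (1 <= t)%N by rewrite leq_maxr.
  have jt : joint r g mu t (base k) (~` base k) < c / 2.
    have := Ht0 t; rewrite /= leq_maxl sub0r normrN => /(_ isT).
    exact: le_lt_trans (ler_norm _).
  pose V := [set w | (base k : set S) (root t w)].
  (* For a fixed [z] this is an event of the maps alone, whereas [V] still uses the values of the
     process. *)
  pose U z := [set w | (base k : set S) (leaf_root t w z)].
  have mV : measurable V.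
    exact: (measurable_root t (mb k)).
  have sU z : <<s G >> (U z).
    apply: (measurable_pre (@measurable_ev _ _ R d S g gd (standard_polish S) _
      (g_sigma_algebraType G) t (fun i => om i : g_sigma_algebraType G -> borel Omega)
      (fun i _ => leaf i z) [::] _ _) (mb k)).
      by move=> i _ _ C mC; rewrite setTI; apply: sub_sigma_algebra; exists i => //; exists C.
    by move=> i _; exact: measurable_cst.
  pose E1 := [set wz : W * borel (pow None S) | V wz.1 /\ ~ U wz.2 wz.1].
  pose E2 := [set wz : W * borel (pow None S) | ~ V wz.1 /\ U wz.2 wz.1].
  have mV1 : measurable [set wz : W * borel (pow None S) | V wz.1].
    by rewrite -[X in measurable X]setTI; exact: measurable_fst.
  have mU1 : measurable [set wz : W * borel (pow None S) | U wz.2 wz.1].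
    exact: (measurable_leaf_root t (mb k)).
  have mE1 : measurable E1 by apply: measurableI => //; exact: measurableC.
  have mE2 : measurable E2 by apply: measurableI => //; exact: measurableC.
  have e1 : pr (P \x iid_law mu)%E E1 < c / 2.
    by rewrite -(pr_disagree gd (rtp_stage t1) (mb k) (measurableC (mb k))) in jt.
  have e2 : pr (P \x iid_law mu)%E E2 < c / 2.
    rewrite jointC// in jt; last exact: measurableC.
    by rewrite -(pr_disagree gd (rtp_stage t1) (measurableC (mb k)) (mb k)) in jt.
  have [z Hz] : exists z, pr P [set w | (E1 `|` E2) (w, z)] < c.
    apply: (@exists_section _ _ _ _ _ P (iid_law mu)); first exact: measurableU.
    rewrite [ltRHS](splitr c); apply: le_lt_trans (ltrD e1 e2).
    exact: pr_setU_le.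
  exists (U z); split => //; have mUz := sGm _ (sU z).
  apply: le_trans (pr_setY_triangle _ (measurable_pre (mX [::]) (mb k)) mV mUz) _.
  rewrite (pr_root t (mb k)) add0r; apply: ltW; apply: le_lt_trans Hz.
  apply: pr_le; first exact: measurableY.
    rewrite (_ : [set _ | _] = V `+` U z); first exact: measurableY.
    by apply/seteqP; split=> w [] [h1 h2]; [left|right|left|right].
  by move=> w [] [h1 h2]; [left|right].
have /choice[B HB] (kn : (nat * nat) * nat) := step kn.1 kn.2.
pose D k := lim_sup_set (fun n => B (k, n)).
have sD k : <<s G >> (D k).
  apply: (@bigcapT_measurable _ (g_sigma_algebraType G)) => n.
  by apply: (@bigcup_measurable _ (g_sigma_algebraType G)) => m _; case: (HB (k, m)).
have XD k : pr P ((X [::] @^-1` base k) `+` D k) = 0.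
  apply: limit_event => [|n|n]; first exact: (measurable_pre (mX [::]) (mb k)).
    by apply: sGm; case: (HB (k, n)).
  by case: (HB (k, n)).
have mXb k := measurable_pre (mX [::]) (mb k).
have mD k := sGm _ (sD k).
have [|Y [mY YD]] := @realize_base R S _ W P G D mu Gm sD.
  move=> l; rewrite -(pr_pat_setY _ mXb mD XD).
  by rewrite -(root_law mu_fix (measurable_pat l mb)).
have mYb k : measurable (Y @^-1` base k) by apply: sGm; exact: (measurable_pre mY (mb k)).
have YX k : pr P ((X [::] @^-1` base k) `+` (Y @^-1` base k)) = 0.
  apply/eqP; rewrite eq_le pr_ge0 andbT.
  apply: le_trans (pr_setY_triangle _ (mXb k) (mD k) (mYb k)) _.
  by rewrite XD add0r setYC YD.
exists Y; split; first by move=> C mC; exact: (measurable_pre mY mC).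
exists (\bigcup_k ((X [::] @^-1` base k) `+` (Y @^-1` base k))).
have mU : measurable (\bigcup_k ((X [::] @^-1` base k) `+` (Y @^-1` base k))).
  by apply: countable_bigcupT_measurable => [|k]; [exact: countableP|exact: measurableY].
split => //; first by apply: pr_eq0 => //; apply: pr_null_countable => // k; exact: measurableY.
by move=> w /= /(base_neq (f := X [::]))[k h]; exists k.
Qed.

End sample_space.
End recursive_tree_processes.

(** * Existence of the recursive tree process *)

Section stage_ext.
Context dO (Omega : measurableType dO) (R : realType) (r : probability Omega R).
Variable d : natbar.
Context (E : ptopologicalType).
Context dW (W : measurableType dW) (P : probability W R).

Lemma stage_ext (o : seq (idx d) -> W -> Omega) (z z' : seq (idx d) -> W -> E)
    (nu nu' : probability (borel E) R) s :
  nu =m nu' -> (forall i, size i = s -> z i = z' i) ->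
  stage r P o z nu s -> stage r P o z' nu' s.
Proof.
move=> nn zz hs; split.
- exact: stage_mo hs.
- by move=> i si; rewrite -zz//; exact: (stage_mz hs).
- by move=> i A si; exact: (stage_lawo hs).
- move=> i A si mA; rewrite -zz// (stage_lawz hs)//.
  by have /eq_lawP := nn; apply.
- apply: indep_fieldsW (stage_indep hs) => i A; rewrite /stage_field.
  by case: ifP => // _; case: eqP => // si; rewrite zz.
Qed.

End stage_ext.

Section existence.
Context (R : realType) (S Omega : polishType R).
Variables (r : probability (borel Omega) R) (g : random_map (borel Omega) S).
Variables (d : natbar) (gd : forall w, le_natbar (arity g w) d).
Variable mu : probability (borel S) R.
Hypothesis mu_fix : Tmap r g mu =m mu.
Local Notation word := (seq (idx d)).
Local Notation configuration := (config (borel Omega) d S).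

Local Notation W0 := (borel (pow None Omega) * borel (pow None S))%type.
Local Notation P0 := (iid_law r \x iid_law mu)%E.

Let o (i : word) (w : W0) : borel Omega := leaf i w.1.
Let z (i : word) (w : W0) : S := leaf i w.2.

Let base_stage t : stage r P0 o z mu t.
Proof.
apply: leaf_stage => [i|i A mA|]; first exact: measurable_leaf.
  exact: leaf_law.
exact: leaf_indep.
Qed.

(* For size i > t the truncated difference t - size i is 0, so the word i keeps
   its leaf value. *)
Definition truncated t (w : W0) : configuration :=
  (o^~ w, fun i => ev gd (t - size i) (o^~ w) (z^~ w) i).

(** The values at depth [s] have law T^(t - s) applied to [mu], which is [mu] again. *)
Let truncated_stage t s : (s <= t)%N ->
  stage r P0 o (fun i w => (truncated t w).2 i) mu s.
Proof.
move=> st; have := @ev_stage _ _ _ r d S g gd _ W0 P0 (standard_polish S) (t - s) o z mu s.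
rewrite subnK// => /(_ (base_stage t)); apply: stage_ext => [|i <-//].
exact: iter_Tmap_fix (standard_polish S) _ _ _ mu_fix.
Qed.

Local Notation key := ((word + word) * (nat * nat))%type.

Definition depth (k : key) : nat :=
  match k.1 with inl i => size i | inr i => size i end.

Definition key_event (k : key) : set configuration :=
  match k with
  | (inl i, m) => [set v | base m (v.1 i : Omega)]
  | (inr i, m) => [set v | base m (v.2 i)]
  end.

Definition shallow N (l : seq (key * bool)) := forall kb, kb \in l -> (depth kb.1 < N)%N.

Lemma shallow_max l : shallow (\max_(kb <- l) depth kb.1).+1 l.
Proof. by move=> kb kl; rewrite ltnS; exact: (leq_bigmax_seq _ kl). Qed.

Let pattern_prob t l := pr P0 (truncated t @^-1` pat key_event l).

Let measurable_truncated t k : measurable (truncated t @^-1` key_event k).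
Proof.
have mo i : measurable_fun setT (o i) by exact: (stage_mo (base_stage 0)).
have mz i : measurable_fun setT (z i : W0 -> borel S).
  exact: (stage_mz (base_stage (size i))).
case: k => [[i|i] m] /=.
  exact: (measurable_pre (mo i) (measurable_base m)).
exact: (measurable_pre (@measurable_ev _ _ R d S g gd (standard_polish S) _ W0
  (t - size i) o z i (fun i _ => mo i) (fun i _ => mz i)) (measurable_base m)).
Qed.

Let pat_preimage (T : Type) (f : T -> configuration) l :
  f @^-1` pat key_event l = pat (fun k => f @^-1` key_event k) l.
Proof. by []. Qed.

(** Leaves at depth t, and values at depth t computed from leaves at depth t + 1, form stages with
    the same law because [T(mu) = mu]. This is the consistency of the finite trees. *)
Let pattern_probS t l : shallow t l -> pattern_prob t l = pattern_prob t.+1 l.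
Proof.
move=> tl.
pose C : set (stage_space (borel Omega) d S t) := pat (fun k =>
  [set v | key_event k (v.1, fun i => ev gd (t - size i) v.1 v.2 i)]) l.
have mC : measurable C.
  apply: measurable_pat_in => -[[[i|i] m] b] /tl /= it.
    exact: (measurable_pre (@measurable_above _ (borel Omega) d S t i it) (measurable_base m)).
  apply: (measurable_pre (@measurable_ev _ _ R d S g gd (standard_polish S) _
    (stage_space (borel Omega) d S t) (t - size i) (@above _ _ _ _) (@at_depth _ _ _ _) i _ _)
    (measurable_base m)).
    by move=> j; rewrite subnK ?(ltnW it)//; exact: measurable_above.
  by move=> j; rewrite subnK ?(ltnW it)//; exact: measurable_at_depth.
have h1 := @stage_step _ _ _ r d S g gd _ W0 P0 (standard_polish S) o z mu t (base_stage t.+1).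
have {}h1 := stage_ext mu_fix (fun i _ => erefl) h1.
have := stage_unique (base_stage t) h1 mC.
rewrite /pattern_prob => E; rewrite (_ : truncated t @^-1` _ = collect o z @^-1` C)//.
rewrite E; congr pr; apply/seteqP; split=> w H [[[i|i] m] b] kl; have := H _ kl => //=.
- rewrite subSn ?(ltnW (tl _ kl))// -addn1 ev_add.
  by [].
- rewrite subSn ?(ltnW (tl _ kl))// -addn1 ev_add.
  by [].
Qed.

Let pattern_prob_stable s t l : shallow s l -> (s <= t)%N ->
  pattern_prob t l = pattern_prob s l.
Proof.
move=> sl /subnK <-; elim: (t - s)%N => //= n IH.
rewrite addSn -pattern_probS// => kb /sl h.
by apply: leq_trans h _; exact: leq_addl.
Qed.

(** The cut is made just below the deepest word in [l]; by consistency any deeper cut gives the same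
    value. *)
Let content l := pattern_prob (\max_(kb <- l) depth kb.1).+1 l.

Let contentE t l : shallow t l -> content l = pattern_prob t l.
Proof.
move=> tl; rewrite /content; set s := _.+1.
have sl : shallow s l by exact: shallow_max.
by rewrite -(pattern_prob_stable sl (leq_maxl s t)) (pattern_prob_stable tl (leq_maxr s t)).
Qed.

Let content_lit : lit_content content.
Proof.
have sh l : exists t, shallow t l by eexists; exact: shallow_max.
have lc t := pat_lit_content P0 (measurable_truncated t).
split.
- by rewrite (@contentE 0)//; exact: (lit_content0 (lc 0)).
- by move=> l; have [t tl] := sh l; rewrite (contentE tl); exact: (lit_content_ge0 (lc t)).
- move=> k l; have [t tl] := sh ((k, true) :: l).
  have tl' : shallow t l by move=> kb kl; apply: tl; rewrite inE kl orbT.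
  have tlf : shallow t ((k, false) :: l).
    move=> kb; rewrite inE => /orP[/eqP -> /=|/tl' //].
    by apply: (tl (k, true)); exact: mem_head.
  rewrite (contentE tl) (contentE tl') (contentE tlf).
  exact: (lit_content_split (lc t)).
- move=> l l' ll; have [t tl] := sh l.
  have tl' : shallow t l' by move=> kb; rewrite -ll => /tl.
  rewrite (contentE tl) (contentE tl').
  exact: (lit_content_ext (lc t)).
Qed.

Let shallow_gen N : set (set configuration) := [set pat key_event l | l in shallow N].
Let shallow_space N := g_sigma_algebraType (shallow_gen N).

Let shallow_key N k : (depth k < N)%N -> measurable (key_event k : set (shallow_space N)).
Proof.
move=> kN; apply: sub_sigma_algebra; exists [:: (k, true)].
  by move=> kb; rewrite inE => /eqP ->.
by rewrite pat_cons pat_nil setIT.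
Qed.

Let measurable_map N i : (size i < N)%N ->
  measurable_fun setT (fun v : shallow_space N => v.1 i : borel Omega).
Proof.
by move=> iN; apply: measurable_fun_base => m; exact: (@shallow_key N (inl i, m)).
Qed.

Let measurable_value N i : (size i < N)%N ->
  measurable_fun setT (fun v : shallow_space N => v.2 i : borel S).
Proof.
by move=> iN; apply: measurable_fun_base => m; exact: (@shallow_key N (inr i, m)).
Qed.

Section transfer.
Context dU (U : measurableType dU) (Q : probability U R) (f : U -> configuration).
Hypothesis mf : forall k, measurable (f @^-1` key_event k).

Let measurable_shallow N : measurable_fun setT (f : U -> shallow_space N).
Proof.
apply: (@measurability _ _ U (shallow_space N) setT _ (shallow_gen N)) => //.
by move=> _ [_ [l _ <-] <-]; rewrite setTI pat_preimage; exact: measurable_pat.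
Qed.

Hypothesis fQ : forall l, pr Q (f @^-1` pat key_event l) = content l.

(** Shallow patterns form a generating pi-system on which the realization [f] and the truncated tree
    agree; a realization of [content] therefore inherits every finite-depth property of truncated
    trees. *)
Lemma pr_shallow N (C : set (shallow_space N)) : measurable C ->
  pr Q (f @^-1` C) = pr P0 (truncated N @^-1` C).
Proof.
have mt : measurable_fun setT (truncated N : W0 -> shallow_space N).
  apply: (@measurability _ _ W0 (shallow_space N) setT _ (shallow_gen N)) => //.
  move=> _ [_ [l _ <-] <-]; rewrite setTI pat_preimage; apply: measurable_pat => k.
  exact: measurable_truncated.
move: C; have /eq_lawP H : law Q (@measurable_shallow N) =m law P0 mt; last exact: H.
apply: (@prob_unique _ (shallow_space N) R (shallow_gen N)) => //.
- exact: sub_sigma_algebra.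
- move=> _ _ [l lN <-] [l' lN' <-]; exists (l ++ l'); last exact: pat_cat.
  by move=> kb; rewrite mem_cat => /orP[/lN|/lN'].
- by move=> _ [l lN <-]; rewrite !pr_law fQ (contentE lN).
Qed.

Let om i u : borel Omega := (f u).1 i.
Let X i u : S := (f u).2 i.

Lemma transfer_stage s : stage r Q om X mu s.
Proof.
(* Stage [s] includes the values at depth [s] itself, so words of depth below s + 1 are needed. *)
pose N := s.+1.
have ht := truncated_stage (leqnSn s).
have mom i : measurable_fun setT (om i).
  apply: (measurableT_comp (measurable_map (leqnn (size i).+1))).
  exact: measurable_shallow.
have mX i : measurable_fun setT (X i : U -> borel S).
  apply: (measurableT_comp (measurable_value (leqnn (size i).+1))).
  exact: measurable_shallow.
split => //.
- move=> i A si mA; rewrite -(stage_lawo ht si mA).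
  have iN : (size i < N)%N by rewrite ltnS ltnW.
  exact: (pr_shallow (measurable_pre (measurable_map iN) mA)).
- move=> i A si mA; rewrite -(stage_lawz ht si mA).
  have iN : (size i < N)%N by rewrite si.
  exact: (pr_shallow (measurable_pre (measurable_value iN) mA)).
move=> l A ul FA.
have /choice[A' HA'] i : exists A' : set (shallow_space N), measurable A' /\
    (i \in l -> f @^-1` A' = A i /\ stage_field o (fun i w => (truncated N w).2 i) s i
      (truncated N @^-1` A')).
  have [/FA|_] := boolP (i \in l); last by exists setT.
  rewrite /stage_field; case: ltnP => [si [B mB BE]|_].
    have iN : (size i < N)%N by rewrite ltnS ltnW.
    exists [set v | B (v.1 i)]; split; first exact: (measurable_pre (measurable_map iN) mB).
    by split => //; exists B.
  case: eqP => [si [B mB BE]|_ ->]; last first.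
    by exists setT; split => //; split; rewrite preimage_setT.
  have iN : (size i < N)%N by rewrite si.
  exists [set v | B (v.2 i)]; split; first exact: (measurable_pre (measurable_value iN) mB).
  by split => //; exists B.
have mA' i : measurable (A' i) by case: (HA' i).
transitivity (pr Q (f @^-1` (\bigcap_(i in [set` l]) A' i))).
  congr pr; rewrite preimage_bigcap; apply: eq_bigcapr => i i_l.
  by have [_ /(_ i_l)[]] := HA' i.
rewrite pr_shallow; last by apply: fin_bigcap_measurable.
rewrite preimage_bigcap (stage_indep ht ul); last first.
  by move=> i i_l; have [_ /(_ i_l)[]] := HA' i.
apply: eq_big_seq => i i_l; have [_ /(_ i_l)[<- _]] := HA' i.
by rewrite pr_shallow.
Qed.

(** In a tree truncated deep enough the recursion at a word holds exactly. Its failure as seen by a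
    single ball is a finite-depth event, hence null after transfer, and there are countably many
    words and balls. *)
Lemma transfer_recursion : Q.-negligible (~` [set u | forall i,
  X i u = node (g := g) gd (om i u) (fun j => X (rcons i j) u)]).
Proof.
(* The children of the word have depth one more than its own, so two more bounds both strictly. *)
pose C (im : word * (nat * nat)) : set (shallow_space (size im.1).+2) :=
  [set v | base im.2 (v.2 im.1)] `+`
  [set v | base im.2 (node (g := g) gd (v.1 im.1) (fun j => v.2 (rcons im.1 j)))].
have mC im : measurable (C im).
  apply: measurableY; first exact: (measurable_pre (measurable_value (leqnSn _)) (measurable_base im.2)).
  apply: (measurable_pre (@measurable_node _ _ R d S g gd (standard_polish S) _
    (shallow_space (size im.1).+2) _ _ _ _) (measurable_base im.2)).
    exact: measurable_map.
  by move=> j; apply: measurable_value; rewrite size_rcons.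
have mfC im : measurable (f @^-1` C im) by exact: (measurable_pre (@measurable_shallow _) (mC im)).
exists (\bigcup_im (f @^-1` C im)).
have mU : measurable (\bigcup_im (f @^-1` C im)).
  by apply: countable_bigcupT_measurable => //; exact: countableP.
split => //.
  apply: pr_eq0 => //; apply: pr_null_countable => // im.
  rewrite pr_shallow//; rewrite (_ : _ @^-1` _ = set0) ?pr_set0//.
  have e (w : W0) : (truncated (size im.1).+2 w).2 im.1 =
      node (g := g) gd ((truncated (size im.1).+2 w).1 im.1)
        (fun j => (truncated (size im.1).+2 w).2 (rcons im.1 j)).
    rewrite /truncated /= [X in ev _ X](_ : _ = 2%N); last by rewrite -addn2 addKn.
    by congr (node _ _ _); apply/funext => j; rewrite size_rcons subSS subSnn.
  by apply/seteqP; split => // w [] /= []; rewrite -e.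
move=> u /= /existsNP[i /(base_neq (f := X i) (f' := fun u => node gd (om i u) _))[m h]].
by exists (i, m).
Qed.

End transfer.

Lemma rtp_exists :
  exists (om : word -> {RV (@unif01 R) >-> borel Omega})
    (X : word -> {RV (@unif01 R) >-> borel S}), is_rtp r gd mu om X.
Proof.
pose E (j : word + word) : polishType R := match j with inl _ => Omega | inr _ => S end.
pose nu j : probability (borel (E j)) R :=
  match j return probability (borel (E j)) R with inl _ => r | inr _ => mu end.
have [|Y [mY _ pY]] := @realize_family R _ E nu _ content_lit.
  move=> [i|i] l; rewrite (@contentE (size i).+1); try by move=> _ /mapP[x _ ->].
    rewrite /pattern_prob pat_preimage (pat_map _ (fun m => (inl i, m))).
    have hs := base_stage (size i).+1.
    by rewrite -(stage_lawo hs (ltnSn _) (measurable_pat l (@measurable_base R Omega))).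
  rewrite /pattern_prob pat_preimage (pat_map _ (fun m => (inr i, m))).
  have hs := truncated_stage (leqnSn (size i)).
  by rewrite -(stage_lawz hs erefl (measurable_pat l (@measurable_base R S))).
pose f u : configuration := (fun i => Y (inl i) u, fun i => Y (inr i) u).
have YE k : f @^-1` key_event k = Y k.1 @^-1` @base R (E k.1) k.2 by case: k => -[i|i] m.
have mf k : measurable (f @^-1` key_event k).
  by rewrite YE; exact: (measurable_pre (mY k.1) (measurable_base k.2)).
have fQ l : pr (@unif01 R) (f @^-1` pat key_event l) = content l.
  by rewrite -pY pat_preimage; congr (pr _ (pat _ _)); apply/funext => k; exact: YE.
have mom i : measurable_fun setT (Y (inl i) : measurableTypeR R -> borel Omega) := mY (inl i).
have mX i : measurable_fun setT (Y (inr i) : measurableTypeR R -> borel S) := mY (inr i).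
exists (fun i => mfun_Sub (mem_set (mom i))), (fun i => mfun_Sub (mem_set (mX i))).
apply: rtp_of_stages => [t t1|].
  exact: (transfer_stage mf fQ).
exact: (transfer_recursion mf fQ).
Qed.

End existence.

Theorem theorem1 (R : realType) (S Omega : polishType R)
    (r : probability (borel Omega) R) (g : random_map (borel Omega) S)
    (d : natbar) (d_pos : d <> Some 0%N)
    (gd : forall w, le_natbar (arity g w) d)
    (mu : probability (borel S) R) (mu_fix : Tmap r g mu =m mu) :
  [<-> endogenous r gd mu;
       [/\ has_marginals mu (diag_law (Some 2%N) mu),
           symmetric_law (diag_law (Some 2%N) mu),
           Tmap r (nvariate (Some 2%N) g) (diag_law (Some 2%N) mu)
             =m diag_law (Some 2%N) mu
         & forall nu : probability (borel (pow (Some 2%N) S)) R,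
             has_marginals mu nu -> symmetric_law nu ->
             Tmap r (nvariate (Some 2%N) g) nu =m nu ->
             nu =m diag_law (Some 2%N) mu];
       forall (n : natbar), n <> Some 0%N ->
         forall nu : probability (borel (pow n S)) R, has_marginals mu nu ->
           weak_cvg (fun t => iter t (Tmap r (nvariate n g)) nu)
             (diag_law n mu)].
Proof.
tfae.
- move=> endo; apply: unique_of_coalescent => //.
  have [om [X rtp]] := rtp_exists gd mu_fix.
  exact: (coalescent_of_endogenous rtp (endo _ _ _ om X rtp)).
- move=> [_ _ _ uniq] n n0 nu /has_marginalsP mnu.
  apply: weak_cvg_of_coalescent => //.
  exact: coalescent_of_unique.
- move=> wc dW W P om X rtp; apply: (endogenous_of_coalescent_base rtp) => //.
  apply: (coalescent_base_of_weak mu_fix); apply: (wc two) => //.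
  by apply/has_marginalsP; exact: prod2_marg.
Qed.
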